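(* Let $X_1,X_2,\ldots$ be i.i.d. random vectors in $\mathbb{R}^2$ with $\mathbb{E}(X_i)=\mu_0$, $\mathbb{E}\|X_i\|^2<\infty$, and positive definite covariance matrix $\Sigma=\operatorname{Var}(X_i)$. Let $\Theta=\{\mu=(\mu_1,\mu_2)^\top\in\mathbb{R}^2:\mu_1\le\mu_2\}$ and suppose that $\mu_0\in\operatorname{int}(\Theta)$, i.e. $\mu_{01}<\mu_{02}$. Then, as $n\to\infty$, the constrained empirical log-likelihood ratio based on $X_1,\ldots,X_n$ satisfies $$\ell_{\Theta,n}(\mu_0)\ \xrightarrow{d}\ \chi^2_2 .$$
   Context: For $\mu\in\mathbb{R}^2$ the normalized empirical likelihood based on $X_1,\ldots,X_n$ is $$L_n(\mu)=\sup\Big\{\prod_{i=1}^n(np_i):\ p_i\ge0,\ \sum_{i=1}^np_i=1,\ \sum_{i=1}^np_i(X_i-\mu)=0\Big\},$$ where the supremum over the empty set is $0$. Put $\ell_n(\mu)=-2\log L_n(\mu)$, with value $+\infty$ if $L_n(\mu)=0$. Let $\mathcal{D}_{\Theta,n}$ be the event $\{\sup_{\nu\in\Theta}L_n(\nu)>0\}$. For $\mu\in\Theta$, on $\mathcal{D}_{\Theta,n}$ the constrained empirical log-likelihood ratio is $$\ell_{\Theta,n}(\mu)=-2\log\frac{L_n(\mu)}{\sup_{\nu\in\Theta}L_n(\nu)}=\ell_n(\mu)-\inf_{\nu\in\Theta}\ell_n(\nu),$$ and by convention $\ell_{\Theta,n}(\mu)=0$ on the complement of $\mathcal{D}_{\Theta,n}$.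 $\chi^2_k$ denotes the chi-square distribution with $k$ degrees of freedom and $\xrightarrow{d}$ denotes convergence in distribution. *)

(* Defs.v *)
From HB Require Import structures.
From mathcomp Require Import all_boot all_order all_algebra finmap.
From mathcomp Require Import all_classical all_reals all_analysis.
From mathcomp Require Import measurable_realfun.

Set Implicit Arguments.
Unset Strict Implicit.
Unset Printing Implicit Defensive.
Import Order.TTheory GRing.Theory Num.Theory.
Import numFieldNormedType.Exports.
Local Open Scope classical_set_scope.
Local Open Scope ring_scope.

Section EmpiricalLikelihood.
Context {R : realType} {V : lmodType R}.
Implicit Types (n : nat) (x : nat -> V) (mu : V) (Theta : set V).

(* The sample of size n is x 0, ..., x n.-1. *)
Definition EL_values n x mu : set R :=
  [set \prod_(i < n) (n%:R * p i) | p in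
    [set p : 'I_n -> R | [/\ forall i, 0 <= p i,
                             \sum_(i < n) p i = 1
                           & \sum_(i < n) p i *: (x i - mu) = 0]]].

(* [sup set0] is 0, as required of an infeasible [mu]. *)
Definition EL n x mu : R := sup (EL_values n x mu).

(* [EL_values_le1] and [EL_le1] bound the sets whose [sup] is taken here and
   below, so that no [sup] is the default value of an unbounded set. *)
Lemma EL_values_le1 n x mu : ubound (EL_values n x mu) 1.
Proof.
move=> _ [p [p0 p1 _] <-].
case: n x p p0 p1 => [|n] x p p0 p1.
  by rewrite big_ord0.
have /leifP := @leif_AGM R _ [set: 'I_n.+1]%SET (fun i => n.+1%:R * p i)
  (fun i _ => mulr_ge0 (ler0n _ _) (p0 i)).
have E (op : R -> R -> R) idx (F : 'I_n.+1 -> R) :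
    \big[op/idx]_(i in [set: 'I_n.+1]%SET) F i = \big[op/idx]_i F i.
  by apply: eq_bigl => i; rewrite inE.
rewrite !E cardsT card_ord -mulr_sumr p1 mulr1 divff ?pnatr_eq0 // expr1n.
by case: ifP => _ => [/eqP ->|/ltW].
Qed.

Lemma EL_le1 n x mu : EL n x mu <= 1.
Proof.
rewrite /EL; have [->|/set0P ne] := eqVneq (EL_values n x mu) set0.
  by rewrite sup0 ler01.
exact: ge_sup ne (@EL_values_le1 n x mu).
Qed.

Definition EL_sup Theta n x : R := sup [set EL n x nu | nu in Theta].

(* [lne 0] is -oo, hence [neg2log 0] is +oo. *)
Definition neg2log (r : R) : \bar R := ((-2)%:E * lne r%:E)%E.

Definition ell Theta n x mu : \bar R :=
  if 0 < EL_sup Theta n x then neg2log (EL n x mu / EL_sup Theta n x) else 0%E.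

End EmpiricalLikelihood.

Section Probability.
Context d (T : measurableType d) (R : realType) (P : probability T R).
Local Open Scope ereal_scope.

Definition mutually_independent d' (U : measurableType d')
    (X : nat -> {RV P >-> U}) : Prop :=
  forall (J : {fset nat}) (A : nat -> set U),
    (forall i, measurable (A i)) ->
    P (\bigcap_(i in [set` J]) (X i @^-1` A i)) =
    \prod_(i <- J) P (X i @^-1` A i).

Definition identically_distributed d' (U : measurableType d')
    (X : nat -> {RV P >-> U}) : Prop :=
  forall i j (A : set U), measurable A ->
    distribution P (X i) A = distribution P (X j) A.

(* The variables may take the value +oo or -oo; the limit [nu] is a probability
   on R, so the convergence of the distribution functions at finite points
   leaves no mass at infinity in the limit. *)
Definition cvg_in_distribution (Y : nat -> T -> \bar R)
    (nu : set R -> \bar R) : Prop :=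
  (forall n, measurable_fun [set: T] (Y n)) /\
  forall t : R, {for t, continuous (fun s : R => nu `]-oo, s]%classic)} ->
    P [set w | Y n w <= t%:E] @[n --> \oo] --> nu `]-oo, t]%classic.

Definition coord2 (v : R * R) (i : 'I_2) : R := if i == 0%R then v.1 else v.2.

Definition sqnorm2 (v : R * R) : R := (\sum_(i < 2) coord2 v i ^+ 2)%R.

Definition covariance_mx (X : {RV P >-> (R * R)%type}) : 'M[R]_2 :=
  (\matrix_(i, j) fine (covariance P (fun w => coord2 (X w) i)
                                     (fun w => coord2 (X w) j)))%R.

End Probability.

Definition posdef_mx (R : realType) n (M : 'M[R]_n) : Prop :=
  M^T = M /\ forall u : 'cV[R]_n, u != 0 -> 0 < (u^T *m M *m u) 0 0.

Section ChiSquare.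
Context {R : realType}.
Notation leb := (@lebesgue_measure R).

Definition Gamma (a : R) : R :=
  \int[leb]_(t in `]0, +oo[) (t `^ (a - 1) * expR (- t)).

(* For k = 0 there is no density: [chi_square] is meant for k >= 1. *)
Definition chi_square_pdf (k : nat) (t : R) : R :=
  if 0 < t then
    t `^ (k%:R / 2 - 1) * expR (- (t / 2)) / (2 `^ (k%:R / 2) * Gamma (k%:R / 2))
  else 0.

Definition chi_square (k : nat) (A : set R) : \bar R :=
  (\int[leb]_(t in A) (chi_square_pdf k t)%:E)%E.

End ChiSquare.

Definition order_cone (R : realType) : set (R * R) := [set mu | mu.1 <= mu.2].

(* Main.v *)
(**
Let [z_i = A (X_i - mu0)], with [A] triangular such that [z_i] has mean 0 and
covariance matrix [I], let [zbar] be the mean of [z_1, ..., z_n] and let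
[Q_n = n |zbar|^2].

The likelihood ratio is sandwiched without solving for the Lagrange multiplier.
By weak duality and the AM-GM inequality, [EL <= prod (1 + zbar . z_i)^-1]; and
the weights [(1 - c . (z_i - zbar)) / n], with [c = V^-1 zbar] for the sample
covariance matrix [V], are feasible.  Hence [-2 log EL = Q_n (1 + o(1))] as soon
as [V] is close to [I] and [|zbar| max |z_i|] is small.  With probability tending
to 1 the mean of the sample lies in the cone, where the constrained supremum of
the likelihood is then 1.

For [Q_n], let [v(t, u) = exp (- |u|^2 / 2 t) / t], a solution of the heat
equation.  Lindeberg's telescoping compares [n E v(s n, z_1 + ... + z_n)] with
[n v(s n + n, 0)], so [E exp (- Q_n / 2 s)] tends to [s / (s + 1)].  For
[s = 1 / k] this says that the moments of [exp (- Q_n / 2)] tend to those of the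
uniform distribution on the unit interval, and Bernstein polynomials turn
this into convergence in distribution.  Laplace transforms also yield the weak law
of large numbers for integrable nonnegative variables.
*)
Require Import Defs.
From HB Require Import structures.
From mathcomp Require Import finmap zify ring lra.
From mathcomp Require Import all_boot all_order all_algebra.
From mathcomp Require Import all_classical all_reals all_analysis.
From mathcomp Require Import measurable_realfun.
Import Order.TTheory GRing.Theory Num.Theory.
Import numFieldNormedType.Exports.
Local Open Scope classical_set_scope.
Local Open Scope ring_scope.

Set Implicit Arguments.
Unset Strict Implicit.
Unset Printing Implicit Defensive.

(** * The chi-square distribution with two degrees of freedom *)

(** The limit law is exponential, since the chi-square density with two degrees of freedom is
    [expR (- t / 2) / 2]; this is why Laplace transforms and moments on a bounded interval can take
    the place of characteristic functions. Up to the factor [s n], the variable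
    [expR (- Q_n / (2 s))] is a heat kernel at the sum of the [z_i], so second-order Taylor
    expansions, uniform in the base point, suffice to follow its expectation.

    Two obstacles shape the rest. Only second moments are available: the Taylor remainder has to be
    the minimum of a second-order and a third-order bound, and the law of large numbers for the
    squares has to work without a variance. Moreover, convergence in distribution includes the
    measurability of the ratio, a quotient of suprema over uncountable sets of weights, for which a
    countable description is needed.

    The matrix [A] is triangular because two square roots of numbers then suffice, and an invertible
    affine map of the sample does not affect the likelihood. *)

Section ChiSquareCdf.
Context {R : realType}.
Notation leb := (@lebesgue_measure R).

Lemma Gamma1 : Gamma 1 = 1 :> R.
Proof.
rewrite /Gamma /Rintegral.
rewrite (_ : (\int[leb]_(x in `]0%R, +oo[) (x `^ (1 - 1) * expR (- x))%:E)%E = 1%E) //.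
rewrite -(integral_exponential_pdf (@ltr01 R)).
rewrite [RHS](_ : _ = \int[leb]_(x in `[0%R, +oo[) (exponential_pdf 1 x)%:E)%E; last first.
  rewrite [RHS]integral_mkcond; apply: eq_integral => x _.
  rewrite patchE; case: ifPn => //; rewrite notin_setE /= in_itv /= andbT => /negP.
  by rewrite -ltNge => x0; rewrite lt0_exponential_pdf.
rewrite -integral_itv_obnd_cbnd; last first.
  apply/measurable_funTS/measurableT_comp => //.
  exact: measurable_exponential_pdf.
apply: eq_integral => x; rewrite mem_setE in_itv /= andbT => x0.
by rewrite subrr powRr0 mul1r exponential_pdfE ?ltW // mul1r mulN1r.
Qed.

(** For [k = 2] the power of [t] in the density disappears, which leaves the exponential density of
    rate 1/2. The maximum with 0 covers negative [t]. *)
Lemma chi_square2_cdf (t : R) :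
  chi_square 2 `]-oo, t] = (1 - expR (- (Num.max t 0 / 2)))%:E.
Proof.
have pdfE x : 0 < x -> chi_square_pdf 2 x = exponential_pdf (2^-1 : R) x.
  move=> x0; rewrite /chi_square_pdf x0 exponential_pdfE ?ltW //.
  have d2 : (2%:R / 2 : R) = 1 by rewrite divff.
  rewrite d2 subrr powRr0 mul1r Gamma1 powRr1 // mulr1.
  by rewrite mulrC mulNr [x * _]mulrC.
rewrite /chi_square.
transitivity (\int[leb]_(x in `]0%R, t]) (exponential_pdf (2^-1 : R) x)%:E)%E.
  rewrite integral_mkcond [RHS]integral_mkcond; apply: eq_integral => x _.
  rewrite !patchE !mem_setE !in_itv /=.
  case: (ltP 0 x) => x0 /=; first by rewrite pdfE.
  by case: ifP => // _; rewrite /chi_square_pdf ltNge x0.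
case: (ltP 0 t) => t0; last first.
  rewrite set_itv_ge ?integral_set0; last by rewrite bnd_simp -leNgt.
  by rewrite mul0r oppr0 expR0 subrr.
rewrite integral_itv_obnd_cbnd; last first.
  apply/measurable_funTS/measurableT_comp => //.
  exact: measurable_exponential_pdf.
rewrite -[LHS]/(exponential_prob 2^-1 `[0, t]) exponential_prob_itv0c //.
by rewrite EFinB mulNr [t * _]mulrC.
Qed.

End ChiSquareCdf.

(** * Bernstein polynomials *)

Section BernsteinMeans.
Context {R : realType}.
Implicit Types (g h : nat -> R) (p q : {poly R}) (v c e : R).

(* The polynomial [v |-> E (g N)] for [N] binomial with parameters [m] and [v]. *)
Fixpoint binmean m g : {poly R} :=
  if m is m'.+1 then (1 - 'X) * binmean m' g + 'X * binmean m' (g \o S)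
  else (g 0%N)%:P.

Lemma horner_binmeanS m g v :
  (binmean m.+1 g).[v] = (1 - v) * (binmean m g).[v] + v * (binmean m (g \o S)).[v].
Proof. by rewrite /= !hornerE. Qed.

Lemma binmean_le m g h v : 0 <= v <= 1 -> (forall j, g j <= h j) ->
  (binmean m g).[v] <= (binmean m h).[v].
Proof.
move=> /andP[v0 v1]; elim: m g h => [|m IH] g h gh; first by rewrite !hornerE.
rewrite !horner_binmeanS lerD // ler_wpM2l ?subr_ge0 //; apply: IH => // j.
exact: gh.
Qed.

Lemma binmeanD m g h : binmean m (g \+ h) = binmean m g + binmean m h.
Proof.
elim: m g h => [|m IH] g h /=; first by rewrite polyCD.
by rewrite IH (IH (g \o S) (h \o S)); ring.
Qed.

Lemma binmeanZ m a g : binmean m (a \*o g) = a *: binmean m g.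
Proof.
elim: m g => [|m IH] g /=; first by rewrite polyCM mul_polyC.
by rewrite IH (IH (g \o S)) -!mul_polyC; ring.
Qed.

Lemma binmean_cst m c : binmean m (fun=> c) = c%:P.
Proof. by elim: m => //= m IH; rewrite !IH; ring. Qed.

Lemma binmean0 m g : (binmean m g).[0] = g 0%N.
Proof.
elim: m g => [|m IH] g; first by rewrite !hornerE.
by rewrite horner_binmeanS IH subr0 mul1r mul0r addr0.
Qed.

Lemma binmean1 m g : (binmean m g).[1] = g m.
Proof.
elim: m g => [|m IH] g; first by rewrite !hornerE.
by rewrite horner_binmeanS !IH subrr mul0r add0r mul1r.
Qed.

Lemma binmean_sqr m (a v : R) :
  (binmean m (fun j => (j%:R - a) ^+ 2)).[v] =
  m%:R * v * (1 - v) + (m%:R * v - a) ^+ 2.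
Proof.
elim: m a => [|m IH] a; first by rewrite /= !hornerE; ring.
rewrite horner_binmeanS IH.
rewrite (_ : _ \o S = (fun j => (j%:R - (a - 1)) ^+ 2)); last first.
  by apply: funext => j /=; rewrite -natr1; ring.
by rewrite IH -natr1; ring.
Qed.

Lemma binmean_diff m g :
  binmean m (fun j => g j.+1 - g j) = binmean m (g \o S) - binmean m g.
Proof.
have -> : (fun j => g j.+1 - g j) = (g \o S) \+ ((-1) \*o g).
  by apply: funext => j /=; rewrite mulN1r.
by rewrite binmeanD binmeanZ scaleN1r.
Qed.

(** The derivative of a Bernstein polynomial is the Bernstein polynomial of the forward differences.
    Its use is to exhibit [binmean m g] as a derivative. *)
Lemma deriv_binmean m g :
  (binmean m g)^`() = m%:R *: binmean m.-1 (fun j => g j.+1 - g j).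
Proof.
elim: m g => [|m IH] g; first by rewrite /= derivC scale0r.
rewrite [binmean _ g]/= derivD !derivM derivB derivX derivC !IH.
have E : binmean m (g \o S) = binmean m g + binmean m (fun j => g j.+1 - g j).
  by rewrite binmean_diff addrC subrK.
rewrite E; case: m {IH E} => [|m]; first by rewrite !scale0r scale1r; ring.
rewrite [m.+2%:R]mulrS scalerDl scale1r [m.+2.-1]/= [m.+1.-1]/=.
set D := fun j => g j.+1 - g j.
rewrite -[fun j => (g \o S) j.+1 - _]/(D \o S) [binmean m.+1 D]/=.
by rewrite -!mul_polyC; ring.
Qed.

(** The integral over the unit interval, computed on coefficients: it is the linear functional that
    the limiting moments [k.+1%:R^-1] determine. *)
Definition unit_integral p : R := \sum_(i < size p) p`_i / i.+1%:R.

Lemma unit_integral_widen n p : (size p <= n)%N ->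
  unit_integral p = \sum_(i < n) p`_i / i.+1%:R.
Proof.
move=> pn; rewrite /unit_integral (big_ord_widen n (fun i => p`_i / i.+1%:R)) //.
rewrite big_mkcond /=; apply: eq_bigr => i _.
by case: ifPn => //; rewrite -leqNgt => /leq_sizeP ->; rewrite ?mul0r.
Qed.

Lemma unit_integralD p q : unit_integral (p + q) = unit_integral p + unit_integral q.
Proof.
have [[sp sq] spq] := (leq_maxl (size p) (size q), leq_maxr (size p) (size q),
  size_polyD p q).
rewrite (unit_integral_widen sp) (unit_integral_widen sq) (unit_integral_widen spq).
by rewrite -big_split; apply: eq_bigr => i _ /=; rewrite coefD mulrDl.
Qed.

Lemma unit_integralC c : unit_integral c%:P = c.
Proof.
by rewrite (@unit_integral_widen 1) ?size_polyC_leq1 // big_ord1 coefC divr1.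
Qed.

Lemma unit_integralZ a p : unit_integral (a *: p) = a * unit_integral p.
Proof.
rewrite (unit_integral_widen (size_scale_leq a p)) mulr_sumr.
by apply: eq_bigr => i _; rewrite coefZ mulrA.
Qed.

Lemma unit_integral_deriv p : unit_integral p^`() = p.[1] - p.[0].
Proof.
rewrite horner_coef0 (@horner_coef_wide _ (size p).+1) //.
rewrite big_ord_recl expr1n mulr1 [_ + _ - _]addrAC subrr add0r.
rewrite (@unit_integral_widen (size p)); last first.
  exact: leq_trans (size_poly _ _) (leq_pred _).
apply: eq_bigr => i _; rewrite coef_deriv expr1n mulr1 lift0.
by rewrite -[X in X / _]mulr_natr mulfK // pnatr_eq0.
Qed.

(** Up to the factor [m.+1], [binmean m g] is the derivative of the Bernstein polynomial of the
    partial sums [G], whose values at 0 and 1 are [G 0] and [G m.+1]. All Bernstein basis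
    polynomials thus have the same integral. *)
Lemma unit_integral_binmean m g :
  unit_integral (binmean m g) = (\sum_(i < m.+1) g i) / m.+1%:R.
Proof.
pose G k := \sum_(i < k) g i.
have := deriv_binmean m.+1 G; rewrite [m.+1.-1]/= => /(congr1 unit_integral).
rewrite unit_integral_deriv binmean0 binmean1 unit_integralZ {2}/G big_ord0 subr0.
move=> E; rewrite -/(G m.+1) E mulrAC divff ?pnatr_eq0 // mul1r.
congr (unit_integral (binmean m _)); apply: funext => j.
by rewrite /G big_ord_recr /= [_ + g j]addrC addrK.
Qed.

Lemma sum_leq_nat J k : \sum_(i < k) (J <= i)%N%:R = (k - J)%N%:R :> R.
Proof.
elim: k => [|k IH]; first by rewrite big_ord0.
rewrite big_ord_recr /= IH -natrD; congr _%:R.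
by lia.
Qed.

Lemma binmean_add_sqr m g (a v b : R) :
  (binmean m (fun j => g j + b * (j%:R - a) ^+ 2)).[v] =
  (binmean m g).[v] + b * (m%:R * v * (1 - v) + (m%:R * v - a) ^+ 2).
Proof.
rewrite -binmean_sqr (binmeanD m g (fun j => b * (j%:R - a) ^+ 2)) hornerD.
by rewrite (binmeanZ m b (fun j => (j%:R - a) ^+ 2)) hornerZ.
Qed.

Lemma binmean_step_moment m J :
  unit_integral (binmean m (fun j => (J <= j)%N%:R)) = (m.+1 - J)%N%:R / m.+1%:R :> R.
Proof. by rewrite unit_integral_binmean sum_leq_nat. Qed.

(* Chebyshev's inequality for the binomial distribution, whose variance is
   [m v (1 - v)], compares [v >= c] with a slightly shifted threshold for
   the binomial variable. *)
Lemma step_sandwich c e : 0 <= c <= 1 -> 0 < e ->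
  exists p q, [/\ unit_integral p <= 1 - c + e, 1 - c - e <= unit_integral q &
    forall v, 0 <= v <= 1 -> q.[v] <= (c <= v)%R%:R <= p.[v]].
Proof.
(* One [r] pays for shifting the threshold, two for rounding it to an integer, one for Chebyshev. In
   the choice of [m] below, [r ^- 3] serves the last and [r ^- 1] the rounding. *)
move=> /andP[c0 c1] e0; pose r := e / 4.
have r0 : 0 < r by rewrite divr_gt0.
have [m [m0 mr]] : exists m, 0 < m%:R :> R /\ r ^- 3 + r ^- 1 < m%:R.
  exists (Num.truncn (r ^- 3 + r ^- 1)).+1.
  by rewrite ltr0n; split => //; exact: truncnS_gt.
have rmr : (m%:R * r ^+ 2)^-1 <= r.
  rewrite -[leRHS]invrK lef_pV2 ?posrE ?mulr_gt0 ?exprn_gt0 ?invr_gt0 //.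
  have : r ^- 3 * r ^+ 2 <= m%:R * r ^+ 2.
    rewrite ler_pM2r ?exprn_gt0 //; apply/ltW/(le_lt_trans _ mr).
    by rewrite lerDl invr_ge0 ltW.
  by have -> : r ^- 3 * r ^+ 2 = r^-1 by field; rewrite gt_eqF.
have rm1 : m.+1%:R^-1 <= r.
  rewrite -[leRHS]invrK lef_pV2 ?posrE ?ltr0n ?invr_gt0 //.
  rewrite -natr1 ler_wpDr //; apply/ltW/(le_lt_trans _ mr).
  by rewrite lerDr invr_ge0 exprn_ge0 // ltW.
(* With this scaling [b * (j - m v) ^ 2] is at least 1 when [j] is [m r] away from [m v], and its
   binomial mean is at most [(m r ^ 2)^-1]. *)
pose b := (m%:R * r) ^- 2.
have b0 : 0 <= b by rewrite invr_ge0 exprn_ge0 // ltW // mulr_gt0.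
have bE v : 0 <= v <= 1 -> b * (m%:R * v * (1 - v)) <= (m%:R * r ^+ 2)^-1.
  move=> /andP[v0 v1].
  rewrite [leRHS](_ : _ = b * m%:R); last first.
    by rewrite /b; field; rewrite !gt_eqF.
  rewrite ler_wpM2l // -mulrA ger_pMr //.
  by rewrite mulr_ile1 // ?subr_ge0 // gerBl.
have far (j : nat) v : m%:R * r <= `|j%:R - m%:R * v| ->
    1 <= b * (j%:R - m%:R * v) ^+ 2.
  move=> jv; rewrite /b mulrC ler_pdivlMr ?exprn_gt0 ?mulr_gt0 // mul1r.
  by rewrite -[leRHS]real_normK ?num_real // lerXn2r ?nnegrE ?mulr_ge0 // ltW.
(* A count that is below [J] although [c <= v], or at least [K] although [v < c], is at distance
   [m r] or more from its mean [m v]. *)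
pose J := Num.truncn ((c - r) * m%:R).
pose K := (Num.truncn ((c + r) * m%:R)).+1.
exists (binmean m (fun j => (J <= j)%N%:R) + ((m%:R * r ^+ 2)^-1)%:P).
exists (binmean m (fun j => (K <= j)%N%:R) - ((m%:R * r ^+ 2)^-1)%:P).
split.
- rewrite unit_integralD unit_integralC binmean_step_moment.
  have -> : 1 - c + e = (1 - c + r + r + r) + r by rewrite /r; field.
  rewrite lerD // ler_pdivrMr ?ltr0n //.
  have Jm : (J <= m.+1)%N.
    rewrite leqW // truncn_le_nat (@le_lt_trans _ _ m%:R) ?ltr_nat //.
    by rewrite ger_pMl // lerBlDr (le_trans c1) // lerDl ltW.
  have := truncnS_gt ((c - r) * m%:R); rewrite -/J natrB // -!natr1 => Jx.
  rewrite -natr1 in rm1.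
  have mr1 : 1 <= r * (m%:R + 1) by rewrite -ler_pdivrMr ?addr_gt0 // mul1r.
  nra.
- rewrite -polyCN unit_integralD unit_integralC binmean_step_moment.
  have -> : 1 - c - e = (1 - c - r - r - r) - r by rewrite /r; field.
  rewrite lerD ?lerN2 // ler_pdivlMr ?ltr0n //.
  have Kx : K%:R <= (c + r) * m%:R + 1.
    by rewrite -natr1 lerD2r truncn_le mulr_ge0 ?addr_ge0 // ltW.
  have Km : m.+1%:R - K%:R <= (m.+1 - K)%N%:R :> R.
    by rewrite lerBlDr -natrD ler_nat addnC -leq_subLR.
  move: (K) Kx Km => k kx km; rewrite (le_trans _ km) //.
  rewrite -natr1 in rm1 *.
  have mr1 : 1 <= r * (m%:R + 1) by rewrite -ler_pdivrMr ?addr_gt0 // mul1r.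
  nra.
- move=> v v01; rewrite !hornerD hornerN !hornerC; apply/andP; split.
    rewrite lerBlDr; apply: (le_trans _ (lerD (lexx _) (bE v v01))).
    have /(@binmean_le m) -/(_ v v01) : forall j, (K <= j)%N%:R <=
        (c <= v)%R%:R + b * (j%:R - m%:R * v) ^+ 2 :> R.
      move=> j; have s0 : 0 <= b * (j%:R - m%:R * v) ^+ 2.
        by rewrite mulr_ge0 // sqr_ge0.
      have [Kj|Kj] := ltnP j K; rewrite /= ?mulr0n ?mulr1n; first by rewrite addr_ge0 // ler0n.
      have [cv|vc] := leP c v; rewrite /= ?mulr0n ?mulr1n; first by rewrite lerDl.
      rewrite add0r far //.
      move: Kj; rewrite /K truncn_lt_nat ?mulr_ge0 ?addr_ge0 ?(ltW r0) // => Kj.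
      by rewrite ler_normr; apply/orP; left; nra.
    by rewrite binmean_add_sqr binmean_cst hornerC subrr expr0n /= addr0.
  apply: (le_trans _ (lerD (lexx _) (bE v v01))).
  have /(@binmean_le m) -/(_ v v01) : forall j, (c <= v)%R%:R <=
      (J <= j)%N%:R + b * (j%:R - m%:R * v) ^+ 2 :> R.
    move=> j; have s0 : 0 <= b * (j%:R - m%:R * v) ^+ 2.
      by rewrite mulr_ge0 // sqr_ge0.
    have [cv|vc] := leP c v; rewrite /= ?mulr0n ?mulr1n; last by rewrite addr_ge0 // ler0n.
    case: leqP => Jj; rewrite /= ?mulr0n ?mulr1n; first by rewrite lerDl.
    rewrite add0r far //.
    move: Jj; rewrite /J truncn_gt_nat -natr1 => Jj.
    by rewrite ler_normr opprB; apply/orP; right; nra.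
  by rewrite binmean_add_sqr binmean_cst hornerC subrr expr0n /= addr0.
Qed.

End BernsteinMeans.

(** * Bounds on the empirical likelihood *)

Section MeanValue.
Context {R : realType}.

(** Parametrising the segment from 0 to [x] by [t] spares a distinction on the sign of [x]. *)
Lemma mean_value0 (f f' : R -> R) (x : R) :
  (forall t : R, 0 <= t <= 1 -> is_derive (t * x) 1 f (f' (t * x))) ->
  exists2 t, 0 <= t <= 1 & f x - f 0 = f' (t * x) * x.
Proof.
move=> df.
have dg (y : R) : 0 <= y <= 1 ->
    is_derive y 1 (fun r => f (r * x)) (f' (y * x) * x).
  move=> /df dfy.
  have -> : (fun r : R => f (r * x)) = f \o (fun r => r * x) by [].
  by apply: is_derive_eq; rewrite /GRing.scale /=; ring.
have [y||t t01] := @MVT_segment R (fun r => f (r * x)) (fun r => f' (r * x) * x) 0 1 ler01.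
- by rewrite in_itv /= => /andP[y0 y1]; apply: dg; rewrite !ltW.
- apply: derivable_within_continuous => y; rewrite in_itv /= => y01.
  by have := dg y y01 => ?; exact: ex_derive.
rewrite subr0 mulr1 mul1r mul0r => E.
by exists t => //; move: t01; rewrite in_itv.
Qed.

(** A lower bound for the logarithm of [1 + x]. The derivative of [g] has the sign of [y] for
    [y >= - del], because [2 del - (1 + 2 del) del = del (1 - 2 del)] is nonnegative; hence [g] is
    minimal at 0, where it is 1. *)
Lemma expR_quadratic_le (del x : R) : 0 <= del <= 1 / 2 -> `|x| <= del ->
  expR (x - (1 / 2 + del) * x ^+ 2) <= 1 + x.
Proof.
move=> /andP[d0 d12]; rewrite ler_norml => /andP[x1 x2].
pose h (y : R) := (1 / 2 + del) * y ^+ 2 - y.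
pose g (y : R) := (1 + y) * expR (h y).
pose g' (y : R) := expR (h y) * (y * (2 * del + (1 + 2 * del) * y)).
have dg (y : R) : is_derive y 1 g (g' y).
  rewrite /g /g' /h; apply: is_derive_eq.
  by rewrite /GRing.scale /=; field.
have [t /andP[t0 t1] E] := @mean_value0 g g' x (fun t _ => dg (t * x)).
have : g 0 <= g x.
  have tx : - del <= t * x by nra.
  have -> : g x = g 0 + expR (h (t * x)) *
      (t * x ^+ 2 * (2 * del + (1 + 2 * del) * (t * x))).
    by apply: (addIr (- g 0)); rewrite E /g'; ring.
  rewrite lerDl mulr_ge0 ?expR_ge0 // mulr_ge0 // 1?mulr_ge0 ?sqr_ge0 //.
  have : 0 <= (1 + 2 * del) * (t * x + del) by apply: mulr_ge0; lra.
  have : 0 <= del * (1 / 2 - del) by apply: mulr_ge0; lra.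
  lra.
rewrite /g /h expr0n /= mulr0 subr0 expR0 addr0 mulr1.
by move=> gx; rewrite -opprB expRN -[leLHS]mul1r ler_pdivrMr ?expR_gt0.
Qed.

End MeanValue.

Section SampleAverages.
Context {R : realType}.
Implicit Types (n : nat) (z : nat -> R * R) (f : R * R -> R).

Definition avg n z f : R := (\sum_(i < n) f (z i)) / n%:R.

Lemma avg_quadratic n z (a b1 b2 c11 c12 c22 : R) f : (0 < n)%N ->
  (forall v, f v = a + b1 * v.1 + b2 * v.2 + c11 * v.1 ^+ 2 +
                   c12 * (v.1 * v.2) + c22 * v.2 ^+ 2) ->
  avg n z f = a + b1 * avg n z fst + b2 * avg n z snd +
    c11 * avg n z (fun v => v.1 ^+ 2) + c12 * avg n z (fun v => v.1 * v.2) +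
    c22 * avg n z (fun v => v.2 ^+ 2).
Proof.
move=> n0 fE; rewrite /avg; under eq_bigr do rewrite fE.
rewrite !big_split -!mulr_sumr sumr_const card_ord !mulrDl !mulrA.
by rewrite -[a *+ n]mulr_natr mulfK // pnatr_eq0 -lt0n.
Qed.

Lemma sum_pairE (I : Type) (r : seq I) (F : I -> R * R) :
  \sum_(i <- r) F i = (\sum_(i <- r) (F i).1, \sum_(i <- r) (F i).2).
Proof.
elim: r => [|i r IH]; first by rewrite !big_nil.
by rewrite !big_cons IH.
Qed.

End SampleAverages.

(* Under these conditions [EL_upper] and [EL_lower] agree up to a factor
   [1 + O(del)] in the exponent; they hold with probability tending to 1. *)
Definition tame_sample (R : realType) n (z : nat -> R * R) (del : R) : Prop :=
  let m2 := avg n z fst ^+ 2 + avg n z snd ^+ 2 in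
  [/\ m2 <= del, forall i, (i < n)%N -> m2 * sqnorm2 (z i) <= del ^+ 2,
      `|avg n z (fun v => v.1 ^+ 2) - 1| <= del,
      `|avg n z (fun v => v.2 ^+ 2) - 1| <= del &
      `|avg n z (fun v => v.1 * v.2)| <= del].

Section EmpiricalLikelihoodBounds.
Context {R : realType}.
Implicit Types (n : nat) (z : nat -> R * R) (del : R).

Lemma sqnorm2E (v : R * R) : sqnorm2 v = v.1 ^+ 2 + v.2 ^+ 2.
Proof. by rewrite /sqnorm2 2!big_ord_recl big_ord0 addr0. Qed.

Lemma cauchy_schwarz2 (a b x y : R) :
  (a * x + b * y) ^+ 2 <= (a ^+ 2 + b ^+ 2) * (x ^+ 2 + y ^+ 2).
Proof.
by rewrite -subr_ge0 (_ : _ - _ = (a * y - b * x) ^+ 2) ?sqr_ge0 //; ring.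
Qed.

Lemma ler_norm_sqr (x del : R) : 0 <= del -> x ^+ 2 <= del ^+ 2 -> `|x| <= del.
Proof. by move=> d0; rewrite -[x ^+ 2]real_normK ?num_real // ler_pXn2r ?nnegrE. Qed.

(** The [Q_n] of the overview: the leading term of [-2 log EL] at 0. *)
Definition log_ratio n z : R := n%:R * (avg n z fst ^+ 2 + avg n z snd ^+ 2).

(* Weak duality, with the sample mean as approximate Lagrange multiplier. *)
Lemma EL_upper n z del : (0 < n)%N -> 0 < del <= 1 / 100 -> tame_sample n z del ->
  EL n z 0 <= expR (- (log_ratio n z / 2 * (1 - 5 * del))).
Proof.
move=> n0 /andP[d0 d1] [md zd w11 w22 w12].
have nR : 0 < n%:R :> R by rewrite ltr0n.
set m1 := avg n z fst in md zd *; set m2 := avg n z snd in md zd *.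
pose x i := m1 * (z i).1 + m2 * (z i).2.
have xd i : (i < n)%N -> `|x i| <= del.
  move=> /zd; rewrite sqnorm2E => zi; apply: ler_norm_sqr; first exact: ltW.
  exact: le_trans (cauchy_schwarz2 _ _ _ _) zi.
pose S := \sum_(i < n) (x i - (1 / 2 + del) * x i ^+ 2).
have SE : S = n%:R * (m1 ^+ 2 + m2 ^+ 2 - (1 / 2 + del) *
   (m1 ^+ 2 * avg n z (fun v => v.1 ^+ 2) +
    2 * m1 * m2 * avg n z (fun v => v.1 * v.2) +
    m2 ^+ 2 * avg n z (fun v => v.2 ^+ 2))).
  have -> : S = n%:R * avg n z
      (fun v => let x := m1 * v.1 + m2 * v.2 in x - (1 / 2 + del) * x ^+ 2).
    by rewrite /avg mulrC divfK // gt_eqF.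
  rewrite (@avg_quadratic R n z 0 m1 m2 (- (1 / 2 + del) * m1 ^+ 2)
    (- (1 / 2 + del) * (2 * m1 * m2)) (- (1 / 2 + del) * m2 ^+ 2)) //=.
    by rewrite -/m1 -/m2; ring.
  by move=> v; ring.
have Sge : log_ratio n z / 2 * (1 - 5 * del) <= S.
  (* Origin of the factor 5: [(1 / 2 + del) (1 + 2 del) <= 1 / 2 + 5 del / 2] as soon as
     [del <= 1 / 4]. *)
  have key (A B : R) : 0 <= B -> A <= (1 + 2 * del) * B ->
      B / 2 * (1 - 5 * del) <= B - (1 / 2 + del) * A.
    move=> B0 AB.
    have h5 : (1 / 2 + del) * A <= (1 / 2 + del) * ((1 + 2 * del) * B).
      by rewrite ler_wpM2l //; lra.
    have h6 : 0 <= B * del * (1 / 4 - del).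
      by rewrite mulr_ge0 ?mulr_ge0 //; lra.
    lra.
  rewrite SE /log_ratio -/m1 -/m2 -[X in X <= _]mulrA -mulrA ler_pM2l // mulrA.
  move: w11 w22 w12; rewrite !ler_distl ler_norml.
  move: (avg n z _) (avg n z (fun v => v.2 ^+ 2)) (avg n z (fun v => v.1 * v.2)).
  move=> W11 W22 W12 /andP[_ W1] /andP[_ W2] /andP[W3 W4].
  have W : m1 ^+ 2 * W11 + 2 * m1 * m2 * W12 + m2 ^+ 2 * W22 <=
      (1 + 2 * del) * (m1 ^+ 2 + m2 ^+ 2).
    have h1 : 0 <= m1 ^+ 2 * (1 + del - W11) by rewrite mulr_ge0 ?sqr_ge0 //; lra.
    have h2 : 0 <= m2 ^+ 2 * (1 + del - W22) by rewrite mulr_ge0 ?sqr_ge0 //; lra.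
    (* The sum of [h3] and [h4] bounds the mixed term: [2 m1 m2 W12 <= del (m1 ^ 2 + m2 ^ 2)]. *)
    have h3 : 0 <= (m1 - m2) ^+ 2 * (del + W12) by rewrite mulr_ge0 ?sqr_ge0 //; lra.
    have h4 : 0 <= (m1 + m2) ^+ 2 * (del - W12) by rewrite mulr_ge0 ?sqr_ge0 //; lra.
    lra.
  apply: key W; by rewrite addr_ge0 ?sqr_ge0.
rewrite /EL; have [->|/set0P ne] := eqVneq (EL_values n z 0) set0.
  by rewrite sup0 expR_ge0.
apply: ge_sup => // _ [p [p0 p1 pz] <-].
apply: (@le_trans _ _ (expR (- S))); last by rewrite ler_expR lerN2.
have x1 (i : 'I_n) : 0 < 1 + x i.
  by have := xd i (ltn_ord i); rewrite ler_norml => /andP[? ?]; lra.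
(* Feasibility of [p] makes the sum of the [p i * x i] vanish, so the factors have arithmetic mean
   1. *)
have AG : \prod_(i < n) (n%:R * p i * (1 + x i)) <= 1.
  have := @leif_AGM R _ [set: 'I_n]%SET (fun i => n%:R * p i * (1 + x i))
    (fun i _ => mulr_ge0 (mulr_ge0 (ler0n _ _) (p0 i)) (ltW (x1 i))).
  have E (op : R -> R -> R) idx (F : 'I_n -> R) :
      \big[op/idx]_(i in [set: 'I_n]%SET) F i = \big[op/idx]_i F i.
    by apply: eq_bigl => i; rewrite inE.
  rewrite !E cardsT card_ord => /leifP.
  have -> : \sum_(i < n) n%:R * p i * (1 + x i) = n%:R.
    have px : \sum_(i < n) p i * x i = 0.
      have : m1 * (\sum_(i < n) p i *: (z i - 0)).1 +
             m2 * (\sum_(i < n) p i *: (z i - 0)).2 = 0.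
        by rewrite pz /= !mulr0 addr0.
      rewrite sum_pairE /= !mulr_sumr -big_split /= => xz.
      apply: etrans xz; apply: eq_bigr => i _.
      by rewrite subr0 /x /GRing.scale /= /GRing.scale /=; ring.
    rewrite (eq_bigr (fun i => n%:R * (p i + p i * x i))) => [|i _]; last by ring.
    by rewrite -mulr_sumr big_split /= p1 px addr0 mulr1.
  rewrite divff ?pnatr_eq0 -?lt0n // expr1n.
  by case: ifP => _ => [/eqP ->|/ltW].
rewrite expRN -[leRHS]mul1r ler_pdivlMr ?expR_gt0 //.
apply: le_trans AG; rewrite [leRHS]big_split /= ler_wpM2l //.
  by apply: prodr_ge0 => i _; rewrite mulr_ge0.
rewrite expR_sum; apply: ler_prod => i _; rewrite expR_ge0 /=.
by apply: expR_quadratic_le (xd i (ltn_ord i)); lra.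
Qed.

End EmpiricalLikelihoodBounds.

Section EmpiricalLikelihoodLowerBound.
Context {R : realType}.
Implicit Types (n : nat) (z : nat -> R * R) (del : R).

Lemma EL_ge n z mu (p : 'I_n -> R) :
  (forall i, 0 <= p i) -> \sum_(i < n) p i = 1 ->
  \sum_(i < n) p i *: (z i - mu) = 0 -> \prod_(i < n) (n%:R * p i) <= EL n z mu.
Proof.
move=> p0 p1 pz; apply: ub_le_sup; last by exists p.
by exists 1; exact: EL_values_le1.
Qed.

(** By Cramer's rule [c] solves the symmetric system with rows [(a, b)], [(b, e)] and right-hand
    side [m]. The factor 10 comes from a numerator at most [1 + 4 del] and an inverse determinant at
    most [1 + 5 del]. *)
Lemma inverse_bounds (del a b e m1 m2 : R) : 0 < del <= 1 / 100 ->
  `|a - 1| <= 2 * del -> `|b| <= 2 * del -> `|e - 1| <= 2 * del ->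
  let D := a * e - b ^+ 2 in
  let c1 := (e * m1 - b * m2) / D in let c2 := (a * m2 - b * m1) / D in
  [/\ 0 < D, c1 ^+ 2 + c2 ^+ 2 <= 4 * (m1 ^+ 2 + m2 ^+ 2) &
      c1 * m1 + c2 * m2 <= (1 + 10 * del) * (m1 ^+ 2 + m2 ^+ 2)].
Proof.
move=> /andP[d0 d1]; rewrite !ler_distl ler_norml.
move=> /andP[a1 a2] /andP[b1 b2] /andP[e1 e2] D c1 c2.
have bb : b ^+ 2 <= 4 * del ^+ 2.
  by rewrite -subr_ge0 (_ : _ - _ = (2 * del - b) * (2 * del + b)); [apply: mulr_ge0; lra|ring].
have dd : del ^+ 2 <= del / 100 by rewrite expr2 ler_pM2l //; lra.
have ae : (1 - 2 * del) * (1 - 2 * del) <= a * e by apply: ler_pM; lra.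
have Dge : 1 - 4 * del <= D by rewrite /D; lra.
have D0 : 0 < D by lra.
have D1 : D^-1 <= 1 + 5 * del.
  have h : 0 <= (D - (1 - 4 * del)) * (1 + 5 * del) by apply: mulr_ge0; lra.
  by rewrite -[leLHS]mul1r ler_pdivrMr //; lra.
have a_sq : a ^+ 2 <= (1 + 2 * del) ^+ 2 by rewrite ler_pXn2r ?nnegrE //; lra.
have e_sq : e ^+ 2 <= (1 + 2 * del) ^+ 2 by rewrite ler_pXn2r ?nnegrE //; lra.
have i_sq : D ^- 2 <= (1 + 5 * del) ^+ 2.
  by rewrite -exprVn ler_pXn2r ?nnegrE //; [rewrite invr_ge0 ltW|lra].
have [s1 s2] := (sqr_ge0 m1, sqr_ge0 m2).
split => //.
  have E : c1 ^+ 2 + c2 ^+ 2 = ((e * m1 - b * m2) ^+ 2 + (a * m2 - b * m1) ^+ 2) * D ^- 2.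
    by rewrite /c1 /c2; field; rewrite gt_eqF.
  have C1 : (e * m1 - b * m2) ^+ 2 <= (e ^+ 2 + b ^+ 2) * (m1 ^+ 2 + m2 ^+ 2).
    by rewrite -[b ^+ 2]sqrrN -mulNr cauchy_schwarz2.
  have C2 : (a * m2 - b * m1) ^+ 2 <= (a ^+ 2 + b ^+ 2) * (m2 ^+ 2 + m1 ^+ 2).
    by rewrite -[b ^+ 2]sqrrN -mulNr cauchy_schwarz2.
  rewrite E; apply: (@le_trans _ _ ((5 / 2 * (m1 ^+ 2 + m2 ^+ 2)) * (3 / 2))).
    apply: ler_pM; rewrite ?addr_ge0 ?sqr_ge0 ?invr_ge0 ?sqr_ge0 //; last by nra.
    have k1 : e ^+ 2 + b ^+ 2 <= 5 / 4 by nra.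
    have k2 : a ^+ 2 + b ^+ 2 <= 5 / 4 by nra.
    have k3 := ler_wpM2r (addr_ge0 s1 s2) k1.
    have k4 := ler_wpM2r (addr_ge0 s1 s2) k2.
    lra.
  lra.
have -> : c1 * m1 + c2 * m2 = (e * m1 ^+ 2 - 2 * b * m1 * m2 + a * m2 ^+ 2) * D^-1.
  by rewrite /c1 /c2; field; rewrite gt_eqF.
have num : e * m1 ^+ 2 - 2 * b * m1 * m2 + a * m2 ^+ 2 <=
    (1 + 4 * del) * (m1 ^+ 2 + m2 ^+ 2).
  have h1 : 0 <= m1 ^+ 2 * (1 + 2 * del - e) by rewrite mulr_ge0 //; lra.
  have h2 : 0 <= m2 ^+ 2 * (1 + 2 * del - a) by rewrite mulr_ge0 //; lra.
  have h3 : 0 <= (m1 - m2) ^+ 2 * (2 * del - b) by rewrite mulr_ge0 ?sqr_ge0 //; lra.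
  have h4 : 0 <= (m1 + m2) ^+ 2 * (2 * del + b) by rewrite mulr_ge0 ?sqr_ge0 //; lra.
  lra.
have i0 : 0 <= D^-1 by rewrite invr_ge0 ltW.
apply: le_trans (ler_wpM2r i0 num) _.
have B0 : 0 <= m1 ^+ 2 + m2 ^+ 2 by rewrite addr_ge0.
rewrite mulrAC ler_wpM2r //.
have h5 : (1 + 4 * del) * D^-1 <= (1 + 4 * del) * (1 + 5 * del).
  by rewrite ler_wpM2l //; lra.
lra.
Qed.

(* The weights [p i = (1 - y i) / n], with [y i] linear in the centred sample
   point, are those of the Euclidean likelihood: they are feasible by
   construction and nearly optimal. *)
Lemma EL_lower n z del : (0 < n)%N -> 0 < del <= 1 / 100 -> tame_sample n z del ->
  expR (- (log_ratio n z / 2 * (1 + 20 * del))) <= EL n z 0.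
Proof.
move=> n0 /[dup] dd /andP[d0 d1] [md zd w11 w22 w12].
have nR : 0 < n%:R :> R by rewrite ltr0n.
set m1 := avg n z fst in md zd *; set m2 := avg n z snd in md zd *.
set W11 := avg n z (fun v => v.1 ^+ 2) in w11 *.
set W22 := avg n z (fun v => v.2 ^+ 2) in w22 *.
set W12 := avg n z (fun v => v.1 * v.2) in w12 *.
(* The entries of the sample covariance matrix [V]. The products of means are at most [del] in size,
   whence the bounds [2 * del]. *)
pose a := W11 - m1 ^+ 2; pose b := W12 - m1 * m2; pose e := W22 - m2 ^+ 2.
have [s1 s2] := (sqr_ge0 m1, sqr_ge0 m2).
have aB : `|a - 1| <= 2 * del.
  by move: w11; rewrite !ler_distl /a => /andP[? ?]; apply/andP; split; lra.
have eB : `|e - 1| <= 2 * del.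
  by move: w22; rewrite !ler_distl /e => /andP[? ?]; apply/andP; split; lra.
have bB : `|b| <= 2 * del.
  have h1 := sqr_ge0 (m1 - m2); have h2 := sqr_ge0 (m1 + m2).
  by move: w12; rewrite !ler_norml /b => /andP[? ?]; apply/andP; split; lra.
have [] := inverse_bounds m1 m2 dd aB bB eB.
set D := a * e - b ^+ 2; set c1 := _ / D; set c2 := _ / D => D0 cB cm.
pose y i := c1 * ((z i).1 - m1) + c2 * ((z i).2 - m2).
(* By Cauchy-Schwarz [y i ^ 2 <= 4 |m| ^ 2 (2 |z_i| ^ 2 + 2 |m| ^ 2)], and both [|m| ^ 2 |z_i| ^ 2]
   and [|m| ^ 4] are at most [del ^ 2]. *)
have yB i : (i < n)%N -> `|y i| <= 4 * del.
  move=> /zd; rewrite sqnorm2E => zi.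
  apply: ler_norm_sqr; first by lra.
  apply: le_trans (cauchy_schwarz2 _ _ _ _) _.
  have h1 : ((z i).1 - m1) ^+ 2 + ((z i).2 - m2) ^+ 2 <=
      2 * ((z i).1 ^+ 2 + (z i).2 ^+ 2) + 2 * (m1 ^+ 2 + m2 ^+ 2).
    have h1 := sqr_ge0 ((z i).1 + m1); have h2 := sqr_ge0 ((z i).2 + m2); lra.
  apply: (@le_trans _ _ (4 * (m1 ^+ 2 + m2 ^+ 2) *
      (2 * ((z i).1 ^+ 2 + (z i).2 ^+ 2) + 2 * (m1 ^+ 2 + m2 ^+ 2)))).
    by apply: ler_pM => //; rewrite addr_ge0 ?sqr_ge0.
  have h2 : (m1 ^+ 2 + m2 ^+ 2) * (m1 ^+ 2 + m2 ^+ 2) <= del * del.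
    by apply: ler_pM => //; rewrite addr_ge0.
  lra.
have sumE (f : R * R -> R) : \sum_(i < n) f (z i) = n%:R * avg n z f.
  by rewrite /avg mulrC divfK // gt_eqF.
(* [V c = m]: the covariance of [y] with the sample is the sample mean, which the weights [p]
   therefore cancel. *)
have mE : a * c1 + b * c2 = m1 /\ b * c1 + e * c2 = m2.
  by rewrite /c1 /c2 /D; split; field; rewrite gt_eqF.
have y0 : \sum_(i < n) y i = 0.
  rewrite (sumE (fun v => c1 * (v.1 - m1) + c2 * (v.2 - m2))).
  rewrite (@avg_quadratic R n z (- c1 * m1 - c2 * m2) c1 c2 0 0 0) //.
    by rewrite -/m1 -/m2; ring.
  by move=> v; ring.
have y1 : \sum_(i < n) y i * (z i).1 = n%:R * m1.
  rewrite (sumE (fun v => (c1 * (v.1 - m1) + c2 * (v.2 - m2)) * v.1)).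
  rewrite (@avg_quadratic R n z 0 (- c1 * m1 - c2 * m2) 0 c1 c2 0) //.
    transitivity (n%:R * (a * c1 + b * c2)); last by rewrite mE.1.
    by rewrite -/m1 -/m2 -/W11 -/W12 /a /b; ring.
  by move=> v; ring.
have y2 : \sum_(i < n) y i * (z i).2 = n%:R * m2.
  rewrite (sumE (fun v => (c1 * (v.1 - m1) + c2 * (v.2 - m2)) * v.2)).
  rewrite (@avg_quadratic R n z 0 0 (- c1 * m1 - c2 * m2) 0 c1 c2) //.
    transitivity (n%:R * (b * c1 + e * c2)); last by rewrite mE.2.
    by rewrite -/m1 -/m2 -/W22 -/W12 /e /b; ring.
  by move=> v; ring.
have yy : \sum_(i < n) y i ^+ 2 = n%:R * (c1 * m1 + c2 * m2).
  rewrite (eq_bigr (fun i : 'I_n => c1 * (y i * (z i).1) + c2 * (y i * (z i).2) -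
     (c1 * m1 + c2 * m2) * y i)); last by move=> i _; rewrite /y; ring.
  rewrite sumrB big_split /= -!mulr_sumr y0 y1 y2; ring.
pose p (i : 'I_n) := (1 - y i) / n%:R.
have pn (i : 'I_n) : n%:R * p i = 1 - y i by rewrite /p mulrC divfK // gt_eqF.
apply: (@le_trans _ _ (\prod_(i < n) (n%:R * p i))); last first.
  apply: EL_ge.
  - move=> i; rewrite divr_ge0 ?ler0n //.
    by have := yB i (ltn_ord i); rewrite ler_norml => /andP[? ?]; lra.
  - by rewrite -mulr_suml sumrB y0 sumr_const card_ord subr0 divff // gt_eqF.
  - rewrite sum_pairE; under eq_bigr do rewrite /= subr0.
    under [X in (_, X)]eq_bigr do rewrite /= subr0.
    have pE (f : R * R -> R) : \sum_(i < n) p i * f (z i) =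
        (\sum_(i < n) f (z i) - \sum_(i < n) y i * f (z i)) / n%:R.
      rewrite -sumrB mulr_suml; apply: eq_bigr => i _.
      by rewrite /p; field; rewrite gt_eqF.
    congr (_, _).
      by rewrite (pE fst) y1 (sumE fst) subrr mul0r.
    by rewrite (pE snd) y2 (sumE snd) subrr mul0r.
under eq_bigr do rewrite pn.
(* [expR_quadratic_le] at [- y i], with [4 * del] for [del]. The linear terms cancel, and the factor
   20 comes from [(1 / 2 + 4 del) (1 + 10 del) <= 1 / 2 + 10 del], valid for [del <= 1 / 40]. *)
apply: (@le_trans _ _ (expR (\sum_(i < n) (- y i - (1 / 2 + 4 * del) * (- y i) ^+ 2)))).
  rewrite ler_expR sumrB sumrN y0 oppr0 sub0r lerN2 -mulr_sumr.
  under eq_bigr do rewrite sqrrN.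
  rewrite yy /log_ratio -/m1 -/m2.
  have B0 : 0 <= m1 ^+ 2 + m2 ^+ 2 by rewrite addr_ge0.
  rewrite [leLHS]mulrCA -[X in _ <= X]mulrA -mulrA ler_pM2l // mulrA.
  apply: (@le_trans _ _ ((1 / 2 + 4 * del) * ((1 + 10 * del) * (m1 ^+ 2 + m2 ^+ 2)))).
    by rewrite ler_wpM2l //; lra.
  have h6 : 0 <= (m1 ^+ 2 + m2 ^+ 2) * (del * (1 / 40 - del)).
    by apply: mulr_ge0 => //; apply: mulr_ge0; [exact: ltW|lra].
  lra.
rewrite expR_sum; apply: ler_prod => i _; rewrite expR_ge0 /=.
apply: expR_quadratic_le; first by lra.
by rewrite normrN yB.
Qed.

End EmpiricalLikelihoodLowerBound.

(** * Affine invariance and the order constraint *)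

Section ConstrainedRatio.
Context {R : realType}.
Implicit Types (n : nat) (x z : nat -> R * R) (mu v : R * R).

(** At the sample mean the uniform weights are feasible and reach 1, the largest value that [EL_le1]
    allows. *)
Lemma EL_sup_eq1 (Theta : set (R * R)) n x : (0 < n)%N ->
  Theta (n%:R^-1 *: \sum_(i < n) x i) -> EL_sup Theta n x = 1.
Proof.
move=> n0 Tm; have nR : n%:R != 0 :> R by rewrite pnatr_eq0 -lt0n.
have ub1 : ubound [set EL n x nu | nu in Theta] 1.
  by move=> _ [nu _ <-]; exact: EL_le1.
apply/eqP; rewrite eq_le; apply/andP; split.
  by apply: ge_sup ub1; exists (EL n x (n%:R^-1 *: \sum_(i < n) x i)); exists (n%:R^-1 *: \sum_(i < n) x i).
have -> : 1 = EL n x (n%:R^-1 *: \sum_(i < n) x i).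
  apply/eqP; rewrite eq_le EL_le1 andbT.
  have := @EL_ge R n x (n%:R^-1 *: \sum_(i < n) x i) (fun=> n%:R^-1).
  rewrite divff // prodr_const expr1n; apply.
  - by move=> i; rewrite invr_ge0.
  - by rewrite sumr_const card_ord -[_ *+ n]mulr_natl divff.
  - rewrite -scaler_sumr sumrB sumr_const card_ord -[X in _ - X]scaler_nat scalerA divff //.
    by rewrite scale1r subrr scaler0.
by apply: ub_le_sup; [exists 1|exists (n%:R^-1 *: \sum_(i < n) x i)].
Qed.

Definition lower_mx (al be ga : R) v : R * R := (al * v.1, be * v.2 + ga * v.1).

(** The moment constraint is linear in the sample, so an invertible map keeps the same feasible
    weights. *)
Lemma EL_lower_mx n x mu al be ga : al != 0 -> be != 0 ->
  EL n (fun i => lower_mx al be ga (x i - mu)) 0 = EL n x mu.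
Proof.
move=> al0 be0; rewrite /EL; congr sup.
have key (p : 'I_n -> R) : \sum_(i < n) p i *: (x i - mu) = 0 <->
    \sum_(i < n) p i *: (lower_mx al be ga (x i - mu) - 0) = 0.
  have -> : \sum_(i < n) p i *: (lower_mx al be ga (x i - mu) - 0) =
      lower_mx al be ga (\sum_(i < n) p i *: (x i - mu)).
    rewrite !sum_pairE /lower_mx /=; congr (_, _).
      by rewrite mulr_sumr; apply: eq_bigr => i _; rewrite subr0 /GRing.scale /=; ring.
    rewrite !mulr_sumr -big_split /=; apply: eq_bigr => i _.
    by rewrite subr0 /GRing.scale /=; ring.
  case: (\sum_(i < n) _) => s1 s2; rewrite /lower_mx /=; split.
    by move=> [-> ->]; rewrite !mulr0 addr0.
  move=> [/eqP]; rewrite mulf_eq0 (negbTE al0) /= => /eqP -> /eqP.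
  by rewrite mulr0 addr0 mulf_eq0 (negbTE be0) /= => /eqP ->.
by apply/seteqP; split => _ [p [p0 p1 /key pz] <-]; exists p.
Qed.

Lemma interior_order_cone mu : interior (@order_cone R) mu -> mu.1 < mu.2.
Proof.
move=> /nbhs_ballP[e /= e0 be].
have : order_cone (mu.1 + e / 2, mu.2).
  apply: be; split => /=; last exact: ballxx.
  rewrite /ball /= opprD addNKr normrN gtr0_norm ?divr_gt0 //.
  by rewrite ltr_pdivrMr // ltr_pMr // ltr1n.
rewrite /order_cone /=; apply: lt_le_trans.
by rewrite ltrDl divr_gt0.
Qed.

(** In whitened coordinates the difference of the two means is [g + L . zbar], where [L] is
    [v.2 - v.1] composed with the inverse of [lower_mx]; by Cauchy-Schwarz a small [zbar] cannot
    outweigh the gap [g]. *)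
Lemma mean_in_order_cone mu (al be ga : R) : mu.1 < mu.2 -> al != 0 -> be != 0 ->
  exists2 del0, 0 < del0 & forall n x, (0 < n)%N ->
    let z i := lower_mx al be ga (x i - mu) in
    avg n z fst ^+ 2 + avg n z snd ^+ 2 <= del0 ->
    order_cone (n%:R^-1 *: \sum_(i < n) x i).
Proof.
move=> g0 al0 be0; pose g := mu.2 - mu.1.
pose L1 := - ga / (al * be) - al^-1; pose L2 := be^-1.
have L0 : 0 < L1 ^+ 2 + L2 ^+ 2 + 1 by rewrite ltr_wpDl // addr_ge0 ?sqr_ge0.
have gp : 0 < g by rewrite subr_gt0.
exists (g ^+ 2 / (L1 ^+ 2 + L2 ^+ 2 + 1)); first by rewrite divr_gt0 // exprn_gt0.
move=> n x n0 z; rewrite ler_pdivlMr // => zB.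
have nR : n%:R != 0 :> R by rewrite pnatr_eq0 -lt0n.
rewrite /order_cone /= sum_pairE /= /GRing.scale /=.
set s1 := \sum_(i < n) (x i).1; set s2 := \sum_(i < n) (x i).2.
have e1 : avg n z fst = al * (n%:R^-1 * s1 - mu.1).
  rewrite /avg /z /lower_mx /= -mulr_sumr sumrB sumr_const card_ord -/s1.
  by rewrite -mulr_natl; field.
have e2 : avg n z snd = be * (n%:R^-1 * s2 - mu.2) + ga * (n%:R^-1 * s1 - mu.1).
  rewrite /avg /z /lower_mx /= big_split /= -!mulr_sumr !sumrB !sumr_const card_ord -/s1 -/s2.
  by rewrite -[mu.1 *+ n]mulr_natl -[mu.2 *+ n]mulr_natl; field.
have e3 : n%:R^-1 * s2 - n%:R^-1 * s1 = g + (L1 * avg n z fst + L2 * avg n z snd).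
  by rewrite e1 e2 /L1 /L2 /g; field; rewrite al0 be0 nR.
have : `|L1 * avg n z fst + L2 * avg n z snd| <= g.
  apply: ler_norm_sqr; first exact: ltW.
  apply: le_trans (cauchy_schwarz2 _ _ _ _) _.
  rewrite mulrC (le_trans _ zB) // ler_wpM2l ?addr_ge0 ?sqr_ge0 //.
  by rewrite lerDl.
by rewrite ler_norml => /andP[? ?]; rewrite -subr_ge0 e3; lra.
Qed.

Lemma ell_tame mu (al be ga del : R) n x :
  al != 0 -> be != 0 -> (0 < n)%N -> 0 < del <= 1 / 100 ->
  let z i := lower_mx al be ga (x i - mu) in
  tame_sample n z del -> order_cone (n%:R^-1 *: \sum_(i < n) x i) ->
  exists2 r, ell (@order_cone R) n x mu = r%:E &
    log_ratio n z * (1 - 5 * del) <= r <= log_ratio n z * (1 + 20 * del).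
Proof.
move=> al0 be0 n0 d01 z tz cone.
rewrite /ell (EL_sup_eq1 n0 cone) ltr01 divr1.
have := EL_lower n0 d01 tz; have := EL_upper n0 d01 tz.
rewrite EL_lower_mx // => up lo.
have EL0 : 0 < EL n x mu by apply: lt_le_trans lo; exact: expR_gt0.
exists (- 2 * ln (EL n x mu)).
  by rewrite /neg2log lne_EFin.
move: up lo; rewrite -ler_ln ?posrE ?expR_gt0 // expRK => up.
rewrite -ler_ln ?posrE ?expR_gt0 // expRK => lo.
apply/andP; split; lra.
Qed.

End ConstrainedRatio.

(** * Independence of the past and the next variable *)

Section Chain.
Context d (T : measurableType d) (R : realType) (P : probability T R).
Context dV (V : measurableType dV) dU (U : measurableType dU).
Local Open Scope ereal_scope.

(** Both sides are finite measures in [C], and rectangles are stable under intersection and generate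
    the product sigma-algebra. *)
Lemma rectangle_independent (Y : T -> U * V) (F : set T) :
  measurable_fun setT Y -> measurable F ->
  (forall A B, measurable A -> measurable B ->
    P (Y @^-1` (A `*` B) `&` F) = P (Y @^-1` (A `*` B)) * P F) ->
  forall C, measurable C -> P (Y @^-1` C `&` F) = P (Y @^-1` C) * P F.
Proof.
move=> mY mF YF C mC.
have PF0 : (0 <= fine (P F))%R by rewrite fine_ge0.
pose Ym := [the {mfun T >-> (U * V)%type} of mfun_Sub (mem_set mY)].
pose m1 := pushforward (mrestr P mF) Ym.
pose m2 := mscale (NngNum PF0) (distribution P Ym).
have m2E D : m2 D = P (Y @^-1` D) * P F.
  by rewrite /m2 /mscale /= fineK ?fin_num_measure // muleC.
rewrite -m2E -[LHS]/(m1 C).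
pose G : set (set (U * V)) :=
  [set C | exists A, measurable A /\ exists B, measurable B /\ C = A `*` B].
apply: (measure_unique G (fun=> setT)) => //.
- rewrite measurable_prod_measurableType //; congr (<<s _ >>).
  rewrite predeqE; split => [[A mA [B mB <-]]|[A [mA [B [mB ->]]]]].
    by exists A; split => //; exists B.
  by exists A => //; exists B.
- move=> /= _ _ [X1 [mX1 [X2 [mX2 ->]]]] [Y1 [mY1 [Y2 [mY2 ->]]]].
  rewrite -setXI; exists (X1 `&` Y1); split; first exact: measurableI.
  by exists (X2 `&` Y2); split => //; exact: measurableI.
- by move=> _; exists setT; split => //; exists setT; split; rewrite ?setXTT.
- by rewrite bigcup_const //; exists 0%N.
- by move=> _ [A [mA [B [mB ->]]]]; apply: etrans (esym (m2E _)); rewrite -YF.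
- move=> k; rewrite /= /m1 /pushforward /mrestr preimage_setT setTI.
  by rewrite (le_lt_trans (probability_le1 P mF)) // ltry.
Qed.

Variables (Z : nat -> {RV P >-> V}) (step : U * V -> U) (u0 : U).
Hypothesis mstep : measurable_fun setT step.
Hypothesis Zind : mutually_independent Z.

(** An abstract state driven by the [Z k]: independence is proved once, and serves both the partial
    sums in the plane and the real sums of the law of large numbers. *)
Fixpoint chain k w : U := if k is k'.+1 then step (chain k' w, Z k' w) else u0.

Lemma measurable_chain k : measurable_fun setT (chain k).
Proof.
elim: k => [|k IH] /=; first exact: measurable_cst.
by apply: measurableT_comp => //; exact: measurable_fun_pair.
Qed.

Lemma measurable_chain_pair k : measurable_fun setT (fun w => (chain k w, Z k w)).
Proof. by apply: measurable_fun_pair => //; exact: measurable_chain. Qed.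

Let cyl (J : {fset nat}) (B : nat -> set V) := \bigcap_(i in [set` J]) Z i @^-1` B i.

Let measurable_cyl J B : (forall i, measurable (B i)) -> measurable (cyl J B).
Proof.
move=> mB; apply: fin_bigcap_measurable => // i _.
by rewrite -[X in measurable X]setTI; exact: measurable_funP.
Qed.

Let cyl_eq J B B' : {in J, B =1 B'} -> cyl J B = cyl J B'.
Proof. by move=> BB; apply: eq_bigcapr => i /= iJ; rewrite BB. Qed.

Let cyl1U k J (B : nat -> set V) :
  cyl (k |` J)%fset B = Z k @^-1` B k `&` cyl J B.
Proof.
apply/seteqP; split=> [w cw|w [wk wJ] i /=].
  split; first by apply: cw; rewrite /= !inE eqxx.
  by move=> i /= iJ; apply: cw; rewrite /= !inE iJ orbT.
by rewrite !inE => /predU1P[-> //|iJ]; exact: wJ.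
Qed.

(** The cylinder over arbitrary later indices makes the induction work: on a rectangle the event
    about [Z k] is moved into the cylinder, and the hypothesis for [k] applies with [k] added to
    [J]. *)
Lemma chain_independent k A (J : {fset nat}) (B : nat -> set V) :
  measurable A -> (forall i, measurable (B i)) -> {in J, forall i, (k <= i)%N} ->
  P (chain k @^-1` A `&` cyl J B) = P (chain k @^-1` A) * P (cyl J B).
Proof.
elim: k A J B => [|k IH] A J B mA mB kJ.
  rewrite /= preimage_cst; case: ifP => _.
    by rewrite setTI probability_setT mul1e.
  by rewrite set0I measure0 mul0e.
have -> : chain k.+1 @^-1` A = (fun w => (chain k w, Z k w)) @^-1` (step @^-1` A).
  by [].
apply: rectangle_independent.
- exact: measurable_chain_pair.
- exact: measurable_cyl.
- move=> D E mD mE.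
  have kNJ : k \notin J by apply/negP => /kJ; rewrite ltnn.
  pose BE i := if i == k then E else B i.
  have mBE i : measurable (BE i) by rewrite /BE; case: ifP.
  have BEk : BE k = E by rewrite /BE eqxx.
  have BEJ : {in J, BE =1 B}.
    by move=> i iJ; rewrite /BE ifN //; apply: contraNneq kNJ => <-.
  have cylE : cyl (k |` J)%fset BE = Z k @^-1` E `&` cyl J B.
    by rewrite cyl1U BEk (cyl_eq BEJ).
  have -> : (fun w => (chain k w, Z k w)) @^-1` (D `*` E) =
            chain k @^-1` D `&` Z k @^-1` E by [].
  have cyl_k : cyl [fset k]%fset BE = Z k @^-1` E.
    by rewrite /cyl set_fset1 bigcap_set1 BEk.
  rewrite -setIA -cylE IH // => [|i]; last first.
    by rewrite !inE => /predU1P[-> //|/kJ/ltnW].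
  rewrite -[X in _ = P (_ `&` X) * _]cyl_k IH // => [|i]; last by rewrite !inE => /eqP ->.
  rewrite -muleA; congr (_ * _).
  rewrite cyl_k [LHS]Zind // big_fsetU1 //= BEk; congr (_ * _).
  rewrite [RHS]Zind //; apply: eq_big_seq => i iJ.
  by rewrite BEJ.
- by rewrite -[X in measurable X]setTI; exact: mstep.
Qed.

(** By independence the law of the pair is a product measure; Tonelli's theorem then freezes the
    state and averages over the next variable alone. *)
Lemma chain_integral k (F : U * V -> \bar R) :
  measurable_fun setT F -> (forall x, 0 <= F x) ->
  \int[P]_w F (chain k w, Z k w) = \int[P]_w \int[P]_w' F (chain k w, Z k w').
Proof.
move=> mF F0.
pose Y := [the {mfun T >-> (U * V)%type} of mfun_Sub (mem_set (measurable_chain_pair k))].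
pose S := [the {mfun T >-> U} of mfun_Sub (mem_set (measurable_chain k))].
have YE C : measurable C ->
    (distribution P S \x distribution P (Z k)) C = distribution P Y C.
  apply: product_measure_unique => A B mA mB.
  have := @chain_independent k A [fset k]%fset (fun=> B) mA (fun=> mB).
  by rewrite /cyl set_fset1 bigcap_set1; apply => i; rewrite !inE => /eqP ->.
rewrite -[LHS]/(\int[P]_w (F \o Y) w) -ge0_integral_distribution //.
rewrite (eq_measure_integral (distribution P S \x distribution P (Z k))); last first.
  by move=> C mC _; exact/esym/YE.
rewrite fubini_tonelli1 // ge0_integral_distribution.
- apply: eq_integral => w _ /=; rewrite /fubini_F.
  rewrite (ge0_integral_distribution (Z k) (f := fun y => F (chain k w, y))) //.
  exact: measurableT_comp.
- exact: measurable_fun_fubini_tonelli_F.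
- by move=> u; apply: integral_ge0.
Qed.

End Chain.

(** * Central limit theorem by Laplace transforms *)

Section RealSequences.
Context {R : realType}.
Implicit Types u : nat -> R.

Lemma cvg_scale (c l : R) u (ul : u n @[n --> \oo] --> l) :
  c * u n @[n --> \oo] --> c * l.
Proof. by apply: cvgM => //; exact: cvg_cst. Qed.

Lemma cvg_invn : n%:R^-1 @[n --> \oo] --> (0 : R).
Proof.
by rewrite -(cvg_shiftS (fun n => n%:R^-1 : R)); exact: cvg_harmonic.
Qed.

Lemma cvg_dominated0 u v : (\forall n \near \oo, `|u n| <= v n) ->
  v n @[n --> \oo] --> 0 -> u n @[n --> \oo] --> 0.
Proof.
move=> uv v0; apply: norm_cvg0.
apply: (squeeze_cvgr _ (cvg_cst 0) v0).
by near=> n; rewrite normr_ge0 /=; near: n.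
Unshelve. all: by end_near. Qed.

End RealSequences.

Section RealExpectation.
Context d (T : measurableType d) (R : realType) (P : probability T R).
Implicit Types (f g : T -> R).

Definition L1 f := P.-integrable [set: T] (EFin \o f).

Lemma L1_measurable f : L1 f -> measurable_fun [set: T] f.
Proof. by move=> /measurable_int /measurable_EFinP. Qed.

Lemma L1_dominated f g : measurable_fun [set: T] f -> L1 g ->
  (forall w, `|f w| <= g w) -> L1 f.
Proof.
move=> mf ig fg; apply: le_integrable ig => //; first exact/measurable_EFinP.
by move=> w _ /=; rewrite lee_fin (le_trans (fg w)) // ler_norm.
Qed.

Lemma L1_cst (c : R) : L1 (fun=> c).
Proof. exact: finite_measure_integrable_cst. Qed.

Lemma L1_bounded f (M : R) : measurable_fun [set: T] f ->
  (forall w, `|f w| <= M) -> L1 f.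
Proof. by move=> mf fM; apply: L1_dominated mf (L1_cst M) fM. Qed.

Lemma L1D f g : L1 f -> L1 g -> L1 (fun w => f w + g w).
Proof. by move=> f1 g1; have := integrableD measurableT f1 g1. Qed.

Lemma L1B f g : L1 f -> L1 g -> L1 (fun w => f w - g w).
Proof. by move=> f1 g1; have := integrableB measurableT f1 g1. Qed.

Lemma L1Z (c : R) f : L1 f -> L1 (fun w => c * f w).
Proof. by move=> f1; have := integrableZl measurableT c f1. Qed.

Lemma Rintegral_cst1 (c : R) : \int[P]_w c = c.
Proof. by rewrite Rintegral_cst // [X in fine X](@probability_setT _ _ _ P) mulr1. Qed.

Lemma EFin_Rintegral f : L1 f -> (\int[P]_w f w)%:E = (\int[P]_w (f w)%:E)%E.
Proof. by move=> f1; rewrite /Rintegral fineK // integrable_fin_num. Qed.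

Lemma Rintegral_dist_le f g h : L1 f -> L1 g -> L1 h ->
  (forall w, `|f w - g w| <= h w) ->
  `|\int[P]_w f w - \int[P]_w g w| <= \int[P]_w h w.
Proof.
move=> f1 g1 h1 fgh; rewrite -RintegralB //.
apply: (le_trans (le_normr_Rintegral measurableT (L1B f1 g1))).
apply: le_Rintegral => //; apply: L1_dominated h1 _.
  by apply/measurableT_comp => //; apply: L1_measurable; exact: L1B.
by move=> w; rewrite normr_id.
Qed.

Lemma dominated_cvg0 (f : nat -> T -> R) g : (forall n, measurable_fun [set: T] (f n)) ->
  L1 g -> (forall n w, `|f n w| <= g w) -> (forall w, f n w @[n --> \oo] --> 0) ->
  \int[P]_w f n w @[n --> \oo] --> 0.
Proof.
move=> mf g1 fg f0.
have [|||||_ _] := @dominated_convergence _ T R P setT measurableT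
  (fun n w => (f n w)%:E) (fun=> 0%E) (EFin \o g).
- by move=> n; exact/measurable_EFinP.
- exact: measurable_cst.
- by apply: aeW => w _; apply/cvg_EFin; [exact: nearW|exact: f0].
- exact: g1.
- by apply: aeW => w n _; rewrite lee_fin.
rewrite integral0 => /fine_cvgP[_]; exact.
Qed.

Lemma fine_prob_bool (b : T -> bool) : measurable [set w | b w] ->
  fine (P [set w | b w]) = \int[P]_w (b w)%:R.
Proof.
move=> mb; rewrite /Rintegral -[X in fine (P X)]setIT -integral_indic //.
congr fine; apply: eq_integral => w _; rewrite indicE; congr (_%:R)%:E.
by congr (nat_of_bool _); apply/idP/idP; rewrite inE.
Qed.

Lemma L1_bool (b : T -> bool) : measurable [set w | b w] -> L1 (fun w => (b w)%:R).
Proof.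
move=> mb; apply: (@L1_bounded _ 1) => [|w].
  rewrite (_ : (fun _ => _) = \1_[set w | b w]); first exact: measurable_indic.
  apply: funext => w; rewrite indicE; congr (_%:R).
  by congr (nat_of_bool _); apply/idP/idP; rewrite inE.
by case: (b w); rewrite ?normr1 ?normr0.
Qed.

End RealExpectation.

(** * Taylor expansions of the heat kernel in space and in time *)

Section HeatKernel.
Context {R : realType}.

Lemma taylor1 (f f1 f2 : R -> R) (M : R) :
  (forall y : R, 0 <= y <= 1 -> is_derive y 1 f (f1 y)) ->
  (forall y : R, 0 <= y <= 1 -> is_derive y 1 f1 (f2 y)) ->
  (forall y, 0 <= y <= 1 -> `|f2 y| <= M) -> `|f 1 - (f 0 + f1 0)| <= M.
Proof.
move=> df df1 fM.
have [t t01] : exists2 t, 0 <= t <= 1 & f 1 - f 0 = f1 (t * 1) * 1.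
  by apply: mean_value0 => t t01; rewrite mulr1; exact/df.
have [t' t'01] : exists2 t', 0 <= t' <= 1 & f1 t - f1 0 = f2 (t' * t) * t.
  apply: mean_value0 => t' t'01; apply: df1; move: t01 t'01; nra.
rewrite !mulr1 => E1 E0.
have -> : f 1 - (f 0 + f1 0) = f2 (t' * t) * t by rewrite -E1 opprD addrA E0.
have f2M : `|f2 (t' * t)| <= M by apply: fM; move: t01 t'01; nra.
rewrite normrM (le_trans _ f2M) // ler_piMr //.
by case/andP: t01 => t0 t1; rewrite ger0_norm.
Qed.

(** Two remainders are kept because the summands have only second moments: [M3] will be the good one
    for small increments, [2 * M2] for large ones. Both follow from [taylor1] once the quadratic
    term is subtracted. *)
Lemma taylor2 (f f1 f2 f3 : R -> R) (M2 M3 : R) :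
  (forall y : R, is_derive y 1 f (f1 y)) ->
  (forall y : R, is_derive y 1 f1 (f2 y)) ->
  (forall y : R, is_derive y 1 f2 (f3 y)) ->
  (forall y, `|f2 y| <= M2) -> (forall y, `|f3 y| <= M3) ->
  `|f 1 - (f 0 + f1 0 + f2 0 / 2)| <= Num.min (2 * M2) M3.
Proof.
move=> df df1 df2 fM2 fM3.
pose g r := f r - f2 0 / 2 * r ^+ 2.
pose g1 r := f1 r - f2 0 * r.
pose g2 r := f2 r - f2 0.
have dg (y : R) : is_derive y 1 g (g1 y).
  by have dfy := df y; apply: is_derive_eq; rewrite /g1 /GRing.scale /=; field.
have dg1 (y : R) : is_derive y 1 g1 (g2 y).
  by have dfy := df1 y; apply: is_derive_eq; rewrite /g2 /GRing.scale /=; ring.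
have -> : f 1 - (f 0 + f1 0 + f2 0 / 2) = g 1 - (g 0 + g1 0).
  by rewrite /g /g1; field.
apply: (@taylor1 g g1 g2) => // y /andP[y0 y1].
rewrite le_min; apply/andP; split.
  rewrite /g2 mulrDl mul1r; apply: le_trans (ler_normB _ _) _.
  by rewrite lerD.
have [t /andP[t0 t1] E] : exists2 t, 0 <= t <= 1 & f2 y - f2 0 = f3 (t * y) * y.
  by apply: mean_value0 => t _; exact: df2.
rewrite /g2 E normrM (le_trans _ (fM3 (t * y))) // ler_piMr //.
by rewrite ger0_norm.
Qed.

Definition dot (u z : R * R) : R := u.1 * z.1 + u.2 * z.2.

(* The constant factor [(2 pi)^-1] of the heat kernel on the plane is dropped. *)
Definition heat (T : R) (u : R * R) : R := T^-1 * expR (- (sqnorm2 u / (2 * T))).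

Lemma heat_ge0 T u : 0 < T -> 0 <= heat T u.
Proof. by move=> T0; rewrite mulr_ge0 ?expR_ge0 // invr_ge0 ltW. Qed.

Lemma sqnorm2_ge0 (u : R * R) : 0 <= sqnorm2 u.
Proof. by rewrite sqnorm2E addr_ge0 ?sqr_ge0. Qed.

Lemma expR_ge_sqr (q : R) : 0 <= q -> (1 + q / 2) ^+ 2 <= expR q.
Proof.
move=> q0; have -> : expR q = expR (q / 2) ^+ 2.
  by rewrite expr2 -expRD; congr expR; field.
by rewrite ler_pXn2r ?nnegrE ?expR_ge0 ?expR_ge1Dx // addr_ge0 // divr_ge0.
Qed.

(** [taylor2] along the segment from [u] to [u + z]. The bound is uniform in [u], since [expR (- q)]
    absorbs the polynomials in [q] that the derivatives produce, by [expR_ge_sqr]. *)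
Lemma heat_space T (u z : R * R) : 0 < T ->
  `|heat T (u.1 + z.1, u.2 + z.2) - heat T u *
     (1 - dot u z / T + (dot u z ^+ 2 / T ^+ 2 - sqnorm2 z / T) / 2)|
  <= 8 / T * (sqnorm2 z / T) * Num.min 1 (Num.sqrt (sqnorm2 z / T)).
Proof.
move=> T0; set k := sqnorm2 z / T; have T1 : T != 0 by rewrite gt_eqF.
have k0 : 0 <= k by rewrite divr_ge0 ?sqnorm2_ge0 // ltW.
have Ti : 0 <= T^-1 by rewrite invr_ge0 ltW.
pose q r := ((u.1 + r * z.1) ^+ 2 + (u.2 + r * z.2) ^+ 2) / (2 * T).
pose q1 r := ((u.1 + r * z.1) * z.1 + (u.2 + r * z.2) * z.2) / T.
have q0 r : 0 <= q r.
  by rewrite divr_ge0 ?addr_ge0 ?sqr_ge0 // mulr_ge0 // ltW.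
have q1q r : q1 r ^+ 2 <= 2 * q r * k.
  rewrite /q1 /q /k expr_div_n sqnorm2E ler_pdivrMr ?exprn_gt0 //.
  apply: le_trans (cauchy_schwarz2 _ _ _ _) _.
  by rewrite le_eqVlt; apply/orP; left; apply/eqP; field.
pose f r := T^-1 * expR (- q r).
pose f1 r := T^-1 * (- q1 r * expR (- q r)).
pose f2 r := T^-1 * ((q1 r ^+ 2 - k) * expR (- q r)).
pose f3 r := T^-1 * ((3 * k * q1 r - q1 r ^+ 3) * expR (- q r)).
have df (y : R) : is_derive y 1 f (f1 y).
  by apply: is_derive_eq; rewrite /f1 /q1 /q /GRing.scale /=; field.
have df1 (y : R) : is_derive y 1 f1 (f2 y).
  by apply: is_derive_eq; rewrite /f2 /q1 /q /k sqnorm2E /GRing.scale /=; field.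
have df2 (y : R) : is_derive y 1 f2 (f3 y).
  by apply: is_derive_eq; rewrite /f3 /q1 /q /k sqnorm2E /GRing.scale /=; field.
have expq y (c : R) : c <= (1 + q y / 2) ^+ 2 -> c * expR (- q y) <= 1.
  move=> cq; rewrite expRN ler_pdivrMr ?expR_gt0 // mul1r.
  exact: le_trans cq (expR_ge_sqr (q0 y)).
have f2M y : `|f2 y| <= 2 * k / T.
  rewrite /f2 normrM (ger0_norm Ti) mulrC ler_wpM2r // normrM.
  rewrite (ger0_norm (expR_ge0 _)).
  apply: (@le_trans _ _ ((2 * k) * ((q y + 1 / 2) * expR (- q y)))).
    rewrite mulrA ler_wpM2r ?expR_ge0 //.
    have := q1q y; have := sqr_ge0 (q1 y) => h1 h2.
    by rewrite ler_norml; apply/andP; split; nra.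
  apply: ler_piMr; first by rewrite mulr_ge0.
  by apply: expq; have := q0 y; nra.
have f3M y : `|f3 y| <= 8 * (k * Num.sqrt k) / T.
  rewrite /f3 normrM (ger0_norm Ti) mulrC ler_wpM2r //.
  (* Squaring leaves only even powers of [q1 y], to which [q1q] applies; one of the two exponentials
     then absorbs [Q / 2], the other [(Q / 2 + 3 / 4) ^ 2]. *)
  apply: ler_norm_sqr; first by apply: mulr_ge0 => //; exact: mulr_ge0 k0 (sqrtr_ge0 k).
  have -> : (8 * (k * Num.sqrt k)) ^+ 2 = k ^+ 3 * 64.
    transitivity (64 * k ^+ 2 * Num.sqrt k ^+ 2); first by ring.
    by rewrite sqr_sqrtr //; ring.
  have := q0 y; have := q1q y; have := sqr_ge0 (q1 y); have := expq y.
  set e := expR (- q y); move: (q y) (q1 y) => Q Q1 eQ s1 sQ Q0.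
  have -> : ((3 * k * Q1 - Q1 ^+ 3) * e) ^+ 2 =
    Q1 ^+ 2 * (3 * k - Q1 ^+ 2) ^+ 2 * (e * e) by ring.
  have e0 : 0 <= e by exact: expR_ge0.
  have h1 : (3 * k - Q1 ^+ 2) ^+ 2 <= k ^+ 2 * (2 * Q + 3) ^+ 2.
    rewrite -exprMn -subr_ge0 subr_sqr mulr_ge0 //; nra.
  have h2 : Q1 ^+ 2 * (3 * k - Q1 ^+ 2) ^+ 2 <= 2 * Q * k * (k ^+ 2 * (2 * Q + 3) ^+ 2).
    by apply: ler_pM => //; exact: sqr_ge0.
  apply: le_trans (ler_wpM2r (mulr_ge0 e0 e0) h2) _.
  have -> : 2 * Q * k * (k ^+ 2 * (2 * Q + 3) ^+ 2) * (e * e) =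
     k ^+ 3 * (64 * ((Q / 2 * e) * ((Q / 2 + 3 / 4) ^+ 2 * e))) by field.
  rewrite ler_wpM2l ?exprn_ge0 //; apply: ler_piMr => //.
  apply: mulr_ile1.
  - by rewrite mulr_ge0 // divr_ge0.
  - by rewrite mulr_ge0 // sqr_ge0.
  - by apply: eQ; nra.
  - by apply: eQ; rewrite ler_pXn2r ?nnegrE //; lra.
have := taylor2 df df1 df2 f2M f3M.
have -> : f 1 = heat T (u.1 + z.1, u.2 + z.2).
  by rewrite /f /heat sqnorm2E /q !mul1r.
have f0 : f 0 = heat T u by rewrite /f /heat sqnorm2E /q !mul0r !addr0.
have f10 : f1 0 = heat T u * (- dot u z / T).
  by rewrite /f1 /heat sqnorm2E /q /q1 /dot !mul0r !addr0; field.
have f20 : f2 0 = heat T u * (dot u z ^+ 2 / T ^+ 2 - k).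
  by rewrite /f2 /heat sqnorm2E /q /q1 /dot /k sqnorm2E !mul0r !addr0; field.
rewrite f0 f10 f20 => H.
have -> : heat T u * (1 - dot u z / T + (dot u z ^+ 2 / T ^+ 2 - k) / 2) =
   heat T u + heat T u * (- dot u z / T) +
     heat T u * (dot u z ^+ 2 / T ^+ 2 - k) / 2 by field.
apply: le_trans H _.
have c0 : 0 <= 8 / T * k by rewrite mulr_ge0 // divr_ge0 // ltW.
rewrite minr_pMr // mulr1 le_min !ge_min; apply/andP; split; apply/orP.
  left; rewrite (_ : 2 * (2 * k / T) = 4 / T * k); last by field.
  by rewrite ler_wpM2r // ler_wpM2r // ler_nat.
by right; rewrite le_eqVlt; apply/orP; left; apply/eqP; field.
Qed.

(** The first-order term in time is the mean of the second-order term of [heat_space] over a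
    standardized [z], for which [dot u z ^ 2] has mean [|u| ^ 2] and [|z| ^ 2] has mean 2: this is
    the heat equation. *)
Lemma heat_time T u : 0 < T ->
  `|heat (T + 1) u - heat T u * (1 + (sqnorm2 u / T ^+ 2 - 2 / T) / 2)| <= 4 / T ^+ 3.
Proof.
move=> T0.
pose w := sqnorm2 u / 2.
have w0 : 0 <= w by rewrite divr_ge0 ?sqnorm2_ge0.
pose f r := (T + r)^-1 * expR (- (w / (T + r))).
pose f1 r := (w * (T + r)^-1 ^+ 3 - (T + r)^-1 ^+ 2) * expR (- (w / (T + r))).
pose f2 r := (2 * (T + r)^-1 ^+ 3 - 4 * w * (T + r)^-1 ^+ 4 +
  w ^+ 2 * (T + r)^-1 ^+ 5) * expR (- (w / (T + r))).
have Tr r : 0 <= r <= 1 -> T + r != 0.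
  by move=> /andP[r0 _]; rewrite gt_eqF // ltr_wpDr.
have df (y : R) : 0 <= y <= 1 -> is_derive y 1 f (f1 y).
  by move=> /Tr Ty; apply: is_derive_eq; rewrite /f1 /GRing.scale /=; field.
have df1 (y : R) : 0 <= y <= 1 -> is_derive y 1 f1 (f2 y).
  by move=> /Tr Ty; apply: is_derive_eq; rewrite /f2 /GRing.scale /=; field.
have f2M y : 0 <= y <= 1 -> `|f2 y| <= 4 / T ^+ 3.
  move=> y01; have y0 : 0 <= y by case/andP: y01.
  have Ty : 0 < T + y by rewrite ltr_wpDr.
  pose i := (T + y)^-1; pose q := w * i.
  have i0 : 0 <= i by rewrite invr_ge0 ltW.
  have q0 : 0 <= q by rewrite mulr_ge0.
  have -> : f2 y = i ^+ 3 * (4 * ((1 / 2 - q + q ^+ 2 / 4) * expR (- q))).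
    by rewrite /f2 -/i -/q /q; field.
  rewrite normrM (ger0_norm (exprn_ge0 3 i0)) mulrC normrM (@ger0_norm R 4) //.
  rewrite normrM (ger0_norm (expR_ge0 _)) -exprVn.
  apply: ler_pM; rewrite ?exprn_ge0 //.
  - rewrite ler_piMr // expRN ler_pdivrMr ?expR_gt0 // [leRHS]mul1r.
    apply: (le_trans _ (expR_ge_sqr q0)); rewrite ler_norml.
    by apply/andP; split; have := sqr_ge0 q; lra.
  - have : i <= T^-1 by rewrite lef_pV2 ?posrE // lerDl.
    by apply: lerXn2r; rewrite nnegrE // invr_ge0 ltW.
have := taylor1 df df1 f2M.
have -> : f 1 = heat (T + 1) u.
  by rewrite /f /heat /w; congr (_ * expR (- _)); field; rewrite Tr // lexx ler01.
have f0 : f 0 = heat T u.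
  rewrite /f /heat /w addr0; congr (_ * expR (- _)); field.
  by rewrite gt_eqF.
have -> : f1 0 = heat T u * ((sqnorm2 u / T ^+ 2 - 2 / T) / 2).
  rewrite -f0 /f /f1 /w addr0; move: (expR _) => E; field.
  by rewrite gt_eqF.
by rewrite f0 mulrDr mulr1.
Qed.

End HeatKernel.

(** * Standardized vectors and the expected heat kernel *)

Section CentralLimit.
Context d (T : measurableType d) (R : realType) (P : probability T R).

Record standardized (Y : T -> R * R) : Prop := Standardized {
  std_measurable : measurable_fun [set: T] Y;
  std_L1 : L1 P (fun w => sqnorm2 (Y w));
  std_mean1 : \int[P]_w (Y w).1 = 0;
  std_mean2 : \int[P]_w (Y w).2 = 0;
  std_var1 : \int[P]_w (Y w).1 ^+ 2 = 1;
  std_var2 : \int[P]_w (Y w).2 ^+ 2 = 1;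
  std_cov : \int[P]_w ((Y w).1 * (Y w).2) = 0 }.

Lemma measurable_fun1 (Y : T -> R * R) : measurable_fun [set: T] Y ->
  measurable_fun [set: T] (fun w => (Y w).1).
Proof. by move=> mY; apply: measurableT_comp => //; exact: measurable_fst. Qed.

Lemma measurable_fun2 (Y : T -> R * R) : measurable_fun [set: T] Y ->
  measurable_fun [set: T] (fun w => (Y w).2).
Proof. by move=> mY; apply: measurableT_comp => //; exact: measurable_snd. Qed.

Lemma measurable_sqnorm2 (Y : T -> R * R) : measurable_fun [set: T] Y ->
  measurable_fun [set: T] (fun w => sqnorm2 (Y w)).
Proof.
move=> mY; rewrite (_ : (fun w => _) = (fun w => (Y w).1 ^+ 2 + (Y w).2 ^+ 2)).
  apply: measurable_funD; apply: measurable_funX.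
    exact: measurable_fun1.
  exact: measurable_fun2.
by apply: funext => w; rewrite sqnorm2E.
Qed.

Section SecondMoments.
Variable Y : T -> R * R.
Hypothesis mY : measurable_fun [set: T] Y.
Hypothesis Y2 : L1 P (fun w => sqnorm2 (Y w)).

Let m1 := measurable_fun1 mY.
Let m2 := measurable_fun2 mY.

Lemma L1_sqr1 : L1 P (fun w => (Y w).1 ^+ 2).
Proof.
apply: L1_dominated Y2 _; first exact: measurable_funX.
by move=> w; rewrite ger0_norm ?sqr_ge0 // sqnorm2E lerDl sqr_ge0.
Qed.

Lemma L1_sqr2 : L1 P (fun w => (Y w).2 ^+ 2).
Proof.
apply: L1_dominated Y2 _; first exact: measurable_funX.
by move=> w; rewrite ger0_norm ?sqr_ge0 // sqnorm2E lerDr sqr_ge0.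
Qed.

Lemma L1_mul12 : L1 P (fun w => (Y w).1 * (Y w).2).
Proof.
apply: L1_dominated Y2 _; first exact: measurable_funM.
move=> w; rewrite sqnorm2E ler_norml.
have := sqr_ge0 ((Y w).1 + (Y w).2); have := sqr_ge0 ((Y w).1 - (Y w).2).
have := sqr_ge0 (Y w).1; have := sqr_ge0 (Y w).2.
by move=> *; apply/andP; split; lra.
Qed.

Lemma L1_fst : L1 P (fun w => (Y w).1).
Proof.
apply: L1_dominated (L1D (L1_cst P 1) L1_sqr1) _ => // w /=.
have := sqr_ge0 ((Y w).1 - 1); have := sqr_ge0 ((Y w).1 + 1).
by rewrite ler_norml => *; apply/andP; split; have := sqr_ge0 (Y w).1; lra.
Qed.

Lemma L1_snd : L1 P (fun w => (Y w).2).
Proof.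
apply: L1_dominated (L1D (L1_cst P 1) L1_sqr2) _ => // w /=.
have := sqr_ge0 ((Y w).2 - 1); have := sqr_ge0 ((Y w).2 + 1).
by rewrite ler_norml => *; apply/andP; split; have := sqr_ge0 (Y w).2; lra.
Qed.

Lemma Rintegral_quadratic (a b1 b2 c11 c12 c22 : R) (f : T -> R) :
  (forall w, f w = a + b1 * (Y w).1 + b2 * (Y w).2 + c11 * (Y w).1 ^+ 2 +
                   c12 * ((Y w).1 * (Y w).2) + c22 * (Y w).2 ^+ 2) ->
  L1 P f /\ \int[P]_w f w = a + b1 * \int[P]_w (Y w).1 + b2 * \int[P]_w (Y w).2 +
    c11 * \int[P]_w (Y w).1 ^+ 2 + c12 * \int[P]_w ((Y w).1 * (Y w).2) +
    c22 * \int[P]_w (Y w).2 ^+ 2.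
Proof.
move=> /funext ->.
have i0 := L1_cst P a.
have i1 := L1Z b1 L1_fst; have i2 := L1Z b2 L1_snd.
have i3 := L1Z c11 L1_sqr1; have i4 := L1Z c12 L1_mul12; have i5 := L1Z c22 L1_sqr2.
have j1 := L1D i0 i1; have j2 := L1D j1 i2; have j3 := L1D j2 i3.
have j4 := L1D j3 i4; have j5 := L1D j4 i5.
split => //; rewrite (RintegralD measurableT j4 i5) (RintegralD measurableT j3 i4).
rewrite (RintegralD measurableT j2 i3) (RintegralD measurableT j1 i2).
rewrite (RintegralD measurableT i0 i1) Rintegral_cst1.
rewrite (RintegralZl _ measurableT L1_fst) (RintegralZl _ measurableT L1_snd).
rewrite (RintegralZl _ measurableT L1_sqr1) (RintegralZl _ measurableT L1_sqr2).
by rewrite (RintegralZl _ measurableT L1_mul12).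
Qed.

End SecondMoments.

(** Lindeberg's truncated second moment in continuous form: the minimum replaces the indicator of
    large values. *)
Definition trunc_moment (Y : T -> R * R) (t : R) : R :=
  \int[P]_w (sqnorm2 (Y w) * Num.min 1 (Num.sqrt (sqnorm2 (Y w) / t))).

Lemma measurable_heat (Y : T -> R * R) (t : R) : measurable_fun [set: T] Y ->
  measurable_fun [set: T] (fun w => heat t (Y w)).
Proof.
move=> mY; apply: measurable_funM => //; apply: measurableT_comp => //.
apply: measurableT_comp => //; apply: measurable_funM => //.
exact: measurable_sqnorm2.
Qed.

Lemma heat_le (t : R) (u : R * R) : 0 < t -> `|heat t u| <= t^-1.
Proof.
move=> t0; have ti : 0 <= t^-1 by rewrite invr_ge0 ltW.
rewrite ger0_norm ?heat_ge0 // /heat ler_piMr //.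
by rewrite -[leRHS]expR0 ler_expR oppr_le0 divr_ge0 ?sqnorm2_ge0 // mulr_ge0 // ltW.
Qed.

Lemma L1_trunc (Y : T -> R * R) (t : R) : measurable_fun [set: T] Y ->
  L1 P (fun w => sqnorm2 (Y w)) ->
  L1 P (fun w => sqnorm2 (Y w) * Num.min 1 (Num.sqrt (sqnorm2 (Y w) / t))).
Proof.
move=> mY Y2; apply: L1_dominated Y2 _.
  apply: measurable_funM; first exact: measurable_sqnorm2.
  apply: measurable_minr; first exact: measurable_cst.
  apply: measurableT_comp.
    by apply: continuous_measurable_fun; exact: sqrt_continuous.
  by apply: measurable_funM => //; exact: measurable_sqnorm2.
move=> w; have s0 := sqnorm2_ge0 (Y w).
have m0 : 0 <= Num.min 1 (Num.sqrt (sqnorm2 (Y w) / t)).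
  by rewrite le_min ler01 sqrtr_ge0.
by rewrite ger0_norm ?mulr_ge0 // ler_piMr // ge_min lexx.
Qed.

(** Averaging kills the linear term of [heat_space] and turns the quadratic one into the first-order
    term of [heat_time]. The error depends on [s] alone, which will bound all times of the
    telescoping sum from below. *)
Lemma heat_expectation (Y : T -> R * R) (t s : R) (u : R * R) :
  standardized Y -> 0 < s -> s <= t ->
  `|\int[P]_w heat t (u.1 + (Y w).1, u.2 + (Y w).2) - heat (t + 1) u| <=
  8 / s ^+ 2 * trunc_moment Y s + 4 / s ^+ 3.
Proof.
move=> [mY Y2 e1 e2 v1 v2 v12] s0 st; have t0 : 0 < t := lt_le_trans s0 st.
pose f w := heat t u *
  (1 - dot u (Y w) / t + (dot u (Y w) ^+ 2 / t ^+ 2 - sqnorm2 (Y w) / t) / 2).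
have [] := @Rintegral_quadratic Y mY Y2 (heat t u) (- heat t u * u.1 / t)
  (- heat t u * u.2 / t) (heat t u * (u.1 ^+ 2 / t ^+ 2 - 1 / t) / 2)
  (heat t u * (u.1 * u.2 / t ^+ 2)) (heat t u * (u.2 ^+ 2 / t ^+ 2 - 1 / t) / 2) f.
  by move=> w; rewrite /f /dot sqnorm2E; field; rewrite gt_eqF.
move=> f1; rewrite e1 e2 v1 v2 v12 !mulr0 !mulr1 !addr0 => fE.
have -> : \int[P]_w heat t (u.1 + (Y w).1, u.2 + (Y w).2) - heat (t + 1) u =
  (\int[P]_w heat t (u.1 + (Y w).1, u.2 + (Y w).2) - \int[P]_w f w) -
  (heat (t + 1) u - heat t u * (1 + (sqnorm2 u / t ^+ 2 - 2 / t) / 2)).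
  by rewrite fE sqnorm2E; field; rewrite gt_eqF.
apply: le_trans (ler_normB _ _) _; apply: lerD; last first.
  apply: le_trans (heat_time u t0) _; rewrite ler_pM2l //.
  by rewrite lef_pV2 ?posrE ?exprn_gt0 // lerXn2r // nnegrE ltW.
rewrite /trunc_moment -RintegralZl //; last exact: L1_trunc.
apply: Rintegral_dist_le => //.
- apply: (@L1_bounded _ _ _ _ _ t^-1) => [|w]; last exact: heat_le.
  apply: measurable_heat; apply: measurable_fun_pair => /=.
    by apply: measurable_funD => //; exact: measurable_fun1.
  by apply: measurable_funD => //; exact: measurable_fun2.
- by apply: L1Z; exact: L1_trunc.
move=> w; apply: le_trans (heat_space u (Y w) t0) _.
have n0 := sqnorm2_ge0 (Y w).
have ts : t^-1 <= s^-1 by rewrite lef_pV2 ?posrE.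
have ti : 0 <= t^-1 by rewrite invr_ge0 ltW.
rewrite (_ : 8 / t * _ = 8 / t ^+ 2 * sqnorm2 (Y w)); last by field; rewrite gt_eqF.
rewrite [leRHS]mulrA; apply: ler_pM.
- by rewrite mulr_ge0 // divr_ge0 // exprn_ge0 // ltW.
- by rewrite le_min ler01 sqrtr_ge0.
- rewrite ler_wpM2r // ler_pM2l // lef_pV2 ?posrE ?exprn_gt0 //.
  by rewrite lerXn2r // nnegrE ltW.
rewrite le_min !ge_min lexx /=; apply/orP; right.
by apply: ler_wsqrtr; rewrite ler_wpM2l.
Qed.

Lemma trunc_moment_cvg0 (Y : T -> R * R) (s : R) : 0 < s ->
  measurable_fun [set: T] Y -> L1 P (fun w => sqnorm2 (Y w)) ->
  trunc_moment Y (s * n%:R) @[n --> \oo] --> 0.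
Proof.
move=> s0 mY Y2; apply: (dominated_cvg0 _ Y2).
- by move=> n; exact: L1_measurable (L1_trunc _ mY Y2).
- move=> n w; have n0 := sqnorm2_ge0 (Y w).
  have m0 : 0 <= Num.min 1 (Num.sqrt (sqnorm2 (Y w) / (s * n%:R))).
    by rewrite le_min ler01 sqrtr_ge0.
  by rewrite ger0_norm ?mulr_ge0 // ler_piMr // ge_min lexx.
move=> w; have n0 := sqnorm2_ge0 (Y w).
have k0 : sqnorm2 (Y w) / (s * n%:R) @[n --> \oo] --> 0.
  have -> : (fun n => sqnorm2 (Y w) / (s * n%:R)) =
      (fun n => (sqnorm2 (Y w) / s) * n%:R^-1).
    by apply: funext => n; rewrite invfM mulrA.
  by have := cvg_scale (c := sqnorm2 (Y w) / s) cvg_invn; rewrite mulr0.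
have c0 : sqnorm2 (Y w) * Num.sqrt (sqnorm2 (Y w) / (s * n%:R)) @[n --> \oo] --> 0.
  have : Num.sqrt (sqnorm2 (Y w) / (s * n%:R)) @[n --> \oo] --> Num.sqrt (0 : R).
    by apply: continuous_cvg => //; exact: sqrt_continuous.
  rewrite sqrtr0.
  by move=> /(cvg_scale (c := sqnorm2 (Y w))); rewrite mulr0.
apply: (squeeze_cvgr _ (cvg_cst 0) c0).
apply: nearW => n; rewrite mulr_ge0 ?le_min ?ler01 ?sqrtr_ge0 //=.
by rewrite ler_wpM2l // ge_min lexx orbT.
Qed.

End CentralLimit.

(** * Lindeberg's telescoping sum *)

Section Lindeberg.
Context d (T : measurableType d) (R : realType) (P : probability T R).

Lemma identically_distributed_integral dV (V : measurableType dV)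
    (Z : nat -> {RV P >-> V}) (F : V -> \bar R) i j :
  identically_distributed Z -> measurable_fun [set: V] F -> (forall v, (0 <= F v)%E) ->
  (\int[P]_w F (Z i w) = \int[P]_w F (Z j w))%E.
Proof.
move=> Zid mF F0.
rewrite -[LHS]/(\int[P]_w (F \o Z i) w)%E -[RHS]/(\int[P]_w (F \o Z j) w)%E.
rewrite -!ge0_integral_distribution //.
by apply: eq_measure_integral => A mA _; exact: Zid.
Qed.

Variable Z : nat -> {RV P >-> (R * R)%type}.
Hypothesis Zind : mutually_independent Z.
Hypothesis Zid : identically_distributed Z.
Hypothesis Zstd : standardized P (Z 0%N).

Definition psum n w : R * R := (\sum_(i < n) (Z i w).1, \sum_(i < n) (Z i w).2).

Definition addp (s : (R * R) * (R * R)) : R * R := (s.1.1 + s.2.1, s.1.2 + s.2.2).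

Lemma measurable_addp : measurable_fun [set: (R * R) * (R * R)] addp.
Proof.
apply: measurable_fun_pair; apply: measurable_funD; apply: measurableT_comp.
- exact: measurable_fst.
- exact: measurable_fst.
- exact: measurable_fst.
- exact: measurable_snd.
- exact: measurable_snd.
- exact: measurable_fst.
- exact: measurable_snd.
- exact: measurable_snd.
Qed.

Lemma chain_psum n w : chain Z addp (0, 0) n w = psum n w.
Proof.
elim: n => [|n IH] /=; first by rewrite /psum !big_ord0.
by rewrite IH /addp /psum !big_ord_recr.
Qed.

Lemma measurable_psum n : measurable_fun [set: T] (psum n).
Proof.
by apply: measurable_fun_pair; apply: measurable_sum => i;
  [apply: measurable_fun1|apply: measurable_fun2].
Qed.

Lemma measurable_heat_addp t :
  measurable_fun [set: (R * R) * (R * R)] (fun s => heat t (addp s)).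
Proof. exact: measurable_heat measurable_addp. Qed.

(* Lindeberg's replacement argument needs no Gaussian variables: since [heat]
   solves the heat equation, adding a standardized summand to [u] nearly amounts
   to replacing [t] by [t + 1]. *)
Lemma heat_step k (t e : R) : 0 < t ->
  (forall u, `|\int[P]_w heat t (addp (u, Z 0%N w)) - heat (t + 1) u| <= e) ->
  `|\int[P]_w heat t (psum k.+1 w) - \int[P]_w heat (t + 1) (psum k w)| <= e.
Proof.
move=> t0 He.
pose J u := \int[P]_w heat t (addp (u, Z 0%N w)).
have mF : measurable_fun [set: (R * R) * (R * R)] (fun s => (heat t (addp s))%:E).
  by apply/measurable_EFinP; exact: measurable_heat_addp.
have F0 s : (0 <= (heat t (addp s))%:E)%E by rewrite lee_fin heat_ge0.
have LJ u : L1 P (fun w => heat t (addp (u, Z 0%N w))).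
  apply: (@L1_bounded _ _ _ _ _ t^-1) => [|w]; last exact: heat_le.
  apply: (measurableT_comp (measurable_heat_addp t)); exact: measurable_fun_pair.
have JE u : (J u)%:E = (\int[P]_w (heat t (addp (u, Z 0%N w)))%:E)%E.
  by rewrite /J EFin_Rintegral.
have mJ : measurable_fun [set: T] (fun w => J (psum k w)).
  apply/measurable_EFinP; rewrite (_ : EFin \o _ = fun w =>
      (\int[P]_w' (heat t (addp (psum k w, Z 0%N w')))%:E)%E); last first.
    by apply: funext => w /=; rewrite JE.
  apply: (@measurable_fun_fubini_tonelli_F _ _ T T R P
    (fun p => (heat t (addp (psum k p.1, Z 0%N p.2)))%:E)) => //.
  apply/measurable_EFinP; apply: (measurableT_comp (measurable_heat_addp t)).
  apply: measurable_fun_pair.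
    exact: measurableT_comp (measurable_psum k) measurable_fst.
  by apply: measurableT_comp => //; exact: measurable_snd.
have J1 u : `|J u| <= t^-1.
  apply: (le_trans (le_normr_Rintegral measurableT (LJ u))).
  rewrite -[leRHS](Rintegral_cst1 P); apply: le_Rintegral => //.
  - by have := integrable_norm (LJ u).
  - exact: L1_cst.
  - by move=> w _; exact: heat_le.
have LH n s : 0 < s -> L1 P (fun w => heat s (psum n w)).
  move=> s0; apply: (@L1_bounded _ _ _ _ _ s^-1) => [|w]; last exact: heat_le.
  exact: measurable_heat (measurable_psum n).
(* The last summand is integrated out with the partial sum frozen, and identical distribution
   replaces [Z k] by [Z 0]. *)
have -> : \int[P]_w heat t (psum k.+1 w) = \int[P]_w J (psum k w).
  apply: EFin_inj; rewrite !EFin_Rintegral; last 2 first.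
  - by apply: (@L1_bounded _ _ _ _ _ t^-1).
  - exact: LH.
  under eq_integral do rewrite -chain_psum /=.
  rewrite (@chain_integral _ _ _ _ _ _ _ _ Z addp (0, 0) measurable_addp Zind k
    (fun s => (heat t (addp s))%:E)) //.
  apply: eq_integral => w _; rewrite JE chain_psum.
  apply: (@identically_distributed_integral _ _ Z (fun v => (heat t (addp (psum k w, v)))%:E)) => //.
  by apply: (measurableT_comp mF); exact: measurable_fun_pair.
rewrite -[leRHS](Rintegral_cst1 P); apply: Rintegral_dist_le.
- exact: (@L1_bounded _ _ _ _ _ t^-1).
- by apply: LH; rewrite addr_gt0.
- exact: L1_cst.
- by move=> w; exact: He.
Qed.

Lemma telescope_dist (a : nat -> R) (e : R) n :
  (forall k, (k < n)%N -> `|a k.+1 - a k| <= e) -> `|a n - a 0%N| <= n%:R * e.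
Proof.
elim: n => [|n IH] ae; first by rewrite subrr normr0 mul0r.
rewrite (_ : a n.+1 - a 0%N = (a n.+1 - a n) + (a n - a 0%N)); last by ring.
rewrite -natr1 mulrDl mul1r (addrC (n%:R * e)); apply: le_trans (ler_normD _ _) _.
apply: lerD; first exact: ae.
by apply: IH => k kn; apply: ae; exact: leq_trans kn _.
Qed.

Lemma laplace_central_limit (s : R) : 0 < s ->
  \int[P]_w expR (- (sqnorm2 (psum n w) / n%:R / (2 * s))) @[n --> \oo] --> s / (s + 1).
Proof.
move=> s0; have [mZ Z2 _ _ _ _ _] := Zstd.
pose tau n := trunc_moment P (Z 0%N) (s * n%:R).
have Hn n : (0 < n)%N -> `|\int[P]_w expR (- (sqnorm2 (psum n w) / n%:R / (2 * s))) -
    s / (s + 1)| <= s * (8 / s ^+ 2 * tau n + 4 / s ^+ 3 * n%:R^-1).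
  move=> n0; have nR : 0 < n%:R :> R by rewrite ltr0n.
  have sn0 : 0 < s * n%:R by rewrite mulr_gt0.
  (* Time decreases by one for each summand added, from the deterministic value at [k = 0] to the
     wanted expectation at [k = n]. *)
  pose t k := s * n%:R + (n - k)%:R.
  pose a k := \int[P]_w heat (t k) (psum k w).
  pose e := 8 / (s * n%:R) ^+ 2 * tau n + 4 / (s * n%:R) ^+ 3.
  have ae k : (k < n)%N -> `|a k.+1 - a k| <= e.
    move=> kn; have tk : t k = t k.+1 + 1.
      by rewrite /t -addrA natr1 -subSn // subSS.
    have tge : s * n%:R <= t k.+1 by rewrite lerDl.
    rewrite /a tk; apply: heat_step; first exact: lt_le_trans sn0 tge.
    by move=> u; exact: heat_expectation.
  have := telescope_dist ae.
  have an : a n = (s * n%:R)^-1 *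
      \int[P]_w expR (- (sqnorm2 (psum n w) / n%:R / (2 * s))).
    have Le : L1 P (fun w => expR (- (sqnorm2 (psum n w) / n%:R / (2 * s)))).
      apply: (@L1_bounded _ _ _ _ _ 1) => [|w].
        apply: measurableT_comp => //; apply: measurableT_comp => //.
        do 2 apply: measurable_funM => //.
        exact: measurable_sqnorm2 (measurable_psum n).
      rewrite ger0_norm ?expR_ge0 // -[leRHS]expR0 ler_expR oppr_le0.
      by rewrite !divr_ge0 ?sqnorm2_ge0 // mulr_ge0 // ltW.
    rewrite /a -(RintegralZl _ measurableT Le).
    apply: eq_Rintegral => w _; rewrite /heat /t subnn addr0.
    by congr (_ * expR (- _)); field; rewrite !gt_eqF.
  have a0 : a 0%N = (s * n%:R + n%:R)^-1.
    rewrite /a -[RHS](Rintegral_cst1 P); apply: eq_Rintegral => w _.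
    rewrite /heat /t subn0 /psum !big_ord0 sqnorm2E /= expr0n /= addr0 mul0r.
    by rewrite oppr0 expR0 mulr1.
  (* There are [n] errors [e], and normalising multiplies them by [s n]; the factor [n ^ 2] is
     compensated by the powers of [n] in [e]. *)
  rewrite an a0; set I := \int[P]_w _.
  have -> : (s * n%:R)^-1 * I - (s * n%:R + n%:R)^-1 =
      (s * n%:R)^-1 * (I - s / (s + 1)).
    by field; rewrite !gt_eqF // ?addr_gt0.
  rewrite normrM gtr0_norm ?invr_gt0 // mulrC ler_pdivrMr // => H.
  apply: le_trans H _; rewrite le_eqVlt; apply/orP; left; apply/eqP.
  by rewrite /e; field; rewrite !gt_eqF.
apply/subr_cvg0.
apply: (@cvg_dominated0 _ _ (fun n => s * (8 / s ^+ 2 * tau n + 4 / s ^+ 3 * n%:R^-1))).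
  by near=> n; apply: Hn; near: n; exact: nbhs_infty_gt.
have c1 := cvg_scale (c := 8 / s ^+ 2) (trunc_moment_cvg0 s0 mZ Z2).
have c2 := cvg_scale (c := 4 / s ^+ 3) (@cvg_invn R).
have := cvg_scale (c := s) (cvgD c1 c2); rewrite !mulr0 addr0 mulr0; exact.
Unshelve. all: by end_near. Qed.

End Lindeberg.

(** * From moments to distribution functions *)

Section MomentMethod.
Context d (T : measurableType d) (R : realType) (P : probability T R).

Lemma unit_integralX k : unit_integral ('X^k : {poly R}) = k.+1%:R^-1.
Proof.
rewrite (@unit_integral_widen _ k.+1) ?size_polyXn // big_ord_recr /= coefXn eqxx.
rewrite mul1r big1 ?add0r // => i _.
by rewrite coefXn ltn_eqF ?mul0r.
Qed.

Variable V : nat -> T -> R.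
Hypothesis mV : forall n, measurable_fun [set: T] (V n).
Hypothesis V01 : forall n w, 0 <= V n w <= 1.
Hypothesis Vk : forall k, \int[P]_w V n w ^+ k @[n --> \oo] --> (k.+1%:R^-1 : R).

(** By linearity from monomials; integrability accompanies the induction because additivity of the
    integral requires it. *)
Lemma cvg_poly_moment (p : {poly R}) :
  (forall n, L1 P (fun w => p.[V n w])) /\
  \int[P]_w p.[V n w] @[n --> \oo] --> unit_integral p.
Proof.
pose A q := (forall n, L1 P (fun w => q.[V n w])) /\
  \int[P]_w q.[V n w] @[n --> \oo] --> unit_integral q.
suff : A (\sum_(i < size p) p`_i *: 'X^i) by rewrite -poly_def coefK.
apply: (big_ind A); rewrite /A.
- split => [n|].
    by rewrite (_ : (fun w => _) = (fun=> 0)) ?funeqE // => [|w];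
      [exact: L1_cst|rewrite horner0].
  rewrite (unit_integralC 0) (_ : (fun n => _) = (fun=> 0)); first exact: cvg_cst.
  apply: funext => n; rewrite -[RHS](Rintegral_cst1 P); apply: eq_Rintegral => w _.
  by rewrite horner0.
- move=> q r [q1 q2] [r1 r2]; split => [n|].
    rewrite (_ : (fun w => _) = (fun w => q.[V n w] + r.[V n w])); first exact: L1D.
    by apply: funext => w; rewrite hornerD.
  rewrite unit_integralD (_ : (fun n => _) =
    (fun n => \int[P]_w q.[V n w] + \int[P]_w r.[V n w])); first exact: cvgD.
  apply: funext => n; rewrite -(RintegralD measurableT (q1 n) (r1 n)); apply: eq_Rintegral => w _.
  by rewrite hornerD.
- move=> i _; have V1 n : L1 P (fun w => V n w ^+ i).
    apply: (@L1_bounded _ _ _ _ _ 1); first exact: measurable_funX.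
    move=> w; have /andP[v0 v1] := V01 n w.
    by rewrite ger0_norm ?exprn_ge0 // exprn_ile1.
  have E n w : (p`_i *: 'X^i).[V n w] = p`_i * V n w ^+ i by rewrite hornerZ hornerXn.
  split => [n|].
    rewrite (_ : (fun w => _) = (fun w => p`_i * V n w ^+ i)); first exact: L1Z.
    by apply: funext => w; rewrite E.
  rewrite unit_integralZ unit_integralX (_ : (fun n => _) =
    (fun n => p`_i * \int[P]_w V n w ^+ i)); first exact: cvg_scale.
  by apply: funext => n; rewrite -(RintegralZl _ measurableT (V1 n)); apply: eq_Rintegral => w _; rewrite E.
Qed.

Lemma uniform_limit (c : R) : 0 <= c <= 1 ->
  fine (P [set w | c <= V n w]) @[n --> \oo] --> 1 - c.
Proof.
move=> c01; apply/cvgrPdist_le => e e0.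
have e2 : 0 < e / 2 by rewrite divr_gt0.
have [p [q [pc qc pq]]] := step_sandwich c01 e2.
have [p1 p2] := cvg_poly_moment p; have [q1 q2] := cvg_poly_moment q.
have mA n : measurable [set w | c <= V n w].
  rewrite -[X in measurable X]setTI; apply: measurable_fun_le => //.
near=> n.
rewrite fine_prob_bool //.
have ub : \int[P]_w (c <= V n w)%R%:R <= \int[P]_w p.[V n w].
  apply: le_Rintegral => // [||w _]; [exact: L1_bool|exact: p1|].
  by have /andP[] := pq _ (V01 n w).
have lb : \int[P]_w q.[V n w] <= \int[P]_w (c <= V n w)%R%:R.
  apply: le_Rintegral => // [||w _]; [exact: q1|exact: L1_bool|].
  by have /andP[] := pq _ (V01 n w).
have pn : `|unit_integral p - \int[P]_w p.[V n w]| <= e / 2.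
  by near: n; move/cvgrPdist_le : p2; apply.
have qn : `|unit_integral q - \int[P]_w q.[V n w]| <= e / 2.
  by near: n; move/cvgrPdist_le : q2; apply.
move: pn qn; rewrite !ler_norml => /andP[? ?] /andP[? ?].
by apply/andP; split; lra.
Unshelve. all: by end_near. Qed.

End MomentMethod.

Section QuadraticLimit.
Context d (T : measurableType d) (R : realType) (P : probability T R).
Variable Z : nat -> {RV P >-> (R * R)%type}.
Hypothesis Zind : mutually_independent Z.
Hypothesis Zid : identically_distributed Z.
Hypothesis Zstd : standardized P (Z 0%N).

(* [exp (- Q / 2)] is uniform on the unit interval if [Q] is chi-square with two
   degrees of freedom. *)
Lemma quadratic_limit (t : R) :
  fine (P [set w | sqnorm2 (psum Z n w) / n%:R <= t]) @[n --> \oo] -->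
  1 - expR (- (Num.max t 0 / 2)).
Proof.
pose Q n w := sqnorm2 (psum Z n w) / n%:R.
have Q0 n w : 0 <= Q n w by rewrite divr_ge0 ?sqnorm2_ge0.
have [t0|t0] := ltP t 0.
  rewrite mul0r oppr0 expR0 subrr (_ : (fun n => _) = (fun=> 0)); first exact: cvg_cst.
  apply: funext => n; rewrite (_ : [set w | _] = set0) ?measure0 // -subset0 => w /=.
  by rewrite leNgt (lt_le_trans t0 (Q0 n w)).
have mQ n : measurable_fun [set: T] (Q n).
  apply: measurable_funM => //.
  by apply: measurable_sqnorm2; exact: measurable_psum.
have := @uniform_limit _ T R P (fun n w => expR (- (Q n w / 2))) _ _ _ (expR (- (t / 2))).
have -> : (fun n => fine (P [set w | sqnorm2 (psum Z n w) / n%:R <= t])) =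
  (fun n => fine (P [set w | expR (- (t / 2)) <= expR (- (Q n w / 2))])).
  apply: funext => n; congr (fine (P _)); apply/seteqP; split => w /=;
    by rewrite ler_expR lerN2 ler_pM2r.
apply.
- move=> n; apply: measurableT_comp => //; apply: measurableT_comp => //.
  exact: measurable_funM.
- move=> n w; rewrite expR_ge0 -[leRHS]expR0 ler_expR oppr_le0.
  by rewrite divr_ge0.
- case=> [|k].
    rewrite invr1 (_ : (fun n => _) = (fun=> 1)); first exact: cvg_cst.
    apply: funext => n; rewrite -[RHS](Rintegral_cst1 P).
    by apply: eq_Rintegral => w _; rewrite expr0.
  have k0 : 0 < k.+1%:R^-1 :> R by rewrite invr_gt0.
  have := laplace_central_limit Zind Zid Zstd k0.
  have -> : k.+1%:R^-1 / (k.+1%:R^-1 + 1) = k.+2%:R^-1 :> R.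
    have : 0 < k.+1%:R :> R by rewrite ltr0n.
    rewrite -[k.+2%:R]natr1; move: (k.+1%:R) => K K0; field.
    by rewrite !gt_eqF // addr_gt0.
  rewrite (_ : (fun n => _) = (fun n => \int[P]_w expR (- (Q n w / 2)) ^+ k.+1)) //.
  apply: funext => n; apply: eq_Rintegral => w _.
  rewrite -expRM_natl mulrN; congr (expR (- _)).
  have : k.+1%:R != 0 :> R by rewrite pnatr_eq0.
  by rewrite /Q; move: (k.+1%:R) (_ / n%:R) => K q K0; field.
- by rewrite expR_ge0 -[leRHS]expR0 ler_expR oppr_le0 divr_ge0.
Qed.

End QuadraticLimit.

(** * Weak law of large numbers *)

Section LawOfLargeNumbers.
Context d (T : measurableType d) (R : realType) (P : probability T R).
Context dV (V : measurableType dV).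

Lemma exp_dist (x : R) : 0 <= x -> 0 <= x - (1 - expR (- x)) <= x ^+ 2.
Proof.
move=> x0; apply/andP; split.
  by have := expR_ge1Dx (- x); lra.
have : expR (- x) <= (1 + x)^-1.
  by rewrite expRN lef_pV2 ?posrE ?expR_gt0 ?expR_ge1Dx // ltr_wpDr.
have : (1 + x)^-1 <= 1 - x + x ^+ 2.
  rewrite -[leLHS]mul1r ler_pdivrMr ?ltr_wpDr //.
  have : 0 <= x ^+ 3 by rewrite exprn_ge0.
  lra.
lra.
Qed.

(** The two bounds serve dominated convergence: [y] dominates for every [n], including [n = 0], and
    [y ^ 2 / n] gives the pointwise limit. *)
Lemma exp_dist_scaled (n : nat) (y : R) : 0 <= y ->
  0 <= y - n%:R * (1 - expR (- (y / n%:R))) <= y /\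
  ((0 < n)%N -> y - n%:R * (1 - expR (- (y / n%:R))) <= y ^+ 2 / n%:R).
Proof.
move=> y0; case: n => [|n].
  by rewrite mul0r subr0 y0 lexx.
have nR : 0 < n.+1%:R :> R by rewrite ltr0n.
have x0 : 0 <= y / n.+1%:R by rewrite divr_ge0.
have /andP[h1 h2] := exp_dist x0.
have E : y - n.+1%:R * (1 - expR (- (y / n.+1%:R))) =
    n.+1%:R * (y / n.+1%:R - (1 - expR (- (y / n.+1%:R)))).
  by move: (expR _) => z; field; rewrite gt_eqF.
split => [|_].
  apply/andP; split; first by rewrite E mulr_ge0.
  rewrite gerBl mulr_ge0 // subr_ge0.
  by rewrite -[leRHS]expR0 ler_expR oppr_le0.
rewrite E (_ : y ^+ 2 / _ = n.+1%:R * (y / n.+1%:R) ^+ 2); last first.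
  by field; rewrite gt_eqF.
by rewrite ler_pM2l.
Qed.

Lemma exp_dist_cvg0 (y : R) : 0 <= y ->
  y - n%:R * (1 - expR (- (y / n%:R))) @[n --> \oo] --> 0.
Proof.
move=> y0; apply: (@cvg_dominated0 _ _ (fun n => y ^+ 2 * n%:R^-1)).
  near=> n; have [/andP[h1 _] h2] := exp_dist_scaled n y0.
  rewrite ger0_norm //; apply: h2; near: n; exact: nbhs_infty_gt.
by have := cvg_scale (c := y ^+ 2) (@cvg_invn R); rewrite mulr0.
Unshelve. all: by end_near. Qed.

Lemma dist_exprn (a b : R) n : 0 <= a <= 1 -> 0 <= b <= 1 ->
  `|a ^+ n - b ^+ n| <= n%:R * `|a - b|.
Proof.
move=> /andP[a0 a1] /andP[b0 b1]; elim: n => [|n IH].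
  by rewrite subrr normr0 mul0r.
rewrite !exprS (_ : _ - _ = (a - b) * a ^+ n + b * (a ^+ n - b ^+ n)); last by ring.
apply: le_trans (ler_normD _ _) _.
rewrite [leRHS](_ : _ = `|a - b| + n%:R * `|a - b|); last by rewrite -natr1; ring.
rewrite !normrM; apply: lerD.
  by rewrite ler_piMr // ger0_norm ?exprn_ge0 // exprn_ile1.
by apply: le_trans IH; rewrite ger0_norm // ler_piMl.
Qed.

Variable Z : nat -> {RV P >-> V}.
Hypothesis Zind : mutually_independent Z.
Hypothesis Zid : identically_distributed Z.
Variable f : V -> R.
Hypothesis mf : measurable_fun [set: V] f.
Hypothesis f0 : forall v, 0 <= f v.
Hypothesis f1 : L1 P (fun w => f (Z 0%N w)).

Definition fsum n w : R := \sum_(i < n) f (Z i w).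

Let step (s : R * V) : R := s.1 + f s.2.

Let mstep : measurable_fun [set: R * V] step.
Proof.
apply: measurable_funD; first exact: measurable_fst.
exact: measurableT_comp mf measurable_snd.
Qed.

Let chain_fsum n w : chain Z step 0 n w = fsum n w.
Proof.
elim: n => [|n IH] /=; first by rewrite /fsum big_ord0.
by rewrite IH /step /fsum big_ord_recr.
Qed.

Lemma measurable_fsum n : measurable_fun [set: T] (fsum n).
Proof. by apply: measurable_sum => i; exact: measurableT_comp. Qed.

Lemma fsum_ge0 n w : 0 <= fsum n w.
Proof. by apply: sumr_ge0. Qed.

Lemma L1_expN (g : T -> R) : measurable_fun [set: T] g -> (forall w, 0 <= g w) ->
  L1 P (fun w => expR (- g w)).
Proof.
move=> mg g0; apply: (@L1_bounded _ _ _ _ _ 1) => [|w].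
  by apply: measurableT_comp => //; exact: measurableT_comp.
by rewrite ger0_norm ?expR_ge0 // -[leRHS]expR0 ler_expR oppr_le0.
Qed.

(** Independence splits off one factor at a time, through [chain_integral]. *)
Lemma laplace_fsum (c : R) n : 0 <= c ->
  \int[P]_w expR (- (c * fsum n w)) = (\int[P]_w expR (- (c * f (Z 0%N w)))) ^+ n.
Proof.
move=> c0; have Lf k : L1 P (fun w => expR (- (c * fsum k w))).
  apply: L1_expN => [|w]; last by rewrite mulr_ge0 // fsum_ge0.
  by apply: measurable_funM => //; exact: measurable_fsum.
have Lz : L1 P (fun w => expR (- (c * f (Z 0%N w)))).
  apply: L1_expN => [|w]; last by rewrite mulr_ge0.
  by apply: measurable_funM => //; exact: measurableT_comp.
elim: n => [|n IH].
  rewrite expr0 -[RHS](Rintegral_cst1 P); apply: eq_Rintegral => w _.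
  by rewrite /fsum big_ord0 mulr0 oppr0 expR0.
rewrite exprS -IH -(RintegralZl _ measurableT (Lf n)); apply: EFin_inj.
have mF : measurable_fun [set: R * V] (fun s => (expR (- (c * step s)))%:E).
  apply/measurable_EFinP; apply: measurableT_comp => //; apply: measurableT_comp => //.
  exact: measurable_funM.
rewrite EFin_Rintegral //; under eq_integral do rewrite -chain_fsum /=.
rewrite (@chain_integral _ _ _ _ _ _ _ _ Z step 0 mstep Zind n
  (fun s => (expR (- (c * step s)))%:E)) //.
rewrite (EFin_Rintegral (L1Z _ (Lf n))).
apply: eq_integral => w _.
rewrite (@identically_distributed_integral _ _ _ _ _ _ Z
   (fun v => (expR (- (c * step (chain Z step 0 n w, v))))%:E) n 0%N) //; last first.
  have mp : measurable_fun [set: V] (fun v : V => (chain Z step 0 n w : R, v)).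
    exact: measurable_fun_pair.
  by have := measurableT_comp mF mp.
rewrite chain_fsum -EFin_Rintegral.
  congr EFin; rewrite mulrC -(RintegralZl _ measurableT Lz); apply: eq_Rintegral => w' _.
  by rewrite -expRD /step /=; congr expR; ring.
rewrite (_ : (fun _ => _) = (fun w' => expR (- (c * fsum n w)) * expR (- (c * f (Z 0%N w'))))).
  exact: L1Z.
by apply: funext => w'; rewrite -expRD /step /=; congr expR; ring.
Qed.

Let m := \int[P]_w f (Z 0%N w).

(** The [n]-th powers of two numbers of the unit interval differ by at most [n] times their
    distance, and [n (1 - E exp (- c f / n))] tends to [c m] by dominated convergence. A first
    moment suffices, as it must for squares of the coordinates. *)
Lemma laplace_law_of_large_numbers (c : R) : 0 <= c ->
  \int[P]_w expR (- (c * (fsum n w / n%:R))) @[n --> \oo] --> expR (- (c * m)).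
Proof.
move=> c0; have m0 : 0 <= m by apply: Rintegral_ge0.
have cm0 : 0 <= c * m by rewrite mulr_ge0.
have mfZ : measurable_fun [set: T] (fun w => f (Z 0%N w)) by exact: measurableT_comp.
have cf0 w : 0 <= c * f (Z 0%N w) by rewrite mulr_ge0.
pose g n w := c * f (Z 0%N w) - n%:R * (1 - expR (- (c * f (Z 0%N w) / n%:R))).
have Le n : L1 P (fun w => expR (- (c * f (Z 0%N w) / n%:R))).
  apply: L1_expN => [|w]; last by rewrite divr_ge0.
  by do 2 apply: measurable_funM => //.
have Lc := L1Z c f1.
have L1e n : L1 P (fun w => n%:R * (1 - expR (- (c * f (Z 0%N w) / n%:R)))).
  by apply: L1Z; apply: L1B => //; exact: L1_cst.
have g0 : \int[P]_w g n w @[n --> \oo] --> 0.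
  apply: (dominated_cvg0 _ Lc).
  - by move=> n; exact: L1_measurable (L1B Lc (L1e n)).
  - move=> n w; have [/andP[h1 h2] _] := exp_dist_scaled n (cf0 w).
    by rewrite ger0_norm.
  - by move=> w; exact: exp_dist_cvg0.
apply/subr_cvg0.
apply: (@cvg_dominated0 _ _ (fun n => `|(c * m - n%:R * (1 - expR (- (c * m / n%:R)))) -
    \int[P]_w g n w|)).
  near=> n; have n0 : (0 < n)%N by near: n; exact: nbhs_infty_gt.
  have nR : n%:R != 0 :> R by rewrite pnatr_eq0 -lt0n.
  pose b := \int[P]_w expR (- (c * f (Z 0%N w) / n%:R)).
  have cn : 0 <= c / n%:R by rewrite divr_ge0.
  have -> : \int[P]_w expR (- (c * (fsum n w / n%:R))) = b ^+ n.
    transitivity (\int[P]_w expR (- (c / n%:R * fsum n w))).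
      by apply: eq_Rintegral => w _; congr (expR (- _)); ring.
    apply: etrans (laplace_fsum n cn) _; rewrite /b; congr (_ ^+ _).
    by apply: eq_Rintegral => w _; congr (expR (- _)); ring.
  have -> : expR (- (c * m)) = expR (- (c * m / n%:R)) ^+ n.
    by rewrite -expRM_natl; congr expR; field.
  have b1 : b <= 1.
    rewrite -[leRHS](Rintegral_cst1 P); apply: le_Rintegral => // [||w _].
    - exact: Le.
    - exact: L1_cst.
    - by rewrite -[leRHS]expR0 ler_expR oppr_le0 divr_ge0.
  have b0 : 0 <= b by apply: Rintegral_ge0 => w _; exact: expR_ge0.
  apply: (le_trans (dist_exprn _ _ _)); first by rewrite b0.
    by rewrite expR_ge0 -[leRHS]expR0 ler_expR oppr_le0 divr_ge0.
  rewrite le_eqVlt; apply/orP; left; apply/eqP.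
  rewrite distrC -[X in X * _](@ger0_norm R) ?ler0n // -normrM; congr (`|_|).
  rewrite /g (RintegralB measurableT Lc (L1e n)) (RintegralZl _ measurableT f1).
  rewrite (RintegralZl _ measurableT (L1B (L1_cst P 1) (Le n))).
  rewrite (RintegralB measurableT (L1_cst P 1) (Le n)) Rintegral_cst1 -/b -/m.
  by ring.
have := cvg_norm (cvgB (exp_dist_cvg0 cm0) g0); rewrite subrr normr0; exact.
Unshelve. all: by end_near. Qed.

End LawOfLargeNumbers.

Section Comparisons.
Context d (T : measurableType d) (R : realType).

Lemma measurable_lt (f g : T -> R) : measurable_fun [set: T] f ->
  measurable_fun [set: T] g -> measurable [set w | f w < g w].
Proof.
move=> mf mg; have mt : measurable [set true] by [].
by have := measurable_fun_ltr mf mg measurableT mt; rewrite setTI preimage_true.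
Qed.

Lemma measurable_le (f g : T -> R) : measurable_fun [set: T] f ->
  measurable_fun [set: T] g -> measurable [set w | f w <= g w].
Proof.
by move=> mf mg; rewrite -[X in measurable X]setTI; exact: measurable_fun_le.
Qed.

End Comparisons.

(** * Convergence in probability and the largest observation *)

Section WeakLaw.
Context d (T : measurableType d) (R : realType) (P : probability T R).

(** Transfers deviations to the bounded variable [expR (- x)]. The constant is the gap of an upward
    deviation; a downward one gives more, as [expR e - 1 >= 1 - expR (- e)]. *)
Lemma exp_gap (x m e : R) : 0 < e -> e < `|x - m| ->
  expR (- m) * (1 - expR (- e)) <= `|expR (- x) - expR (- m)|.
Proof.
move=> e0; rewrite lter_normr => /orP[xm|xm]; rewrite ler_normr; apply/orP.
  right; rewrite opprB mulrBr mulr1 lerD2l lerN2 -expRD ler_expR; lra.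
left; apply: (@le_trans _ _ (expR (- m) * (expR e - 1))).
  rewrite ler_wpM2l ?expR_ge0 //.
  have := expR_ge1Dx (- e); have := expR_ge1Dx e; have := expR_gt0 e.
  have h : expR e * expR (- e) = 1 by rewrite -expRD subrr expR0.
  have := expR_gt0 (- e); move: (expR e) (expR (- e)) h => a b ab b0 a0 a1 b1; nra.
by rewrite mulrBr mulr1 lerD2r -expRD ler_expR; lra.
Qed.

(** The Laplace transform at 1 and 2 gives two moments of [exp (- average)], to which Chebyshev's
    inequality applies although the average itself may have no variance. *)
Lemma weak_law dV (V : measurableType dV) (Z : nat -> {RV P >-> V}) (f : V -> R) (e : R) :
  mutually_independent Z -> identically_distributed Z ->
  measurable_fun [set: V] f -> (forall v, 0 <= f v) ->
  L1 P (fun w => f (Z 0%N w)) -> 0 < e ->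
  fine (P [set w | e < `|fsum Z f n w / n%:R - \int[P]_w f (Z 0%N w)|])
    @[n --> \oo] --> 0.
Proof.
move=> Zind Zid mf f0 f1 e0; set m := \int[P]_w _.
pose X n w := expR (- (fsum Z f n w / n%:R)); pose v := expR (- m).
have mS n : measurable_fun [set: T] (fun w => fsum Z f n w / n%:R).
  by apply: measurable_funM => //; apply: measurable_fsum.
have mX n : measurable_fun [set: T] (X n).
  by apply: measurableT_comp => //; exact: measurableT_comp.
have X1 n k : L1 P (fun w => X n w ^+ k).
  apply: (@L1_bounded _ _ _ _ _ 1) => [|w]; first exact: measurable_funX.
  rewrite ger0_norm ?exprn_ge0 ?expR_ge0 // exprn_ile1 ?expR_ge0 //.
  by rewrite -[leRHS]expR0 ler_expR oppr_le0 divr_ge0 // fsum_ge0.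
have lim1 : \int[P]_w X n w ^+ 1 @[n --> \oo] --> v.
  have := laplace_law_of_large_numbers Zind Zid mf f0 f1 ler01; rewrite -/m mul1r.
  rewrite (_ : (fun n => _) = (fun n => \int[P]_w X n w ^+ 1)); first exact.
  by apply: funext => n; apply: eq_Rintegral => w _; rewrite expr1 mul1r.
have lim2 : \int[P]_w X n w ^+ 2 @[n --> \oo] --> v ^+ 2.
  have := laplace_law_of_large_numbers Zind Zid mf f0 f1 (@ler0n R 2); rewrite -/m.
  rewrite (_ : expR _ = v ^+ 2); last by rewrite -expRM_natl mulrN.
  rewrite (_ : (fun n => _) = (fun n => \int[P]_w X n w ^+ 2)) //.
  by apply: funext => n; apply: eq_Rintegral => w _; rewrite -expRM_natl mulrN.
pose k := v * (1 - expR (- e)).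
have k0 : 0 < k.
  by rewrite mulr_gt0 ?expR_gt0 // subr_gt0 -[ltRHS]expR0 ltr_expR oppr_lt0.
have c2 n : L1 P (fun w => X n w ^+ 2 - 2 * v * X n w ^+ 1).
  by apply: L1B => //; exact: L1Z.
have c3 n : L1 P (fun w => X n w ^+ 2 - 2 * v * X n w ^+ 1 + v ^+ 2).
  by apply: L1D => //; exact: L1_cst.
(* [X n] tends to [v] in mean square, because its first two moments do. *)
apply: (@cvg_dominated0 _ _ (fun n => k ^- 2 *
   (\int[P]_w X n w ^+ 2 - 2 * v * \int[P]_w X n w ^+ 1 + v ^+ 2))).
  apply: nearW => n; rewrite ger0_norm ?fine_ge0 //.
  have mA : measurable [set w | e < `|fsum Z f n w / n%:R - m|].
    apply: measurable_lt => //; apply: measurableT_comp => //.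
    exact: measurable_funB.
  rewrite fine_prob_bool // -[v ^+ 2](Rintegral_cst1 P).
  rewrite -(RintegralZl _ measurableT (X1 n 1%N)).
  rewrite -(RintegralB measurableT (X1 n 2%N) (L1Z _ (X1 n 1%N))).
  rewrite -(RintegralD measurableT (c2 n) (L1_cst P _)).
  rewrite -(RintegralZl _ measurableT (c3 n)).
  apply: le_Rintegral => // [||w _]; [exact: L1_bool|exact: L1Z|].
  rewrite (_ : _ + v ^+ 2 = (X n w - v) ^+ 2); last by ring.
  case: ltP => [h|_]; last by rewrite mulr_ge0 ?sqr_ge0 // invr_ge0 sqr_ge0.
  rewrite mulrC ler_pdivlMr ?exprn_gt0 // mul1r -[leRHS]real_normK ?num_real //.
  by apply: lerXn2r; rewrite ?nnegrE //; [exact: ltW|exact: exp_gap].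
have lim : \int[P]_w X n w ^+ 2 - 2 * v * \int[P]_w X n w ^+ 1 + v ^+ 2 @[n --> \oo]
    --> v ^+ 2 - 2 * v * v + v ^+ 2.
  by apply: cvgD; [apply: cvgB => //; exact: cvg_scale|exact: cvg_cst].
have := cvg_scale (c := k ^- 2) lim.
by rewrite (_ : k ^- 2 * (v ^+ 2 - 2 * v * v + v ^+ 2) = 0) //; ring.
Qed.

(** The union bound leaves [n] times the indicator of [e n < |z| ^ 2], which is dominated by
    [|z| ^ 2 / e] and vanishes pointwise for large [n]. *)
Lemma max_negligible (Z : nat -> {RV P >-> (R * R)%type}) (e : R) :
  identically_distributed Z -> L1 P (fun w => sqnorm2 (Z 0%N w)) -> 0 < e ->
  fine (P (\big[setU/set0]_(i < n) [set w | e * n%:R < sqnorm2 (Z i w)]))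
    @[n --> \oo] --> 0.
Proof.
move=> Zid Z1 e0.
have mB n : measurable [set v : R * R | e * n%:R < sqnorm2 v].
  apply: measurable_lt => //.
  by apply: (@measurable_sqnorm2 _ _ _ id); exact: measurable_id.
have mA n i : measurable [set w | e * n%:R < sqnorm2 (Z i w)].
  by apply: measurable_lt => //; exact: measurable_sqnorm2.
have PA n i : P [set w | e * n%:R < sqnorm2 (Z i w)] =
    P [set w | e * n%:R < sqnorm2 (Z 0%N w)] by exact: (Zid i 0%N _ (mB n)).
have tend : \int[P]_w (n%:R * (e * n%:R < sqnorm2 (Z 0%N w))%R%:R) @[n --> \oo] --> 0.
  apply: (dominated_cvg0 _ (L1Z e^-1 Z1)).
  - by move=> n; exact: (L1_measurable (L1Z n%:R (@L1_bool _ _ _ P _ (mA n 0%N)))).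
  - move=> n w; have s0 := sqnorm2_ge0 (Z 0%N w).
    case: ltP => [h|_]; last by rewrite mulr0 normr0 mulr_ge0 // invr_ge0 ltW.
    by rewrite mulr1 ger0_norm // mulrC ler_pdivlMr // mulrC ltW.
  - move=> w; apply/cvgrPdist_le => r r0; near=> n.
    have h : sqnorm2 (Z 0%N w) <= e * n%:R.
      by rewrite -ler_pdivrMl //; near: n; exact: nbhs_infty_ger.
    by rewrite ltNge h /= mulr0 subrr normr0 ltW.
apply: cvg_dominated0 tend; apply: nearW => n.
rewrite ger0_norm ?fine_ge0 // RintegralZl //; last exact: L1_bool.
rewrite -fine_prob_bool //.
have PE : (P (\big[setU/set0]_(i < n) [set w | (e * n%:R < sqnorm2 (Z i w))%R]) <=
    \sum_(i < n) P [set w | (e * n%:R < sqnorm2 (Z i w))%R])%E.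
  exact: (Boole_inequality P (A := fun i => [set w | e * n%:R < sqnorm2 (Z i w)])).
rewrite -lee_fin fineK; last first.
  by rewrite fin_num_measure //; exact: bigsetU_measurable.
apply: le_trans PE _; under eq_bigr do rewrite PA.
rewrite EFinM fineK ?fin_num_measure // sumr_const card_ord.
by rewrite mule_natl.
Unshelve. all: by end_near. Qed.

End WeakLaw.

(** * Measurability of the likelihood ratio *)

Section WeightedSup.
Context {R : realType} (n : nat) (rho : R * R -> R).
Hypothesis rho_cont : continuous rho.
Implicit Types (q p : 'I_n -> R) (x : nat -> R * R) (c : R).

Definition wsum x q : R * R := (\sum_(i < n) q i * (x i).1, \sum_(i < n) q i * (x i).2).

(** The single constraint [rho <= 0] on the weighted mean covers both likelihoods: [gap_at]
    prescribes the mean, [gap_cone] puts it in the cone. *)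
Definition weighted_values x : set R :=
  [set \prod_(i < n) (n%:R * q i) | q in
    [set q | [/\ forall i, 0 <= q i, \sum_(i < n) q i = 1 & rho (wsum x q) <= 0]]].

Lemma weighted_values_ub x : ubound (weighted_values x) 1.
Proof.
move=> _ [q [q0 q1 _] <-].
(* For the zero sample the moment constraint is void. *)
apply: (@EL_values_le1 R R^o n (fun=> 0) 0); exists q => //; split => //.
by apply: big1 => i _; rewrite subr0 scaler0.
Qed.

Lemma weighted_sup_ge0 x : 0 <= sup (weighted_values x).
Proof.
have [->|/set0P[s Ss]] := eqVneq (weighted_values x) set0; first by rewrite sup0.
apply: (@le_trans _ _ s); last by apply: ub_le_sup => //; exists 1; exact: weighted_values_ub.
by case: Ss => q [q0 _ _] <-; apply: prodr_ge0 => i _; rewrite mulr_ge0.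
Qed.

(** The slack is strict so that rounded weights can meet the constraints; [0 <= q i <= 1] confines
    the weights to a compact cube. *)
Definition relaxed x c (k : nat) q :=
  [/\ forall i, 0 <= q i <= 1, `|\sum_(i < n) q i - 1| < k.+1%:R^-1,
      rho (wsum x q) < k.+1%:R^-1 & c - k.+1%:R^-1 < \prod_(i < n) (n%:R * q i)].

(** Rational weights with common denominator [N.1], indexed by a countable type so that unions over
    them remain measurable. *)
Definition grid_weight (N : nat * {ffun 'I_n -> nat}) (i : 'I_n) : R := (N.2 i)%:R / N.1%:R.

Lemma cvg_bigsum (F : nat -> 'I_n -> R) (f : 'I_n -> R) :
  (forall i, F N i @[N --> \oo] --> f i) ->
  \sum_(i < n) F N i @[N --> \oo] --> \sum_(i < n) f i.
Proof.
move=> Ff; apply: (@cvg_big R^o _ +%R 0 xpredT add_continuous _ \oo _ (fun i N => F N i)) => i _.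
exact: Ff.
Qed.

Lemma cvg_bigprod (F : nat -> 'I_n -> R) (f : 'I_n -> R) :
  (forall i, F N i @[N --> \oo] --> f i) ->
  \prod_(i < n) F N i @[N --> \oo] --> \prod_(i < n) f i.
Proof.
move=> Ff; apply: (@cvg_big R^o _ *%R 1 xpredT (@mul_continuous R) _ \oo _ (fun i N => F N i)) => i _.
exact: Ff.
Qed.

Lemma relaxed_grid x c k q : (forall i, 0 <= q i) -> \sum_(i < n) q i = 1 ->
  rho (wsum x q) <= 0 -> c - k.+1%:R^-1 < \prod_(i < n) (n%:R * q i) ->
  exists N, relaxed x c k (grid_weight N).
Proof.
move=> q0 q1 qr qc.
pose g N : nat * {ffun 'I_n -> nat} := (N, [ffun i => Num.truncn (N%:R * q i)]).
have qle1 i : q i <= 1.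
  by rewrite -q1 (bigD1 i) //= lerDl sumr_ge0.
have gE N i : (0 < N)%N -> q i - N%:R^-1 <= grid_weight (g N) i <= q i.
  move=> N0; have NR : 0 < N%:R :> R by rewrite ltr0n.
  rewrite /grid_weight /= ffunE ler_pdivlMr // ler_pdivrMr //.
  have := truncn_itv (mulr_ge0 (ler0n R N) (q0 i)) => /andP[h1 h2].
  rewrite mulrC; apply/andP; split; last by rewrite [leRHS]mulrC.
  by rewrite mulrBr divff ?gt_eqF // lerBlDr natr1 ltW.
have gq i : grid_weight (g N) i @[N --> \oo] --> q i.
  apply/subr_cvg0; apply: (@cvg_dominated0 _ _ (fun N => N%:R^-1)); last exact: cvg_invn.
  near=> N; have /(gE N i)/andP[h1 h2] : (0 < N)%N by near: N; exact: nbhs_infty_gt.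
  by rewrite distrC ger0_norm ?subr_ge0 // lerBlDr -lerBlDl.
have k0 : 0 < k.+1%:R^-1 :> R by rewrite invr_gt0 ltr0n.
have c1 : \sum_(i < n) grid_weight (g N) i @[N --> \oo] --> (1 : R).
  by rewrite -q1; exact: cvg_bigsum.
have c2 : rho (wsum x (grid_weight (g N))) @[N --> \oo] --> rho (wsum x q).
  apply: continuous_cvg; first exact: rho_cont.
  have h (f : R * R -> R) : \sum_(i < n) grid_weight (g N) i * f (x i) @[N --> \oo] -->
      \sum_(i < n) q i * f (x i).
    by apply: cvg_bigsum => i; apply: cvgM => //; exact: cvg_cst.
  exact: cvg_pair (h fst) (h snd).
have c3 : \prod_(i < n) (n%:R * grid_weight (g N) i) @[N --> \oo] -->
    \prod_(i < n) (n%:R * q i).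
  by apply: cvg_bigprod => i; exact: cvg_scale.
suff : \forall N \near \oo, relaxed x c k (grid_weight (g N)).
  by move=> /filter_ex[N rN]; exists (g N).
near=> N; split.
- move=> i; have /(gE N i)/andP[h1 h2] : (0 < N)%N by near: N; exact: nbhs_infty_gt.
  by rewrite divr_ge0 //= (le_trans h2).
- near: N; move/cvgrPdist_lt : c1 => /(_ _ k0); apply: filterS => N.
  by rewrite distrC.
- near: N; move/cvgr_lt : c2; apply; exact: le_lt_trans qr k0.
- near: N; move/cvgr_gt : c3; exact.
Unshelve. all: by end_near. Qed.

(** The weights have a cluster point in the cube. By [lim], a bound on a continuous function along
    the sequence passes to that point when the slack tends to 0. *)
Lemma relaxed_limit x c (q : nat -> 'I_n -> R) :
  (forall k, relaxed x c k (q k)) ->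
  exists p, [/\ forall i, 0 <= p i, \sum_(i < n) p i = 1, rho (wsum x p) <= 0 &
    c <= \prod_(i < n) (n%:R * p i)].
Proof.
move=> qk; pose u k : 'rV[R]_n := \row_i q k i.
pose K := [set v : 'rV[R]_n | forall i, `[0, 1]%classic (v ord0 i)].
have cK : compact K.
  exact: (@rV_compact R n (fun=> `[0%R, 1%R]%classic) (fun=> @segment_compact R 0 1)).
have uK : \forall k \near \oo, K (u k).
  by apply: nearW => k i /=; rewrite mxE in_itv /=; have [] := qk k.
have [v [Kv cv]] := cK (u @ \oo) (fmap_proper_filter _ _) uK.
have lim (F : 'rV[R]_n -> R) (b : nat -> R) : continuous F -> b @ \oo --> 0 ->
    (forall k, F (u k) <= b k) -> F v <= 0.
  move=> cF b0 Fb; apply/ler_addgt0Pr => e e0; rewrite add0r.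
  have clF : closed [set r | F r <= e].
    by apply: (@closed_comp _ _ F [set r | r <= e]) => [r _|]; [exact: cF|exact: closed_le].
  have ue : \forall k \near \oo, F (u k) <= e.
    near=> k; rewrite (le_trans (Fb k)) //.
    by near: k; move/cvgr_le : b0; apply.
  by apply: clF; move: cv; rewrite clusterE; apply; exact: ue.
have kn : k.+1%:R^-1 @[k --> \oo] --> (0 : R) by exact: cvg_harmonic.
have cc i : continuous (fun r : 'rV[R]_n => r ord0 i) by move=> r; exact: coord_continuous.
have sum_cont (F : 'I_n -> 'rV[R]_n -> R) : (forall i, continuous (F i)) ->
    continuous (fun r => \sum_(i < n) F i r).
  by move=> Fc; apply: (@continuous_big R^o _ +%R 0 xpredT add_continuous).
have prod_cont (F : 'I_n -> 'rV[R]_n -> R) : (forall i, continuous (F i)) ->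
    continuous (fun r => \prod_(i < n) F i r).
  by move=> Fc; apply: (@continuous_big R^o _ *%R 1 xpredT (@mul_continuous R)).
have comp (h : R -> R) (F : 'rV[R]_n -> R) : continuous h -> continuous F ->
    continuous (fun r => h (F r)).
  by move=> hc Fc r; exact: continuous_comp (Fc r) (hc (F r)).
exists (v ord0); split.
- by move=> i; have := Kv i; rewrite /= in_itv /= => /andP[].
- apply/eqP; rewrite -subr_eq0 -normr_eq0 eq_le normr_ge0 andbT.
  apply: (lim (fun r => `|\sum_(i < n) r ord0 i - 1|) _ _ kn).
    apply: (comp (fun y => `|y - 1|)); last exact: sum_cont.
    by move=> y; apply: cvg_norm; apply: cvgB; [exact: cvg_id|exact: cvg_cst].
  by move=> k; under eq_bigr do rewrite mxE; have [_ /ltW] := qk k.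
- apply: (lim (fun r => rho (wsum x (r ord0))) _ _ kn).
    have h (f : R * R -> R) : continuous (fun r : 'rV[R]_n => \sum_(i < n) r ord0 i * f (x i)).
      apply: sum_cont => i; apply: (comp (fun y => y * f (x i))) => // y.
      by apply: cvgM; [exact: cvg_id|exact: cvg_cst].
    move=> r; apply: (@continuous_comp _ _ _ (fun r : 'rV[R]_n => wsum x (r ord0)) rho).
      exact: cvg_pair (h fst r) (h snd r).
    exact: rho_cont.
  move=> k; rewrite (_ : wsum x (u k ord0) = wsum x (q k)).
    by have [_ _ /ltW] := qk k.
  by congr (_, _); apply: eq_bigr => i _; rewrite mxE.
- rewrite -subr_le0; apply: (lim (fun r => c - \prod_(i < n) (n%:R * r ord0 i)) _ _ kn).
    apply: (comp (fun y => c - y)).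
      by move=> y; apply: cvgB; [exact: cvg_cst|exact: cvg_id].
    apply: prod_cont => i; apply: (comp (fun y => n%:R * y)) => // y.
    by apply: cvgM; [exact: cvg_cst|exact: cvg_id].
  move=> k; under eq_bigr do rewrite mxE.
  by have [_ _ _ h] := qk k; rewrite lerBlDr -lerBlDl ltW.
Unshelve. all: by end_near. Qed.

(* By compactness of the simplex the supremum is attained in the limit of relaxed
   constraints, which rational weights can meet: a countable description. *)
Lemma weighted_sup_geP x c : 0 < c ->
  c <= sup (weighted_values x) <-> forall k, exists N, relaxed x c k (grid_weight N).
Proof.
move=> c0; split => [cs k|rk].
  have ne : weighted_values x !=set0.
    by apply/set0P; apply: contraTneq cs => ->; rewrite sup0 -ltNge.
  have : c - k.+1%:R^-1 < sup (weighted_values x).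
    by apply: lt_le_trans cs; rewrite ltrBlDr ltrDl invr_gt0 ltr0n.
  move=> /(sup_gt ne)[_ [q [q0 q1 qr] <-] qc].
  exact: relaxed_grid qc.
have [N Nk] := choice rk.
have [p [p0 p1 pr pc]] := relaxed_limit Nk.
apply: le_trans pc _; apply: ub_le_sup; last by exists p.
by exists 1; exact: weighted_values_ub.
Qed.

End WeightedSup.

Section RatioMeasurable.
Context d (T : measurableType d) (R : realType).
Variable X : nat -> T -> R * R.
Hypothesis mX : forall i, measurable_fun [set: T] (X i).

Lemma measurable_weighted_sup n (rho : R * R -> R) : continuous rho ->
  measurable_fun [set: R * R] rho ->
  measurable_fun [set: T] (fun w => sup (weighted_values n rho (X^~ w))).
Proof.
move=> rho_cont mrho.
have mrel c k (N : nat * {ffun 'I_n -> nat}) : measurable [set w | relaxed rho (X^~ w) c k (grid_weight N)].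
  (* For fixed grid weights only the constraint on [rho] depends on [w]; the others either all hold
     or make the event empty. *)
  have [gN|gN] := pselect ((forall i : 'I_n, 0 <= grid_weight (R := R) N i <= 1) /\
    `|\sum_(i < n) grid_weight N i - 1| < k.+1%:R^-1 :> R /\
    c - k.+1%:R^-1 < \prod_(i < n) (n%:R * grid_weight N i)).
    rewrite (_ : mkset _ = [set w | rho (wsum (X^~ w) (grid_weight N)) < k.+1%:R^-1]).
      apply: measurable_lt; last exact: measurable_cst.
      apply: measurableT_comp => //; apply: measurable_fun_pair => /=.
        apply: measurable_sum => i; apply: measurable_funM => //.
        exact: measurable_fun1.
      apply: measurable_sum => i; apply: measurable_funM => //.
      exact: measurable_fun2.
    by apply/seteqP; split => w /=; [case|case: gN => ? [? ?]; split].
  rewrite (_ : mkset _ = set0); first exact: measurable0.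
  by rewrite -subset0 => w /= [h1 h2 _ h4]; exact: gN.
have mge c : measurable [set w | c <= sup (weighted_values n rho (X^~ w))].
  have [c0|c0] := leP c 0.
    rewrite (_ : mkset _ = setT); first exact: measurableT.
    by apply/seteqP; split => // w _; exact: le_trans c0 (@weighted_sup_ge0 R n rho (X^~ w)).
  rewrite (_ : mkset _ = \bigcap_k \bigcup_(N : nat * {ffun 'I_n -> nat})
      [set w | relaxed rho (X^~ w) c k (grid_weight N)]); last first.
    apply/seteqP; split => w /=.
      move=> /(@weighted_sup_geP R n rho rho_cont (X^~ w) c c0) h k _.
      by have [N ?] := h k; exists N.
    move=> h; apply/(@weighted_sup_geP R n rho rho_cont (X^~ w) c c0) => k.
    by have [N _ ?] := h k I; exists N.
  apply: bigcap_measurableType => k _; apply: countable_bigcupT_measurable => //.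
apply: (measurability _ (RGenCInfty.measurableE R)) => _ [_ [c ->] <-].
rewrite setTI (_ : _ @^-1` _ = [set w | c <= sup (weighted_values n rho (X^~ w))]) //.
by apply/seteqP; split => w /=; rewrite in_itv /= andbT.
Qed.

Definition gap_at (mu v : R * R) : R := `|v.1 - mu.1| + `|v.2 - mu.2|.

Definition gap_cone (v : R * R) : R := v.1 - v.2.

Lemma wsumE n (x : nat -> R * R) (p : 'I_n -> R) :
  wsum x p = \sum_(i < n) p i *: x i.
Proof. by rewrite sum_pairE. Qed.

Lemma EL_weighted n (x : nat -> R * R) mu :
  EL n x mu = sup (weighted_values n (gap_at mu) x).
Proof.
rewrite /EL; congr sup.
have key (p : 'I_n -> R) : \sum_(i < n) p i = 1 ->
    \sum_(i < n) p i *: (x i - mu) = 0 <-> gap_at mu (wsum x p) <= 0.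
  move=> p1; have -> : \sum_(i < n) p i *: (x i - mu) = wsum x p - mu.
    under eq_bigr do rewrite scalerBr.
    by rewrite sumrB -scaler_suml p1 scale1r wsumE.
  rewrite /gap_at; case: (wsum x p) mu => [a b] [u v] /=; split.
    by move=> [-> ->]; rewrite normr0 addr0.
  move=> h; have [h1 h2] := (normr_ge0 (a - u), normr_ge0 (b - v)).
  have /eqP : `|a - u| = 0 by lra.
  have /eqP : `|b - v| = 0 by lra.
  by rewrite !normr_eq0 => /eqP e2 /eqP e1; congr (_, _).
by apply/seteqP; split => _ [p [p0 p1 pz] <-]; exists p => //; split => //; exact/key.
Qed.

(** Weights are feasible for exactly one [nu], their weighted mean, so the iterated supremum is one
    over the weights with mean in the cone. Empty sets are treated apart, with [sup] equal to 0. *)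
Lemma EL_sup_weighted n (x : nat -> R * R) :
  EL_sup (@order_cone R) n x = sup (weighted_values n gap_cone x).
Proof.
have EL0 nu : 0 <= EL n x nu by rewrite EL_weighted weighted_sup_ge0.
have ub1 : ubound [set EL n x nu | nu in @order_cone R] 1.
  by move=> _ [nu _ <-]; exact: EL_le1.
have ne : [set EL n x nu | nu in @order_cone R] !=set0.
  by exists (EL n x 0); exists 0 => //; rewrite /order_cone /=.
have key (p : 'I_n -> R) : \sum_(i < n) p i = 1 ->
    \sum_(i < n) p i *: (x i - wsum x p) = 0.
  move=> p1; under eq_bigr do rewrite scalerBr.
  by rewrite sumrB -scaler_suml p1 scale1r wsumE subrr.
apply/eqP; rewrite eq_le; apply/andP; split.
  apply: ge_sup => // _ [nu cnu <-].
  rewrite /EL; have [->|/set0P nev] := eqVneq (EL_values n x nu) set0.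
    by rewrite sup0 weighted_sup_ge0.
  apply: ge_sup => // _ [p [p0 p1 pz] <-].
  apply: ub_le_sup; first by exists 1; exact: weighted_values_ub.
  exists p => //; split => //.
  have -> : wsum x p = nu.
    apply/eqP; rewrite -subr_eq0 wsumE; apply/eqP.
    by rewrite -[nu]scale1r -p1 scaler_suml -sumrB -[RHS]pz; apply: eq_bigr => i _; rewrite scalerBr.
  by rewrite /gap_cone subr_le0.
have [->|/set0P nev] := eqVneq (weighted_values n gap_cone x) set0.
  by rewrite sup0; case: ne => s Ss; apply: le_trans (ub_le_sup (ex_intro _ 1 ub1) Ss); case: Ss => nu _ <-.
apply: ge_sup => // _ [p [p0 p1 pg] <-].
apply: (@le_trans _ _ (EL n x (wsum x p))).
  by apply: EL_ge => //; exact: key.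
apply: ub_le_sup; first by exists 1.
by exists (wsum x p) => //; move: pg; rewrite /gap_cone subr_le0.
Qed.

Lemma continuous_fstR : continuous (fun v : R * R => v.1).
Proof. by move=> v; exact: cvg_fst. Qed.

Lemma continuous_sndR : continuous (fun v : R * R => v.2).
Proof. by move=> v; exact: cvg_snd. Qed.

Lemma measurable_EL n mu : measurable_fun [set: T] (fun w => EL n (X^~ w) mu).
Proof.
under eq_fun do rewrite EL_weighted.
apply: measurable_weighted_sup.
  move=> v; apply: cvgD; apply: cvg_norm; apply: cvgB.
  - exact: continuous_fstR.
  - exact: cvg_cst.
  - exact: continuous_sndR.
  - exact: cvg_cst.
apply: measurable_funD; apply: measurableT_comp => //; apply: measurable_funB => //.
Qed.

Lemma measurable_EL_sup n :
  measurable_fun [set: T] (fun w => EL_sup (@order_cone R) n (X^~ w)).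
Proof.
under eq_fun do rewrite EL_sup_weighted.
apply: measurable_weighted_sup.
  by move=> v; apply: cvgB; [exact: continuous_fstR|exact: continuous_sndR].
exact: measurable_funB.
Qed.

Lemma neg2logE (r : R) : neg2log r = if 0 < r then (- 2 * ln r)%:E else +oo%E.
Proof.
rewrite /neg2log; case: ltP => r0; first by rewrite lne_EFin.
by rewrite le0_lneNy // mulrNy ltr0_sg // ?mulN1e // oppr_lt0.
Qed.

Lemma measurable_ell n mu :
  measurable_fun [set: T] (fun w => ell (@order_cone R) n (X^~ w) mu).
Proof.
have mE := measurable_EL n mu; have mS := measurable_EL_sup n.
have m0 : measurable_fun [set: T] (fun _ : T => 0 : R) by exact: measurable_cst.
apply: measurable_fun_ifT => //; first exact: measurable_fun_ltr.
have mr : measurable_fun [set: T]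
    (fun w => EL n (X^~ w) mu / EL_sup (@order_cone R) n (X^~ w)).
  apply: measurable_funM => //.
  have S0 w : 0 <= EL_sup (@order_cone R) n (X^~ w).
    by rewrite EL_sup_weighted weighted_sup_ge0.
  (* Inversion is measurable as the power with exponent -1; [S0] allows the rewriting. *)
  under eq_fun do rewrite -powR_inv1 //.
  exact: measurableT_comp (measurable_powR _) mS.
under eq_fun do rewrite neg2logE.
apply: measurable_fun_ifT => //; first exact: measurable_fun_ltr.
apply/measurable_EFinP; apply: measurable_funM => //.
exact: measurableT_comp.
Qed.

End RatioMeasurable.

(** * Whitening and the limit law *)

Section Whitening.
Context d (T : measurableType d) (R : realType) (P : probability T R).

Lemma mutually_independent_comp dV (V : measurableType dV) dU (U : measurableType dU)
    (X : nat -> {RV P >-> V}) (Z : nat -> {RV P >-> U}) (f : V -> U) :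
  measurable_fun [set: V] f -> (forall i w, Z i w = f (X i w)) ->
  mutually_independent X -> mutually_independent Z.
Proof.
move=> mf ZE Xind J A mA.
have mfA i : measurable (f @^-1` A i) by rewrite -[X in measurable X]setTI; exact: mf.
have E i : Z i @^-1` A i = X i @^-1` (f @^-1` A i).
  by apply/seteqP; split => w /=; rewrite ZE.
under eq_bigcapr do rewrite E.
by rewrite Xind //; apply: eq_bigr => i _; rewrite E.
Qed.

Lemma identically_distributed_comp dV (V : measurableType dV) dU (U : measurableType dU)
    (X : nat -> {RV P >-> V}) (Z : nat -> {RV P >-> U}) (f : V -> U) :
  measurable_fun [set: V] f -> (forall i w, Z i w = f (X i w)) ->
  identically_distributed X -> identically_distributed Z.
Proof.
move=> mf ZE Xid i j A mA.
have mfA : measurable (f @^-1` A) by rewrite -[X in measurable X]setTI; exact: mf.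
have E k : Z k @^-1` A = X k @^-1` (f @^-1` A).
  by apply/seteqP; split => w /=; rewrite ZE.
by rewrite /distribution /pushforward !E; exact: Xid.
Qed.

(** At the vectors [(1, 0)] and [(- M 0 1, M 0 0)] the form takes the values [M 0 0] and [M 0 0]
    times the determinant. *)
Lemma posdef_mx2 (M : 'M[R]_2) : posdef_mx M ->
  [/\ 0 < M 0 0, M 1 0 = M 0 1 & 0 < M 0 0 * M 1 1 - M 0 1 ^+ 2].
Proof.
move=> [sM pM].
have M10 : M 1 0 = M 0 1 by rewrite -[in LHS]sM mxE.
have quad (x y : R) : (x, y) != (0, 0) ->
    0 < M 0 0 * x ^+ 2 + 2 * M 0 1 * x * y + M 1 1 * y ^+ 2.
  move=> xy0; pose u : 'cV[R]_2 := \col_i (if i == 0 then x else y).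
  have u0 : u != 0.
    apply: contraNneq xy0 => /matrixP u0; apply/eqP.
    by have := u0 0 0; have := u0 1 0; rewrite !mxE /= => -> ->.
  have := pM u u0; rewrite !mxE !big_ord_recl big_ord0 !mxE !big_ord_recl !big_ord0 !mxE /=.
  have -> : lift ord0 ord0 = 1 :> 'I_2 by apply: val_inj.
  have -> : ord0 = 0 :> 'I_2 by apply: val_inj.
  rewrite M10 => h; apply: le_lt_trans (lexx 0) _.
  by rewrite (_ : _ + _ = (x * M 0 0 + (y * M 0 1 + 0)) * x +
    ((x * M 0 1 + (y * M 1 1 + 0)) * y + 0)) //; ring.
have n10 : (1, 0) != (0, 0) :> R * R by rewrite xpair_eqE oner_eq0.
have a0 : 0 < M 0 0 by have := quad 1 0 n10; rewrite !(expr1n, mulr1, mulr0, expr0n, addr0).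
split => //; rewrite -(pmulr_rgt0 _ a0).
have := quad (- M 0 1) (M 0 0); rewrite xpair_eqE (gt_eqF a0) andbF => /(_ isT).
by rewrite (_ : _ + _ = M 0 0 * (M 0 0 * M 1 1 - M 0 1 ^+ 2)) //; ring.
Qed.

Lemma standardize (X : nat -> {RV P >-> (R * R)%type}) (mu0 : R * R) :
  (forall i (j : 'I_2), 'E_P[fun w => coord2 (X i w) j]%E = (coord2 mu0 j)%:E) ->
  (forall i, ('E_P[fun w => sqnorm2 (X i w)] < +oo)%E) ->
  (forall i, posdef_mx (covariance_mx (X i))) ->
  exists al be ga : R, [/\ al != 0, be != 0 &
    standardized P (fun w => lower_mx al be ga (X 0%N w - mu0))].
Proof.
move=> Xmean Xmom Xcov.
have mX : measurable_fun [set: T] (X 0%N) by [].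
have X2 : L1 P (fun w => sqnorm2 (X 0%N w)).
  apply/integrableP; split; first by apply/measurable_EFinP; exact: measurable_sqnorm2.
  have := Xmom 0%N; rewrite unlock; apply: le_lt_trans.
  rewrite le_eqVlt; apply/orP; left; apply/eqP; apply: eq_integral => w _ /=.
  by rewrite ger0_norm // sqnorm2_ge0.
have c20 (v : R * R) : coord2 v 0 = v.1 by [].
have c21 (v : R * R) : coord2 v 1 = v.2 by [].
have m1 : \int[P]_w (X 0%N w).1 = mu0.1.
  by have := Xmean 0%N 0; rewrite unlock /Rintegral c20 => ->.
have m2 : \int[P]_w (X 0%N w).2 = mu0.2.
  by have := Xmean 0%N 1; rewrite unlock /Rintegral c21 => ->.
pose C := covariance_mx (X 0%N).
have CE i j : C i j = \int[P]_w ((coord2 (X 0%N w) i - coord2 mu0 i) *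
                               (coord2 (X 0%N w) j - coord2 mu0 j)).
  rewrite /C mxE covariance.unlock !Xmean /=.
  by rewrite unlock.
have [C00 C10 CD] := posdef_mx2 (Xcov 0%N).
rewrite -/C in C00 C10 CD.
set a := C 0 0 in C00 CD; set b := C 0 1 in C10 CD; set e := C 1 1 in CD.
pose D := a * e - b ^+ 2.
(* The inverse Cholesky factor: [al] scales the first coordinate, the regression on it with slope
   [b / a] is removed from the second, and [be] scales the residual of variance [D / a]. *)
pose al := (Num.sqrt a)^-1; pose be := Num.sqrt (a / D).
have al2 : al ^+ 2 = a^-1 by rewrite exprVn sqr_sqrtr // ltW.
have be2 : be ^+ 2 = a / D by rewrite sqr_sqrtr // divr_ge0 // ltW.
have al0 : al != 0 by rewrite invr_eq0 gt_eqF // sqrtr_gt0.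
have be0 : be != 0 by rewrite gt_eqF // sqrtr_gt0 divr_gt0.
exists al, be, (- be * b / a); split => //.
pose Y w := X 0%N w - mu0.
have mY : measurable_fun [set: T] Y.
  rewrite (_ : Y = fun w => ((X 0%N w).1 - mu0.1, (X 0%N w).2 - mu0.2)) //.
  apply: measurable_fun_pair; apply: measurable_funB => //.
    exact: measurable_fun1.
  exact: measurable_fun2.
have Y2 : L1 P (fun w => sqnorm2 (Y w)).
  have [|L _] := @Rintegral_quadratic _ T R P _ mX X2 (mu0.1 ^+ 2 + mu0.2 ^+ 2)
    (- 2 * mu0.1) (- 2 * mu0.2) 1 0 1 (fun w => sqnorm2 (Y w)); last exact: L.
  by move=> w; rewrite /Y sqnorm2E /=; ring.
have y1 : \int[P]_w (Y w).1 = 0.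
  by rewrite (RintegralB measurableT (L1_fst mX X2) (L1_cst P _)) m1 Rintegral_cst1 subrr.
have y2 : \int[P]_w (Y w).2 = 0.
  by rewrite (RintegralB measurableT (L1_snd mX X2) (L1_cst P _)) m2 Rintegral_cst1 subrr.
have y11 : \int[P]_w (Y w).1 ^+ 2 = a.
  by rewrite /a CE; apply: eq_Rintegral => w _; rewrite expr2.
have y22 : \int[P]_w (Y w).2 ^+ 2 = e.
  by rewrite /e CE; apply: eq_Rintegral => w _; rewrite expr2.
have y12 : \int[P]_w ((Y w).1 * (Y w).2) = b by rewrite /b CE.
have quadY := @Rintegral_quadratic _ T R P Y mY Y2.
set ga := - be * b / a.
have gaE : ga = - be * b / a by [].
have a_neq0 : a != 0 by rewrite gt_eqF.
have D_neq0 : D != 0 by rewrite gt_eqF.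
have DE : D = a * e - b ^+ 2 by [].
rewrite -[fun w => lower_mx _ _ _ _]/(fun w => lower_mx al be ga (Y w)).
split.
- have mY1 := measurable_fun1 mY; have mY2 := measurable_fun2 mY.
  apply: measurable_fun_pair; first exact: measurable_funM (measurable_cst al) mY1.
  exact: measurable_funD (measurable_funM (measurable_cst be) mY2)
    (measurable_funM (measurable_cst ga) mY1).
- have [|L _] := quadY 0 0 0 (al ^+ 2 + ga ^+ 2) (2 * be * ga) (be ^+ 2)
    (fun w => sqnorm2 (lower_mx al be ga (Y w))); last exact: L.
  by move=> w; rewrite /lower_mx sqnorm2E /=; ring.
- have [|_ ->] := quadY 0 al 0 0 0 0 (fun w => (lower_mx al be ga (Y w)).1).
    by move=> w; rewrite /lower_mx /=; ring.
  by rewrite y1; ring.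
- have [|_ ->] := quadY 0 ga be 0 0 0 (fun w => (lower_mx al be ga (Y w)).2).
    by move=> w; rewrite /lower_mx /=; ring.
  by rewrite y1 y2; ring.
- have [|_ ->] := quadY 0 0 0 (al ^+ 2) 0 0 (fun w => (lower_mx al be ga (Y w)).1 ^+ 2).
    by move=> w; rewrite /lower_mx /=; ring.
  by rewrite y11 al2; field.
- have [|_ ->] := quadY 0 0 0 (ga ^+ 2) (2 * be * ga) (be ^+ 2)
      (fun w => (lower_mx al be ga (Y w)).2 ^+ 2).
    by move=> w; rewrite /lower_mx /=; ring.
  rewrite y11 y12 y22.
  transitivity (be ^+ 2 * ((a * e - b ^+ 2) / a)); first by rewrite gaE; field.
  by rewrite be2 -DE; field; rewrite a_neq0 D_neq0.
- have [|_ ->] := quadY 0 0 0 (al * ga) (al * be) 0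
      (fun w => (lower_mx al be ga (Y w)).1 * (lower_mx al be ga (Y w)).2).
    by move=> w; rewrite /lower_mx /=; ring.
  by rewrite y11 y12 gaE; field.
Qed.

End Whitening.

(** * Tame samples have probability close to 1 *)

Section TameEvent.
Context d (T : measurableType d) (R : realType) (P : probability T R).
Variable Z : nat -> {RV P >-> (R * R)%type}.
Hypothesis Zind : mutually_independent Z.
Hypothesis Zid : identically_distributed Z.
Hypothesis Zstd : standardized P (Z 0%N).

Lemma log_ratio_psum n w : (0 < n)%N ->
  log_ratio n (Z^~ w) = sqnorm2 (psum Z n w) / n%:R.
Proof.
move=> n0; rewrite /log_ratio /avg sqnorm2E /psum /=; field.
by rewrite pnatr_eq0 -lt0n.
Qed.

(** [weak_law] concerns nonnegative variables, so the mixed moment is recovered from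
    [(v.1 + v.2) ^ 2], whose mean is 2, with error at most [3 del / 4]. Here [M] bounds [Q_n], so
    that [|zbar| ^ 2 |z_i| ^ 2 <= (M / n) (e n)]. *)
Lemma tame_of_bounds n w (M e del : R) : (0 < n)%N -> 0 < del ->
  sqnorm2 (psum Z n w) / n%:R <= M -> M <= del * n%:R -> M * e <= del ^+ 2 -> 0 <= e ->
  (forall i, (i < n)%N -> sqnorm2 (Z i w) <= e * n%:R) ->
  `|fsum Z (fun v => v.1 ^+ 2) n w / n%:R - 1| <= del / 2 ->
  `|fsum Z (fun v => v.2 ^+ 2) n w / n%:R - 1| <= del / 2 ->
  `|fsum Z (fun v => (v.1 + v.2) ^+ 2) n w / n%:R - 2| <= del / 2 ->
  tame_sample n (Z^~ w) del.
Proof.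
move=> n0 d0 QM Mn Me e0 Ze h1 h2 h12.
have nR : 0 < n%:R :> R by rewrite ltr0n.
have := log_ratio_psum w n0; rewrite /log_ratio => Q.
have m2M : avg n (Z^~ w) fst ^+ 2 + avg n (Z^~ w) snd ^+ 2 <= M / n%:R.
  by rewrite ler_pdivlMr // mulrC Q.
have m20 : 0 <= avg n (Z^~ w) fst ^+ 2 + avg n (Z^~ w) snd ^+ 2.
  by rewrite addr_ge0 ?sqr_ge0.
have cross : fsum Z (fun v => (v.1 + v.2) ^+ 2) n w / n%:R =
    avg n (Z^~ w) (fun v => v.1 ^+ 2) + 2 * avg n (Z^~ w) (fun v => v.1 * v.2) +
    avg n (Z^~ w) (fun v => v.2 ^+ 2).
  rewrite -[LHS]/(avg n (Z^~ w) (fun v => (v.1 + v.2) ^+ 2)).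
  rewrite (@avg_quadratic R n (Z^~ w) 0 0 0 1 2 1) //; first by ring.
  by move=> v; ring.
rewrite cross in h12.
split.
- by apply: le_trans m2M _; rewrite ler_pdivrMr.
- move=> i ni; apply: le_trans Me.
  rewrite (_ : M * e = M / n%:R * (e * n%:R)); last by field; rewrite gt_eqF.
  by apply: ler_pM => //; [exact: sqnorm2_ge0|exact: Ze].
- by apply: le_trans h1 _; lra.
- by apply: le_trans h2 _; lra.
move: h1 h2 h12.
rewrite -[fsum Z _ n w / _]/(avg n (Z^~ w) (fun v => v.1 ^+ 2)).
rewrite -[fsum Z (fun v => v.2 ^+ 2) n w / _]/(avg n (Z^~ w) (fun v => v.2 ^+ 2)).
rewrite !ler_norml => /andP[? ?] /andP[? ?] /andP[? ?].
by apply/andP; split; lra.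
Qed.

(** Tightness of [Q_n] comes from its limit law. A measurable [B] containing the bad samples spares
    the measurability of the tame event itself. *)
Lemma tame_sample_likely (del r : R) : 0 < del -> 0 < r ->
  \forall n \near \oo, exists2 B : set T, measurable B /\ fine (P B) <= r &
    forall w, ~ B w -> tame_sample n (Z^~ w) del.
Proof.
move=> d0 r0; have [mZ Z2 e1 e2 v1 v2 v12] := Zstd.
(* One share for each of the three averages, one for the maximum, and two for [Q_n]: the tail of the
   limit law and the convergence to it. *)
have r6 : 0 < r / 6 by rewrite divr_gt0.
have d2 : 0 < del / 2 by rewrite divr_gt0.
(* Then [expR (M / 2) >= 1 + 6 / r], so the limiting tail beyond [M] is at most [r / 6]. *)
pose M := 12 / r.
have M0 : 0 < M by rewrite divr_gt0.
have EM : expR (- (Num.max M 0 / 2)) <= r / 6.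
  rewrite (max_l (ltW M0)) expRN -[leRHS]invrK lef_pV2 ?posrE ?expR_gt0 ?invr_gt0 //.
  apply: le_trans (expR_ge1Dx _); rewrite /M (_ : (r / 6)^-1 = 12 / r / 2).
    by rewrite lerDr.
  by field; rewrite gt_eqF.
pose e := del ^+ 2 / M.
have e0 : 0 < e by rewrite divr_gt0 // exprn_gt0.
have Me : M * e <= del ^+ 2 by rewrite /e mulrC divfK // gt_eqF.
pose f1 (v : R * R) := v.1 ^+ 2; pose f2 (v : R * R) := v.2 ^+ 2.
pose f3 (v : R * R) := (v.1 + v.2) ^+ 2.
have mf1 : measurable_fun [set: R * R] f1 by apply: measurable_funX; exact: measurable_fst.
have mf2 : measurable_fun [set: R * R] f2 by apply: measurable_funX; exact: measurable_snd.
have mf3 : measurable_fun [set: R * R] f3.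
  by apply: measurable_funX; apply: measurable_funD; [exact: measurable_fst|exact: measurable_snd].
have [|L3 E3] := @Rintegral_quadratic _ T R P _ mZ Z2 0 0 0 1 2 1 (fun w => f3 (Z 0%N w)).
  by move=> w; rewrite /f3; ring.
have {}E3 : \int[P]_w f3 (Z 0%N w) = 2 by rewrite E3 v1 v12 v2; ring.
have lim1 := weak_law Zind Zid mf1 (fun v => sqr_ge0 v.1) (L1_sqr1 mZ Z2) d2.
have lim2 := weak_law Zind Zid mf2 (fun v => sqr_ge0 v.2) (L1_sqr2 mZ Z2) d2.
have lim3 := weak_law Zind Zid mf3 (fun v => sqr_ge0 (v.1 + v.2)) L3 d2.
rewrite [\int[P]_w _]v1 in lim1; rewrite [\int[P]_w _]v2 in lim2; rewrite E3 in lim3.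
have limm := max_negligible Zid Z2 e0.
have limq := quadratic_limit Zind Zid Zstd (t := M).
near=> n; have n0 : (0 < n)%N by near: n; exact: nbhs_infty_gt.
have h1 : `|0 - fine (P [set w | del / 2 < `|fsum Z f1 n w / n%:R - 1|])| <= r / 6.
  by near: n; move/cvgrPdist_le : lim1 => /(_ _ r6); exact.
rewrite sub0r normrN in h1.
have h2 : `|0 - fine (P [set w | del / 2 < `|fsum Z f2 n w / n%:R - 1|])| <= r / 6.
  by near: n; move/cvgrPdist_le : lim2 => /(_ _ r6); exact.
rewrite sub0r normrN in h2.
have h3 : `|0 - fine (P [set w | del / 2 < `|fsum Z f3 n w / n%:R - 2|])| <= r / 6.
  by near: n; move/cvgrPdist_le : lim3 => /(_ _ r6); exact.
rewrite sub0r normrN in h3.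
have hm : `|0 - fine (P (\big[setU/set0]_(i < n) [set w | e * n%:R < sqnorm2 (Z i w)]))| <= r / 6.
  by near: n; move/cvgrPdist_le : limm => /(_ _ r6); exact.
rewrite sub0r normrN in hm.
have hq : `|1 - expR (- (Num.max M 0 / 2)) -
    fine (P [set w | sqnorm2 (psum Z n w) / n%:R <= M])| <= r / 6.
  by near: n; move/cvgrPdist_le : limq => /(_ _ r6); exact.
have MN : M <= del * n%:R by rewrite -ler_pdivrMl //; near: n; exact: nbhs_infty_ger.
pose A1 := [set w | del / 2 < `|fsum Z f1 n w / n%:R - 1|].
pose A2 := [set w | del / 2 < `|fsum Z f2 n w / n%:R - 1|].
pose A3 := [set w | del / 2 < `|fsum Z f3 n w / n%:R - 2|].
pose Am := \big[setU/set0]_(i < n) [set w | e * n%:R < sqnorm2 (Z i w)].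
pose Q w := sqnorm2 (psum Z n w) / n%:R.
pose Aq := [set w | M < Q w].
have mA f (c : R) : measurable_fun [set: R * R] f ->
    measurable [set w | del / 2 < `|fsum Z f n w / n%:R - c|].
  move=> mf; apply: measurable_lt => //; apply: measurableT_comp => //.
  by apply: measurable_funB => //; apply: measurable_funM => //; exact: measurable_fsum.
have mA1 : measurable A1 by exact: mA.
have mA2 : measurable A2 by exact: mA.
have mA3 : measurable A3 by exact: mA.
have mAm : measurable Am.
  apply: bigsetU_measurable => i _; apply: measurable_lt => //.
  exact: measurable_sqnorm2.
have mQ : measurable_fun [set: T] Q.
  by apply: measurable_funM => //; apply: measurable_sqnorm2; exact: measurable_psum.
have mAq : measurable Aq by exact: measurable_lt.
have P1 : fine (P A1) <= r / 6 by exact: le_trans (ler_norm _) _.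
have P2 : fine (P A2) <= r / 6 by exact: le_trans (ler_norm _) _.
have P3 : fine (P A3) <= r / 6 by exact: le_trans (ler_norm _) _.
have Pm : fine (P Am) <= r / 6 by exact: le_trans (ler_norm _) _.
have Pq : fine (P Aq) <= r / 6 + r / 6.
  have mQM : measurable [set w | Q w <= M] by exact: measurable_le.
  have -> : P Aq = (1 - P [set w | (Q w <= M)%R])%E.
    rewrite -probability_setC //; congr (P _); apply/seteqP; split => w /=.
      by rewrite /Aq /= => h; apply/negP; rewrite -ltNge.
    by move=> /negP; rewrite -ltNge.
  rewrite fineB ?fin_num_measure //=; move: hq; rewrite ler_norml => /andP[_ hq].
  by apply: le_trans (lerD hq EM); rewrite addrAC subrK.
have PU (A B : set T) : measurable A -> measurable B ->
    fine (P (A `|` B)) <= fine (P A) + fine (P B).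
  move=> mA' mB; rewrite -fineD ?fin_num_measure //; apply: fine_le.
  - by rewrite fin_num_measure //; exact: measurableU.
  - by rewrite fin_numD !fin_num_measure.
  - exact: measureU2.
exists (A1 `|` A2 `|` A3 `|` Am `|` Aq).
  have m12 := measurableU _ _ mA1 mA2; have m123 := measurableU _ _ m12 mA3.
  have m123m := measurableU _ _ m123 mAm; split; first exact: measurableU.
  have -> : r = r / 6 + r / 6 + r / 6 + r / 6 + (r / 6 + r / 6) by field.
  apply: le_trans (PU _ _ m123m mAq) _; apply: lerD Pq.
  apply: le_trans (PU _ _ m123 mAm) _; apply: lerD Pm.
  apply: le_trans (PU _ _ m12 mA3) _; apply: lerD P3.
  by apply: le_trans (PU _ _ mA1 mA2) _; exact: lerD.
move=> w /not_orP[/not_orP[/not_orP[/not_orP[n1 n2] n3] nm] nq].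
apply: (@tame_of_bounds n w M e del) => //; rewrite ?(ltW e0) //.
- by rewrite leNgt; apply/negP.
- move=> i ni; rewrite leNgt; apply/negP => iB; apply: nm.
  rewrite /Am -(bigcup_mkord n (fun i => [set w | e * n%:R < sqnorm2 (Z i w)])).
  by exists i.
- by rewrite leNgt; apply/negP.
- by rewrite leNgt; apply/negP.
- by rewrite leNgt; apply/negP.
Unshelve. all: by end_near. Qed.

End TameEvent.

(** * Comparison of the distribution functions *)

Section LimitLaw.
Context {R : realType}.

(** Absorbs the change of threshold from [t] to [t / (1 - 5 * del)] and [t / (1 + 20 * del)]. *)
Lemma chi_square2_lipschitz (x y : R) :
  `|expR (- (Num.max x 0 / 2)) - expR (- (Num.max y 0 / 2))| <= `|x - y|.
Proof.
wlog xy : x y / x <= y.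
  by move=> h; have [/h//|/ltW/h] := leP x y; rewrite distrC [in leRHS]distrC.
have mxy : Num.max x 0 <= Num.max y 0.
  by rewrite ge_max !le_max xy lexx orbT.
have mm : Num.max y 0 - Num.max x 0 <= y - x.
  by rewrite lerBlDr ge_max; case: (leP x 0) => h; apply/andP; split; lra.
have m0 : 0 <= Num.max x 0 by rewrite le_max lexx orbT.
rewrite [leRHS]distrC (@ger0_norm _ (y - x)) ?subr_ge0 //.
rewrite ger0_norm ?subr_ge0 ?ler_expR ?lerN2 ?ler_pM2r //.
rewrite (_ : expR (- (Num.max y 0 / 2)) = expR (- (Num.max x 0 / 2)) *
  expR (- ((Num.max y 0 - Num.max x 0) / 2))); last first.
  by rewrite -expRD; congr expR; ring.
set b := Num.max y 0 - Num.max x 0 in mm *.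
have b0 : 0 <= b by rewrite subr_ge0.
have e1 : expR (- (Num.max x 0 / 2)) <= 1.
  by rewrite -[leRHS]expR0 ler_expR oppr_le0 divr_ge0.
have e2 := expR_ge1Dx (- (b / 2)); have e3 := expR_ge0 (- (Num.max x 0 / 2)).
move: (expR (- (Num.max x 0 / 2))) (expR (- (b / 2))) e1 e2 e3 => p q p1 q1 p0.
have : p * (1 - q) <= p * (b / 2) by rewrite ler_wpM2l //; lra.
have : p * (b / 2) <= 1 * (b / 2) by rewrite ler_wpM2r // divr_ge0.
lra.
Qed.

(** The three shares of [r] belong to the change of threshold, the convergence at the shifted
    threshold and the exceptional set. *)
Lemma sandwich_dist (l la lb p pa pb q r : R) :
  `|la - l| <= r / 3 -> `|lb - l| <= r / 3 -> `|la - pa| <= r / 3 ->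
  `|lb - pb| <= r / 3 -> p <= pa + q -> pb <= p + q -> q <= r / 3 -> `|l - p| <= r.
Proof.
rewrite !ler_norml => /andP[? ?] /andP[? ?] /andP[? ?] /andP[? ?] *.
by apply/andP; split; lra.
Qed.

End LimitLaw.

Unset Implicit Arguments.

Theorem theorem2p2 (d : measure_display) (T : measurableType d) (R : realType)
  (P : probability T R) (X : nat -> {RV P >-> (R * R)%type}) (mu0 : R * R)
  (X_indep : mutually_independent X)
  (X_ident : identically_distributed X)
  (X_mean : forall i (j : 'I_2),
     'E_P[fun w => coord2 (X i w) j]%E = (coord2 mu0 j)%:E)
  (X_moment : forall i, ('E_P[fun w => sqnorm2 (X i w)] < +oo)%E)
  (X_cov : forall i, posdef_mx (covariance_mx (X i)))
  (mu0_int : interior (@order_cone R) mu0) :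
  cvg_in_distribution P
    (fun n w => ell (@order_cone R) n (fun i => X i w) mu0)
    (chi_square 2).
Proof.
have mX i : measurable_fun [set: T] (X i) by [].
split => [n|t _]; first exact: measurable_ell.
have [al [be [ga [al0 be0 std]]]] := standardize X_mean X_moment X_cov.
pose f v := lower_mx al be ga (v - mu0).
have mf : measurable_fun [set: R * R] f.
  have mf1 : measurable_fun [set: R * R] (fun v : R * R => v.1 - mu0.1).
    by apply: measurable_funB => //; exact: measurable_fst.
  have mf2 : measurable_fun [set: R * R] (fun v : R * R => v.2 - mu0.2).
    by apply: measurable_funB => //; exact: measurable_snd.
  apply: measurable_fun_pair; first exact: measurable_funM (measurable_cst al) mf1.
  exact: measurable_funD (measurable_funM (measurable_cst be) mf2)
    (measurable_funM (measurable_cst ga) mf1).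
have mZ i : measurable_fun [set: T] (fun w => f (X i w)) by exact: measurableT_comp.
pose Z i : {RV P >-> (R * R)%type} :=
  [the {mfun T >-> (R * R)%type} of mfun_Sub (mem_set (mZ i))].
have ZE i w : Z i w = f (X i w) by [].
have Zind := mutually_independent_comp mf ZE X_indep.
have Zid := identically_distributed_comp mf ZE X_ident.
have Zstd : standardized P (Z 0%N) by exact: std.
rewrite chi_square2_cdf.
pose F (s : R) := 1 - expR (- (Num.max s 0 / 2)).
pose L n w := ell (@order_cone R) n (fun i => X i w) mu0.
have mL n : measurable [set w | (L n w <= t%:E)%E].
  rewrite -[X in measurable X]setTI; apply: emeasurable_fun_infty_c => //.
  exact: measurable_ell.
suff limF : fine (P [set w | (L n w <= t%:E)%E]) @[n --> \oo] --> F t.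
  apply/fine_cvgP; split => //; apply: nearW => n.
  by rewrite fin_num_measure //; exact: mL.
apply/cvgrPdist_le => r r0.
have [del0 del00 cone] := mean_in_order_cone ga (interior_order_cone mu0_int) al0 be0.
have [del [d0 d1 dd0 dt]] : exists del, [/\ 0 < del, del <= 1 / 100, del <= del0 &
    20 * del * `|t| <= r / 3].
  (* The last entry bounds both displacements of [t], [5 del |t| / (1 - 5 del)] and
     [20 del |t| / (1 + 20 del)], by [r / 3]; the summand 1 covers [t = 0]. *)
  exists (Num.min (1 / 100) (Num.min del0 (r / (60 * (`|t| + 1))))).
  have t1 : 0 < 60 * (`|t| + 1) by rewrite mulr_gt0 // ltr_wpDl.
  split.
  - by rewrite !lt_min del00 !divr_gt0.
  - by rewrite ge_min lexx.
  - by rewrite !ge_min lexx !orbT.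
  apply: (@le_trans _ _ (20 * (r / (60 * (`|t| + 1))) * `|t|)).
    by rewrite ler_wpM2r // ler_pM2l // !ge_min lexx !orbT.
  rewrite (_ : _ * _ = r / 3 * (`|t| / (`|t| + 1))); last first.
    by field; rewrite gt_eqF // ltr_wpDl.
  by rewrite ler_piMr ?divr_ge0 ?(ltW r0) // ler_pdivrMr ?ltr_wpDl // mul1r lerDl.
have r3 : 0 < r / 3 by rewrite divr_gt0.
have a0 : 0 < 1 - 5 * del by lra.
have b0 : 0 < 1 + 20 * del by lra.
have Fa : `|F (t / (1 - 5 * del)) - F t| <= r / 3.
  rewrite /F opprB addrC -addrA addKr.
  apply: le_trans (chi_square2_lipschitz _ _) _; apply: le_trans dt.
  rewrite (_ : t - _ = - (5 * del / (1 - 5 * del)) * t); last by field; rewrite gt_eqF.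
  rewrite normrM normrN ler_wpM2r // ger0_norm; last by rewrite !divr_ge0 ?mulr_ge0 // ltW.
  by rewrite ler_pdivrMr //; nra.
have Fb : `|F (t / (1 + 20 * del)) - F t| <= r / 3.
  rewrite /F opprB addrC -addrA addKr.
  apply: le_trans (chi_square2_lipschitz _ _) _; apply: le_trans dt.
  rewrite (_ : t - _ = (20 * del / (1 + 20 * del)) * t); last by field; rewrite gt_eqF.
  rewrite normrM ler_wpM2r // ger0_norm; last by rewrite !divr_ge0 ?mulr_ge0 // ltW.
  by rewrite ler_pdivrMr //; nra.
have la := quadratic_limit Zind Zid Zstd (t := t / (1 - 5 * del)).
have lb := quadratic_limit Zind Zid Zstd (t := t / (1 + 20 * del)).
have likely := tame_sample_likely Zind Zid Zstd d0 r3.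
near=> n; have n0 : (0 < n)%N by near: n; exact: nbhs_infty_gt.
have ha : `|F (t / (1 - 5 * del)) -
    fine (P [set w | sqnorm2 (psum Z n w) / n%:R <= t / (1 - 5 * del)])| <= r / 3.
  by near: n; move/cvgrPdist_le : la => /(_ _ r3); exact.
have hb : `|F (t / (1 + 20 * del)) -
    fine (P [set w | sqnorm2 (psum Z n w) / n%:R <= t / (1 + 20 * del)])| <= r / 3.
  by near: n; move/cvgrPdist_le : lb => /(_ _ r3); exact.
have [B [mB PB] tame] : exists2 B : set T, measurable B /\ fine (P B) <= r / 3 &
    forall w, ~ B w -> tame_sample n (Z^~ w) del by near: n; exact: likely.
pose Q w := sqnorm2 (psum Z n w) / n%:R.
have mQ : measurable_fun [set: T] Q.
  by apply: measurable_funM => //; apply: measurable_sqnorm2; exact: measurable_psum.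
have mQs s : measurable [set w | Q w <= s] by exact: measurable_le.
have PU (A C : set T) : measurable A -> measurable C -> A `<=` C `|` B ->
    fine (P A) <= fine (P C) + fine (P B).
  move=> mA mC AC; rewrite -fineD ?fin_num_measure //; apply: fine_le.
  - by rewrite fin_num_measure.
  - by rewrite fin_numD !fin_num_measure.
  - apply: le_trans (measureU2 P mC mB); apply: le_measure => //; apply: mem_set => //.
    exact: measurableU.
(* Off [B] the sample is tame, and [|zbar| ^ 2 <= del <= del0] also puts its mean in the cone. *)
have main w : ~ B w -> exists2 r', L n w = r'%:E &
    Q w * (1 - 5 * del) <= r' <= Q w * (1 + 20 * del).
  move=> /tame tw; rewrite /Q -log_ratio_psum //.
  have dd : 0 < del <= 1 / 100 by rewrite d0.
  have [m2 _ _ _ _] := tw.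
  have cw := cone n (fun i => X i w) n0 (le_trans m2 dd0).
  exact: (@ell_tame R mu0 al be ga del n (fun i => X i w) al0 be0 n0 dd tw cw).
have ub : fine (P [set w | (L n w <= t%:E)%E]) <=
    fine (P [set w | Q w <= t / (1 - 5 * del)]) + fine (P B).
  apply: PU => // w /= Lt; have [Bw|/main[r' Lr /andP[h _]]] := pselect (B w); [by right|left].
  by move: Lt; rewrite Lr lee_fin => r't; rewrite ler_pdivlMr // (le_trans h).
have lo : fine (P [set w | Q w <= t / (1 + 20 * del)]) <=
    fine (P [set w | (L n w <= t%:E)%E]) + fine (P B).
  apply: PU => // w /= Qt; have [Bw|/main[r' Lr /andP[_ h]]] := pselect (B w); [by right|left].
  by rewrite Lr lee_fin (le_trans h) // -ler_pdivlMr.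
exact: sandwich_dist Fa Fb ha hb ub lo PB.
Unshelve. all: by end_near. Qed.
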